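(* Let $\Lambda\subset\mathbb{C}$ be a regular self-similar arc with corner angles $\theta_1,\dots,\theta_{\ell-1}$ and let $s=\dim_H(\Lambda)$ be its Hausdorff dimension. If $\theta_{\min}:=\min\{\theta_p:p=1,\dots,\ell-1\}>0$, then $\Lambda$ is a $t$-quasi-arc for each $t\ge1$, and the $s$-dimensional Hausdorff measure function $f(x)=H^s([z_0,x])$ is a Whitney function on $\Lambda$.
   Context: Identify $\mathbb{R}^2$ with $\mathbb{C}$. Basic figures. Let $\Omega$ be a polygon formed by a sequence of successive segments in the plane, with $\ell+1$ vertices $z_0,z_1,\dots,z_\ell$, such that $z_1,z_{\ell-1}$ lie on the segment $\overline{z_0z_\ell}$ and $z_{\ell-1}$ lies on the segment $\overline{z_1z_\ell}$. Suppose there is a vertex $z_q$ such that all vertices belong to $\Pi=\{z_q\}\cup\overline{z_0z_\ell}\cup\Pi_0$, where $\Pi_0$ is the interior of the triangle $z_0z_\ell z_q$; let $\Pi_1$ be the closure of $\Pi_0$. For $j=1,\dots,\ell$ let $S_j$ be the unique orientation-preserving similitude (of the form $z\mapsto az+b$) with $S_j(z_0)=z_{j-1}$, $S_j(z_\ell)=z_j$. $\Omega$ is a basic figure if moreover: the $S_j$ are contractive; the sets $S_j(\Pi_0)$ are pairwise disjoint; $S_j(z_q)\in\Pi_1$ for all $j$; and $S_j(\Pi_1)\cap(\overline{z_qz_0}\cup\overline{z_qz_\ell})=\emptyset$ for $j\notin\{1,\ell,q,q+1\}$. Standing assumption: $\operatorname{Im}\frac{z_q-z_0}{z_\ell-z_0}>0$.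 Angles (all arguments in $[0,2\pi)$). Corner angle at $z_p$, $1\le p\le\ell-1$: $\theta_p=\arg\frac{S_p(z_q)-z_p}{S_{p+1}(z_q)-z_p}$. Put $\theta_{\min}=\min_p\theta_p$, $\eta_1=\arg\frac{S_q(z_q)-z_q}{z_0-z_q}$, $\eta_2=\arg\frac{z_\ell-z_q}{S_{q+1}(z_q)-z_q}$, $\eta_0=\min(\eta_1,\eta_2)$. The characteristic angle is $\xi=\theta_{\min}+\eta_0$. Regular self-similar arcs. Let $\Lambda$ be the unique nonempty compact set with $\Lambda=\bigcup_{j=1}^\ell S_j(\Lambda)$. If $\Lambda$ is an arc (homeomorphic to $[0,1]$), it is called the self-similar arc generated by $\Omega$; it is ordered from $z_0$ to $z_\ell$, and $S_j(\Lambda)$ is its subarc from $z_{j-1}$ to $z_j$. A regular self-similar arc is a self-similar arc generated by a basic figure with positive characteristic angle. $[x,y]$ denotes the subarc of $\Lambda$ from $x$ to $y$; $H^s$ is $s$-dimensional Hausdorff measure; $|\Lambda(x,y)|$ is the diameter of the subarc of $\Lambda$ between $x$ and $y$. $\Lambda$ is a $t$-quasi-arc if there is $\lambda>0$ with $|\Lambda(x,y)|^t\le\lambda|x-y|$ for all $x,y\in\Lambda$. A function on $\Lambda$ is a Whitney function on $\Lambda$ if it is non-constant and is the restriction to $\Lambda$ of a $C^1$ function $F:\mathbb{R}^2\to\mathbb{R}$ with $\nabla F|_\Lambda\equiv0$. *)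

(* Defs.v *)
From HB Require Import structures.
From mathcomp Require Import all_boot all_order all_algebra.
From mathcomp Require Import all_classical all_reals all_analysis.
From mathcomp Require Import complex.

Set Implicit Arguments.
Unset Strict Implicit.
Unset Printing Implicit Defensive.

Import Order.TTheory GRing.Theory Num.Theory.
Import numFieldNormedType.Exports.

Local Open Scope classical_set_scope.
Local Open Scope ring_scope.

(* [Rcomplex R] is R[i] seen as a real vector space, with the Euclidean norm
   valued in R. Giving it the topology of that norm makes it a normed module
   over R: it is both the field C and the Euclidean plane. *)
Section Rcomplex_normedModType.
Variable R : rcfType.

HB.instance Definition _ :=
  PseudoMetric.copy (Rcomplex R) (pseudoMetric_normed (Rcomplex R)).

HB.instance Definition _ := isPointed.Build (Rcomplex R) 0.

HB.instance Definition _ :=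
  NormedZmod_PseudoMetric_eq.Build R (Rcomplex R) erefl.

Lemma Rcomplex_normrZ (k : R) (x : Rcomplex R) : `|k *: x| = `|k| * `|x|.
Proof.
case: x => a b; rewrite /Num.norm/= !exprMn -mulrDr sqrtrM ?sqr_ge0//.
by rewrite sqrtr_sqr.
Qed.

HB.instance Definition _ :=
  PseudoMetricNormedZmod_Lmodule_isNormedModule.Build R (Rcomplex R)
    Rcomplex_normrZ.

End Rcomplex_normedModType.

Section PlaneGeometry.
Variable R : realType.
Local Notation C := (Rcomplex R).

Definition plane_segment (a b : C) : set C :=
  [set (1 - t) *: a + t *: b | t in `[0, 1]].

Definition triangle (a b c : C) : set C :=
  [set x | exists u v w : R, [/\ 0 <= u, 0 <= v, 0 <= w, u + v + w = 1
                               & x = u *: a + v *: b + w *: c]].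

Definition similitude (S : C -> C) : Prop :=
  exists a b : C, a != 0 /\ forall x, S x = a * x + b.

Definition contractive (S : C -> C) : Prop :=
  exists2 c : R, c < 1 & forall x y, `|S x - S y| <= c * `|x - y|.

(* The argument in [0, 2 pi). It is unspecified at 0. *)
Definition carg (x : C) : R :=
  xget 0 [set t : R | 0 <= t < 2 * pi /\
                      x = `|x| *: ((cos t +i* sin t)%C : C)].

End PlaneGeometry.

(* Vertices [z] and maps [S] are sequences of which only [z 0, ..., z l] and
   [S 1, ..., S l] matter. *)
Section BasicFigures.
Variable R : realType.
Local Notation C := (Rcomplex R).
Variables (l q : nat) (z : nat -> C) (S : nat -> C -> C).

Definition open_triangle : set C := interior (triangle (z 0) (z l) (z q)).

Definition closed_triangle : set C := closure open_triangle.

(* As similitudes are not constant, the conditions on [S j] force the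
   segments from [z j.-1] to [z j] to be nondegenerate. In [bf_polygon], a
   polygon is understood not to fold back on itself: consecutive sides share
   only their common vertex. Otherwise the two copies of the arc along a pair
   of overlapping sides may come arbitrarily close to each other. *)
Record basic_figure : Prop := BasicFigure {
  bf_polygon : forall p, (1 <= p < l)%N ->
    plane_segment (z p.-1) (z p) `&` plane_segment (z p) (z p.+1) = [set z p] ;
  bf_apex : (q <= l)%N ;
  bf_first : plane_segment (z 0) (z l) (z 1) ;
  bf_last : plane_segment (z 0) (z l) (z l.-1) ;
  bf_order : plane_segment (z 1) (z l) (z l.-1) ;
  bf_vertices : forall j, (j <= l)%N ->
    ([set z q] `|` plane_segment (z 0) (z l) `|` open_triangle) (z j) ;
  bf_similitude : forall j, (1 <= j <= l)%N -> similitude (S j) ;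
  bf_start : forall j, (1 <= j <= l)%N -> S j (z 0) = z j.-1 ;
  bf_end : forall j, (1 <= j <= l)%N -> S j (z l) = z j ;
  bf_contractive : forall j, (1 <= j <= l)%N -> contractive (S j) ;
  bf_disjoint : trivIset [set j | (1 <= j <= l)%N]
                         (fun j => S j @` open_triangle) ;
  bf_apex_image : forall j, (1 <= j <= l)%N -> closed_triangle (S j (z q)) ;
  bf_sides : forall j, (1 <= j <= l)%N -> j \notin [:: 1; l; q; q.+1]%N ->
    (S j @` closed_triangle) `&`
      (plane_segment (z q) (z 0) `|` plane_segment (z q) (z l)) = set0
}.

Definition positively_oriented : Prop :=
  0 < complex.Im ((z q - z 0) / (z l - z 0)).

Definition corner_angle (p : nat) : R :=
  carg ((S p (z q) - z p) / (S p.+1 (z q) - z p)).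

(* Only used for [2 <= l], where the seed [corner_angle 1] is one of the
   terms. *)
Definition theta_min : R :=
  \big[Order.min/corner_angle 1]_(1 <= p < l) corner_angle p.

Definition eta1 : R := carg ((S q (z q) - z q) / (z 0 - z q)).

Definition eta2 : R := carg ((z l - z q) / (S q.+1 (z q) - z q)).

Definition characteristic_angle : R := theta_min + Order.min eta1 eta2.

Definition attractor (L : set C) : Prop :=
  [/\ compact L, L !=set0
    & L = \bigcup_(j in [set j | (1 <= j <= l)%N]) (S j @` L)].

End BasicFigures.

Section Arcs.
Variable R : realType.
Local Notation C := (Rcomplex R).

Definition arc_parametrization (L : set C) (gamma : R -> C) : Prop :=
  exists g : C -> R,
    [/\ {within `[0, 1], continuous gamma} /\ {within L, continuous g},
        {homo gamma : t / `[0, 1]%classic t >-> L t} /\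
          {homo g : x / L x >-> `[0, 1]%classic x},
        forall t, `[0, 1]%classic t -> g (gamma t) = t
      & forall x, L x -> gamma (g x) = x].

Definition is_arc (L : set C) : Prop := exists gamma, arc_parametrization L gamma.

(* The points of the arc [L] between [x] and [y]. This does not depend on the
   parametrization, nor on the orientation of [L]. *)
Definition subarc (L : set C) (x y : C) : set C :=
  [set w | exists2 gamma, arc_parametrization L gamma &
    exists a b t : R, [/\ 0 <= a <= 1, 0 <= b <= 1,
      x = gamma a /\ y = gamma b, Order.min a b <= t <= Order.max a b
      & w = gamma t]].

Definition regular_self_similar_arc (l q : nat) (z : nat -> C)
    (S : nat -> C -> C) (L : set C) : Prop :=
  [/\ basic_figure l q z S, positively_oriented l q z, attractor l S L,
      is_arc L & 0 < characteristic_angle l q z S].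

End Arcs.

Section HausdorffMeasure.
Variable R : realType.
Local Notation C := (Rcomplex R).
Local Open Scope ereal_scope.

(* [diam set0] is [-oo]. *)
Definition diam (U : set C) : \bar R :=
  ereal_sup [set `|x.1 - x.2|%:E | x in U `*` U].

(* [|U|^s], with [|set0|^s = 0] even for [s = 0]; [0 `^ 0 = 1]. *)
Definition diam_pow (s : R) (U : set C) : \bar R :=
  if U == set0 then 0 else diam U `^ s.

Definition hausdorff_premeasure (s delta : R) (A : set C) : \bar R :=
  ereal_inf [set \sum_(0 <= i <oo) diam_pow s (U i) | U in
    [set U : nat -> set C |
      A `<=` \bigcup_i U i /\ forall i, diam (U i) <= delta%:E]].

(* The premeasure increases as [delta] decreases to 0. *)
Definition hausdorff_measure (s : R) (A : set C) : \bar R :=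
  ereal_sup [set hausdorff_premeasure s delta A | delta in
    [set delta : R | (0 < delta)%R]].

Definition hausdorff_dim (A : set C) : \bar R :=
  ereal_inf [set s%:E | s in [set s : R |
    (0 <= s)%R /\ hausdorff_measure s A = 0]].

Definition quasi_arc (t : R) (L : set C) : Prop :=
  exists2 lambda : R, (0 < lambda)%R & forall x y, L x -> L y ->
    diam_pow t (subarc L x y) <= (lambda * `|x - y|)%:E.

End HausdorffMeasure.

Section WhitneyFunctions.
Variable R : realType.
Local Notation C := (Rcomplex R).

Definition gradient (F : C -> R) (x : C) : C :=
  ('D_((1 +i* 0)%C : C) F x +i* 'D_((0 +i* 1)%C : C) F x)%C.

Definition C1 (F : C -> R) : Prop :=
  (forall x, differentiable F x) /\ continuous (gradient F).

Definition whitney_function (L : set C) (f : C -> R) : Prop :=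
  (exists x y, [/\ L x, L y & f x != f y]) /\
  exists F : C -> R, [/\ C1 F, forall x, L x -> F x = f x
                       & forall x, L x -> gradient F x = 0].

End WhitneyFunctions.

(* Main.v *)
(* Reading the similitudes in a parametrization [gam] of the arc turns them into
   increasing maps onto consecutive subintervals: two copies of the arc cannot
   share a subarc, for it would contain a small copy of the three vertices, hence
   of the whole triangle by convexity, and the open triangles would overlap.
   Positive corner angles make the sectors of two successive triangles meet only
   at their common vertex, so points [x], [y] of successive copies satisfy
   |x - y| >= kap |x - z_p|, while copies that are not successive stay apart.
   Zooming in on the smallest copy containing two points, every quantity on
   subarcs that is subadditive and scales like a power sg of the distance is then
   bounded by a constant times |x - y|^sg. This applies to the diameter (whence
   bounded turning), to the natural measure of the arc (whence a lower bound of
   its Hausdorff measure by mass distribution, so that its dimension is the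
   similarity dimension, which exceeds 1 by the triangle inequality), and to the
   Hausdorff measure itself, which gives |f x - f y| <= c |x - y|^s with s > 1;
   Whitney's extension theorem for zero gradients concludes. *)

Require Import Defs.
From HB Require Import structures.
From mathcomp Require Import all_boot all_order all_algebra.
From mathcomp Require Import all_classical all_reals all_analysis.
From mathcomp Require Import complex.
From mathcomp Require Import ring lra.

Set Implicit Arguments.
Unset Strict Implicit.
Unset Printing Implicit Defensive.

Import Order.TTheory GRing.Theory Num.Theory.
Import numFieldNormedType.Exports.

Local Open Scope classical_set_scope.
Local Open Scope ring_scope.

(** Corner angles alone do not separate successive sectors. At [z p], copy [p] fills the sector from
    its apex side counterclockwise to its base, and copy [p.+1] the sector from its base
    counterclockwise to its apex side. Disjoint interiors already forbid the apex side of one along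
    the base of the other; a positive corner angle forbids common apex sides, and [bf_polygon]
    forbids common bases. The chart keeps only ratios, order, separation and the corner inequality.
    Its Hoelder estimate asks neither additivity nor continuity of the quantity estimated: the
    natural measure enters through a distribution function [phi], a greatest subsolution whose
    continuity is a consequence of the estimate, and the Hausdorff measure only through
    subadditivity. As all prescribed gradients vanish, the Whitney extension interpolates plain
    values, without Taylor terms. Two consecutive scales suffice at any point, and the ratio 8
    between scales leaves room for the cutoff of one scale to vanish before that of the previous
    scale leaves 1. *)

Section ComplexPlane.
Variable R : realType.
Local Notation C := (Rcomplex R).
Implicit Types x y : C.

Lemma RcomplexE x y : complex.Re x = complex.Re y -> complex.Im x = complex.Im y -> x = y.
Proof. by case: x y => [a b] [c d] /= -> ->. Qed.

Lemma Rcomplex_normE x : `|x| = Num.sqrt (complex.Re x ^+ 2 + complex.Im x ^+ 2).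
Proof. by case: x. Qed.

Lemma Rcomplex_normM x y : `|x * y : C| = `|x| * `|y|.
Proof.
rewrite !Rcomplex_normE -sqrtrM ?addr_ge0 ?sqr_ge0//; congr (Num.sqrt _).
by case: x => a b; case: y => c d /=; ring.
Qed.

Lemma Rcomplex_normV x : `|x^-1 : C| = `|x|^-1.
Proof.
have [->|x0] := eqVneq x 0; first by rewrite invr0 normr0 invr0.
have nx0 : `|x| != 0 by rewrite normr_eq0.
apply: (mulfI nx0); rewrite -Rcomplex_normM !divff//.
by rewrite Rcomplex_normE /= expr1n expr0n /= addr0 sqrtr1.
Qed.

Lemma ReD x y : complex.Re (x + y) = complex.Re x + complex.Re y.
Proof. by case: x; case: y. Qed.
Lemma ImD x y : complex.Im (x + y) = complex.Im x + complex.Im y.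
Proof. by case: x; case: y. Qed.
Lemma ReN x : complex.Re (- x) = - complex.Re x. Proof. by case: x. Qed.
Lemma ImN x : complex.Im (- x) = - complex.Im x. Proof. by case: x. Qed.
Lemma ReZ (k : R) x : complex.Re (k *: x) = k * complex.Re x. Proof. by case: x. Qed.
Lemma ImZ (k : R) x : complex.Im (k *: x) = k * complex.Im x. Proof. by case: x. Qed.
Lemma ReM x y : complex.Re (x * y) = complex.Re x * complex.Re y - complex.Im x * complex.Im y.
Proof. by case: x; case: y. Qed.
Lemma ImM x y : complex.Im (x * y) = complex.Re x * complex.Im y + complex.Im x * complex.Re y.
Proof. by case: x; case: y. Qed.
Definition ReImE := (ReD, ImD, ReN, ImN, ReZ, ImZ, ReM, ImM).

Lemma Re_le_norm x : `|complex.Re x| <= `|x|.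
Proof. by rewrite Rcomplex_normE -sqrtr_sqr ler_sqrt ?addr_ge0 ?sqr_ge0// lerDl sqr_ge0. Qed.
Lemma Im_le_norm x : `|complex.Im x| <= `|x|.
Proof. by rewrite Rcomplex_normE -sqrtr_sqr ler_sqrt ?addr_ge0 ?sqr_ge0// lerDr sqr_ge0. Qed.
Lemma norm_le_ReIm x : `|x| <= `|complex.Re x| + `|complex.Im x|.
Proof.
rewrite Rcomplex_normE -(ger0_norm (addr_ge0 (normr_ge0 _) (normr_ge0 _))) -sqrtr_sqr.
rewrite ler_sqrt ?sqr_ge0// sqrrD !real_normK ?num_real// addrAC lerDl.
by rewrite mulrn_wge0 ?mulr_ge0.
Qed.

End ComplexPlane.

(** * Whitney extension of functions with zero gradient *)

Section C11.
Variable R : realType.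
Local Notation C := (Rcomplex R).

Definition dotC (g h : C) : R :=
  complex.Re g * complex.Re h + complex.Im g * complex.Im h.

(** Bounding each product of coordinates by the product of the norms spares Cauchy-Schwarz at the
    price of the factor 2, which is harmless. *)
Lemma dotC_le g h : `|dotC g h| <= 2 * (`|g| * `|h|).
Proof.
rewrite mulrDl !mul1r; apply: le_trans (ler_normD _ _) _; rewrite !normrM.
by apply: lerD; apply: ler_pM => //; rewrite ?Re_le_norm ?Im_le_norm.
Qed.

Lemma dotCDl g1 g2 h : dotC (g1 + g2) h = dotC g1 h + dotC g2 h.
Proof. by rewrite /dotC !ReImE; ring. Qed.

Lemma dotCZl k g h : dotC (k *: g) h = k * dotC g h.
Proof. by rewrite /dotC !ReImE; ring. Qed.

(* Bounded functions with a bounded Lipschitz gradient, in a form that is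
   stable under products. *)
Definition C11 (F : C -> R) (G : C -> C) : Prop := exists2 K : R, 0 <= K &
  [/\ forall x, `|F x| <= K, forall x, `|G x| <= K,
      forall x h, `|F (x + h) - F x| <= K * `|h|,
      forall x h, `|F (x + h) - F x - dotC (G x) h| <= K * `|h| ^+ 2
    & forall x h, `|G (x + h) - G x| <= K * `|h|].

Lemma C11_cst (k : R) : C11 (fun=> k) (fun=> 0).
Proof.
exists `|k| => //; split => [x|x|x h|x h|x h];
  rewrite ?subrr ?normr0 ?mulr_ge0 ?exprn_ge0//.
by rewrite /dotC mul0r mul0r addr0 subrr normr0 mulr_ge0 ?exprn_ge0.
Qed.

Lemma C11D F1 G1 F2 G2 : C11 F1 G1 -> C11 F2 G2 ->
  C11 (fun x => F1 x + F2 x) (fun x => G1 x + G2 x).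
Proof.
move=> [K K0 [a1 a2 a3 a4 a5]] [L L0 [b1 b2 b3 b4 b5]].
exists (K + L); first exact: addr_ge0.
split => [x|x|x h|x h|x h]; rewrite ?mulrDl.
- by apply: le_trans (ler_normD _ _) _; apply: lerD.
- by apply: le_trans (ler_normD _ _) _; apply: lerD.
- rewrite opprD addrACA.
  by apply: le_trans (ler_normD _ _) _; apply: lerD.
- rewrite dotCDl.
  rewrite (_ : _ - _ = (F1 (x + h) - F1 x - dotC (G1 x) h) +
    (F2 (x + h) - F2 x - dotC (G2 x) h)); last by ring.
  by apply: le_trans (ler_normD _ _) _; apply: lerD.
- rewrite opprD addrACA.
  by apply: le_trans (ler_normD _ _) _; apply: lerD.
Qed.

(** The remainder of a product consists of the two remainders weighted by values, plus the product
    of the two increments, which is quadratic; this is why bounds on the values and on the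
    increments belong to the class. *)
Lemma C11M F1 G1 F2 G2 : C11 F1 G1 -> C11 F2 G2 ->
  C11 (fun x => F1 x * F2 x) (fun x => F1 x *: G2 x + F2 x *: G1 x).
Proof.
move=> [K K0 [a1 a2 a3 a4 a5]] [L L0 [b1 b2 b3 b4 b5]].
have KL : 0 <= K * L by exact: mulr_ge0.
have N (F : C -> R) (G : C -> C) (A B : R) x :
   `|F x| <= A -> `|G x| <= B -> `|F x *: G x| <= A * B.
  by move=> *; rewrite normrZ ler_pM.
exists (4 * (K * L)); first by rewrite mulr_ge0.
split => [x|x|x h|x h|x h].
- by rewrite normrM; apply: (@le_trans _ _ (K * L)); [exact: ler_pM|nra].
- apply: le_trans (ler_normD _ _) _; rewrite !normrZ.
  apply: (@le_trans _ _ (K * L + L * K)); last nra.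
  by apply: lerD; exact: ler_pM.
- rewrite (_ : _ - _ = F1 (x + h) * (F2 (x + h) - F2 x) +
    F2 x * (F1 (x + h) - F1 x)); last by ring.
  apply: le_trans (ler_normD _ _) _; rewrite !normrM.
  apply: (@le_trans _ _ (K * (L * `|h|) + L * (K * `|h|))).
    by apply: lerD; exact: ler_pM.
  have := normr_ge0 h; nra.
- rewrite dotCDl !dotCZl (_ : _ - _ - _ =
    F1 x * (F2 (x + h) - F2 x - dotC (G2 x) h) +
    F2 x * (F1 (x + h) - F1 x - dotC (G1 x) h) +
    (F1 (x + h) - F1 x) * (F2 (x + h) - F2 x)); last by ring.
  apply: le_trans (ler_normD _ _) _; rewrite normrM.
  apply: (@le_trans _ _ (K * (L * `|h| ^+ 2) + L * (K * `|h| ^+ 2) +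
     (K * `|h|) * (L * `|h|))); last first.
    by have := sqr_ge0 `|h|; rewrite expr2; nra.
  apply: lerD; last exact: ler_pM.
  apply: le_trans (ler_normD _ _) _; rewrite !normrM.
  by apply: lerD; exact: ler_pM.
- rewrite (_ : _ - _ = F1 (x + h) *: (G2 (x + h) - G2 x) +
    (F1 (x + h) - F1 x) *: G2 x + (F2 (x + h) *: (G1 (x + h) - G1 x) +
    (F2 (x + h) - F2 x) *: G1 x)); last first.
    by apply: RcomplexE; rewrite !ReImE; ring.
  apply: le_trans (ler_normD _ _) _.
  apply: (@le_trans _ _ ((K * (L * `|h|) + K * `|h| * L) +
    (L * (K * `|h|) + L * `|h| * K))); last by have := normr_ge0 h; nra.
  by apply: lerD; apply: le_trans (ler_normD _ _) _; rewrite !normrZ;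
     apply: lerD; apply: ler_pM.
Qed.

Lemma C11Z k F G : C11 F G -> C11 (fun x => k * F x) (fun x => k *: G x).
Proof.
move=> FG; have := C11M (C11_cst k) FG.
by congr C11; apply/funext => x; rewrite scaler0 addr0.
Qed.

Lemma C11_sum (I : Type) (r : seq I) (F : I -> C -> R) (G : I -> C -> C) :
  (forall i, C11 (F i) (G i)) ->
  C11 (fun x => \sum_(i <- r) F i x) (fun x => \sum_(i <- r) G i x).
Proof.
move=> FG; elim: r => [|i r IH].
  have := C11_cst 0; congr C11; apply/funext => x; by rewrite big_nil.
have := C11D (FG i) IH; congr C11; apply/funext => x; by rewrite big_cons.
Qed.

End C11.

Section SmoothStep.
Variable R : realType.
Local Notation C := (Rcomplex R).

Let pos (x : R) : R := Num.max 0 x.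

Let posB x y : `|pos x - pos y| <= `|x - y|.
Proof.
rewrite /pos; case: (leP 0 x) => ?; case: (leP 0 y) => ?;
  case: (ler0P (x - y)) => ?; rewrite ?ler_norml; lra.
Qed.

Let pos_taylor x h : `|pos (x + h) ^+ 2 - pos x ^+ 2 - 2 * pos x * h| <= h ^+ 2.
Proof.
rewrite /pos; case: (leP 0 x) => ?; case: (leP 0 (x + h)) => ?;
  rewrite ler_norml; nra.
Qed.

(* A smooth step from 0 to 1 on [0, 1], as a second difference of the squared
   positive part; [dstep] is its derivative. *)
Definition step (x : R) : R :=
  2 * (pos x ^+ 2 - 2 * pos (x - 1 / 2) ^+ 2 + pos (x - 1) ^+ 2).

Definition dstep (x : R) : R := 4 * (pos x - 2 * pos (x - 1 / 2) + pos (x - 1)).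

Lemma step_itv x : 0 <= step x <= 1.
Proof.
rewrite /step /pos; case: (leP 0 x) => ?; case: (leP 0 (x - 1 / 2)) => ?;
  case: (leP 0 (x - 1)) => ?; nra.
Qed.

Lemma step_le0 x : x <= 0 -> step x = 0.
Proof.
move=> ?; rewrite /step /pos !max_l//; [ring|lra|lra].
Qed.

Lemma step_ge1 x : 1 <= x -> step x = 1.
Proof.
move=> ?; rewrite /step /pos !max_r//; [by field|lra|lra|lra].
Qed.

Lemma dstep_itv x : 0 <= dstep x <= 2.
Proof.
rewrite /dstep /pos; case: (leP 0 x) => ?; case: (leP 0 (x - 1 / 2)) => ?;
  case: (leP 0 (x - 1)) => ?; lra.
Qed.

Lemma dstep_le0 x : x <= 0 -> dstep x = 0.
Proof.
move=> ?; rewrite /dstep /pos !max_l//; [ring|lra|lra].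
Qed.

Lemma dstep_ge1 x : 1 <= x -> dstep x = 0.
Proof.
move=> ?; rewrite /dstep /pos !max_r//; [by field|lra|lra|lra].
Qed.

Lemma step_taylor x h : `|step (x + h) - step x - dstep x * h| <= 8 * h ^+ 2.
Proof.
have := pos_taylor x h; have := pos_taylor (x - 1 / 2) h.
have := pos_taylor (x - 1) h.
rewrite /step /dstep ![x - _ + h]addrAC !ler_norml => /andP[? ?] /andP[? ?] /andP[? ?].
by apply/andP; split; lra.
Qed.

Lemma dstepB x h : `|dstep (x + h) - dstep x| <= 16 * `|h|.
Proof.
have e1 : x + h - x = h by ring.
have e2 : x + h - 1 / 2 - (x - 1 / 2) = h by ring.
have e3 : x + h - 1 - (x - 1) = h by ring.
move: (posB (x + h) x) (posB (x + h - 1 / 2) (x - 1 / 2)) (posB (x + h - 1) (x - 1)).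
rewrite e1 e2 e3 !ler_norml /dstep => /andP[? ?] /andP[? ?] /andP[? ?].
by apply/andP; split; lra.
Qed.

Lemma stepB x h : `|step (x + h) - step x| <= 10 * `|h|.
Proof.
have /andP[? ?] := step_itv x; have /andP[? ?] := step_itv (x + h).
(* Large increments are controlled by the range [0, 1], small ones by the Taylor estimate. *)
have [h1|h1] := leP 1 `|h|.
  by rewrite ler_norml; apply/andP; split; lra.
rewrite -[X in `|X|](subrK (dstep x * h)); apply: le_trans (ler_normD _ _) _.
apply: (@le_trans _ _ (8 * h ^+ 2 + 2 * `|h|)).
  apply: lerD; first exact: step_taylor.
  by rewrite normrM ler_wpM2r// ger0_norm; have /andP[? ?] := dstep_itv x.
by rewrite -(real_normK (num_real h)); have := normr_ge0 h; nra.
Qed.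

Lemma C11_step_Re (a c : R) : C11 (fun x : C => step (a * complex.Re x + c))
  (fun x => (a * dstep (a * complex.Re x + c) +i* 0)%C).
Proof.
have a0 := normr_ge0 a; have a2 := sqr_ge0 `|a|.
(* One constant has to dominate 1, 2|a|, 10|a|, 8|a|^2 and 16|a|^2. *)
exists (16 * (1 + `|a|) ^+ 2); first by rewrite mulr_ge0// sqr_ge0.
have e (x h : C) : a * complex.Re (x + h) + c = a * complex.Re x + c + a * complex.Re h.
  by rewrite ReD; ring.
have nr (u : R) : `|(u +i* 0)%C : C| = `|u|.
  by rewrite Rcomplex_normE/= expr0n addr0 sqrtr_sqr.
have nb (x : R) : `|dstep x| <= 2 by rewrite ger0_norm; have /andP[] := dstep_itv x.
have Rl (h : C) : `|a * complex.Re h| <= `|a| * `|h|.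
  by rewrite normrM ler_wpM2l// Re_le_norm.
split => [x|x|x h|x h|x h]; rewrite ?e.
- have /andP[? ?] := step_itv (a * complex.Re x + c).
  by rewrite ger0_norm//; nra.
- rewrite nr normrM; have := nb (a * complex.Re x + c); nra.
- apply: le_trans (stepB _ _) _; have := Rl h; have := normr_ge0 h; nra.
- rewrite /dotC/= mul0r addr0 -mulrA mulrCA.
  apply: le_trans (step_taylor _ _) _.
  rewrite -(real_normK (num_real (a * _))).
  apply: (@le_trans _ _ (8 * (`|a| * `|h|) ^+ 2)).
    by rewrite ler_wpM2l// lerXn2r ?nnegrE ?mulr_ge0.
  rewrite exprMn mulrA ler_wpM2r ?sqr_ge0//; nra.
- rewrite (_ : _ - _ = (a * (dstep (a * complex.Re x + c + a * complex.Re h) -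
    dstep (a * complex.Re x + c)) +i* 0)%C); last first.
    by apply: RcomplexE; rewrite !ReImE/=; ring.
  rewrite nr normrM.
  apply: (@le_trans _ _ (`|a| * (16 * (`|a| * `|h|)))).
    rewrite ler_wpM2l//; apply: le_trans (dstepB _ _) _.
    by rewrite ler_wpM2l.
  have := normr_ge0 h; have := mulr_ge0 a0 (normr_ge0 h); nra.
Qed.

Lemma C11_step_Im (a c : R) : C11 (fun x : C => step (a * complex.Im x + c))
  (fun x => (0 +i* (a * dstep (a * complex.Im x + c)))%C).
Proof.
(* Exchanging the coordinates is an additive isometry preserving the pairing [dotC], so the case of
   the real part carries over. *)
pose sw (x : C) : C := (complex.Im x +i* complex.Re x)%C.
have nsw x : `|sw x| = `|x| by rewrite !Rcomplex_normE /= addrC.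
have swD x y : sw (x + y) = sw x + sw y by case: x; case: y.
have swB x y : sw (x - y) = sw x - sw y by case: x; case: y.
have [K K0 [a1 a2 a3 a4 a5]] := C11_step_Re a c.
exists K => //; split => [x|x|x h|x h|x h].
- exact: (a1 (sw x)).
- by rewrite -nsw; exact: (a2 (sw x)).
- by have := a3 (sw x) (sw h); rewrite -swD nsw.
- by have := a4 (sw x) (sw h); rewrite -swD nsw /dotC/= mul0r addr0 add0r.
- by have := a5 (sw x) (sw h); rewrite -swD !nsw -[X in _ -> X <= _]nsw swB.
Qed.

End SmoothStep.

(** * Interpolation on a square lattice *)

Section Lattice.
Variable R : realType.
Local Notation C := (Rcomplex R).

(* The bump of index [k] is centred at [k.+1] and supported in [k, k + 2]; being
   a difference of steps, bumps telescope to a partition of unity. *)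
Definition bump (k : nat) (X : R) : R := step (X - k%:R) - step (X - k%:R - 1).
Definition dbump (k : nat) (X : R) : R := dstep (X - k%:R) - dstep (X - k%:R - 1).

Lemma bump_itv k X : 0 <= bump k X <= 1.
Proof.
rewrite /bump; have /andP[? ?] := step_itv (X - k%:R).
have /andP[? ?] := step_itv (X - k%:R - 1).
have [X1|X1] := leP (X - k%:R) 1.
  by rewrite (@step_le0 _ (X - k%:R - 1)); lra.
by rewrite (@step_ge1 _ (X - k%:R)); lra.
Qed.

Lemma bump_eq0 k X : 1 <= `|X - k%:R - 1| -> bump k X = 0.
Proof.
rewrite ler_normr /bump => /orP[|] ?.
  by rewrite !step_ge1 ?subrr//; lra.
by rewrite !step_le0 ?subrr//; lra.
Qed.

Lemma dbump_eq0 k X : 1 <= `|X - k%:R - 1| -> dbump k X = 0.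
Proof.
rewrite ler_normr /dbump => /orP[|] ?.
  by rewrite !dstep_ge1 ?subrr//; lra.
by rewrite !dstep_le0 ?subrr//; lra.
Qed.

Lemma bump_sum N X : 1 <= X <= N%:R -> \sum_(k < N) bump k X = 1.
Proof.
move=> /andP[X1 XN].
have -> : \sum_(k < N) bump k X = step X - step (X - N%:R).
  elim: N {XN} => [|N IH]; first by rewrite big_ord0 subr0 subrr.
  rewrite big_ord_recr IH/= /bump (_ : X - N.+1%:R = X - N%:R - 1); [ring|by rewrite -natr1 opprD addrA].
by rewrite step_ge1// step_le0 ?subr0//; lra.
Qed.

Lemma dbump_sum N X : 1 <= X <= N%:R -> \sum_(k < N) dbump k X = 0.
Proof.
move=> /andP[X1 XN].
have -> : \sum_(k < N) dbump k X = dstep X - dstep (X - N%:R).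
  elim: N {XN} => [|N IH]; first by rewrite big_ord0 subr0 subrr.
  rewrite big_ord_recr IH/= /dbump (_ : X - N.+1%:R = X - N%:R - 1); [ring|by rewrite -natr1 opprD addrA].
by rewrite dstep_ge1// dstep_le0 ?subr0//; lra.
Qed.

(** [dstep] vanishes outside (0, 1), so at most one of its integer translates is nonzero at [X]. *)
Lemma dstep_sum N (X : R) : \sum_(k < N) dstep (X - k%:R) <= 2.
Proof.
elim: N X => [|N IH] X; first by rewrite big_ord0.
rewrite big_ord_recr/=; have [XN|XN] := leP X N%:R.
  by rewrite (@dstep_le0 _ (X - N%:R)) ?addr0//; lra.
rewrite big1 => [|k _].
  by have /andP[_] := dstep_itv (X - N%:R); rewrite add0r.
rewrite dstep_ge1//; have : (k.+1)%:R <= N%:R :> R by rewrite ler_nat.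
by rewrite -natr1; lra.
Qed.

Lemma dbump_sum_norm N X : \sum_(k < N) `|dbump k X| <= 4.
Proof.
apply: (@le_trans _ _ (\sum_(k < N) (dstep (X - k%:R) + dstep (X - 1 - k%:R)))).
  apply: ler_sum => k _; apply: le_trans (ler_normD _ _) _.
  rewrite normrN addrAC !ger0_norm//.
    by have /andP[] := dstep_itv (X - 1 - k%:R).
  by have /andP[] := dstep_itv (X - k%:R).
have := dstep_sum N X; have := dstep_sum N (X - 1).
by rewrite big_split/=; lra.
Qed.

Variables (M : nat) (a : R).
Hypothesis a0 : 0 < a.

(* A lattice of mesh [a^-1], whose indices are shifted by [M] so as to be
   natural numbers. *)
Definition node (k l : nat) : C :=
  ((k.+1%:R - M%:R) / a +i* ((l.+1%:R - M%:R) / a))%C.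

Definition tile (k l : nat) (x : C) : R :=
  bump k (a * complex.Re x + M%:R) * bump l (a * complex.Im x + M%:R).

Definition dtile (k l : nat) (x : C) : C :=
  (a * dbump k (a * complex.Re x + M%:R) * bump l (a * complex.Im x + M%:R)
   +i* (a * bump k (a * complex.Re x + M%:R) * dbump l (a * complex.Im x + M%:R)))%C.

Definition interp (c : nat -> nat -> R) (x : C) : R :=
  \sum_(k < M.*2) \sum_(l < M.*2) c k l * tile k l x.

Definition dinterp (c : nat -> nat -> R) (x : C) : C :=
  \sum_(k < M.*2) \sum_(l < M.*2) c k l *: dtile k l x.

Lemma C11_interp c : C11 (interp c) (dinterp c).
Proof.
apply: C11_sum => k; apply: C11_sum => l; apply: C11Z.
have bR : C11 (fun x : C => bump k (a * complex.Re x + M%:R))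
    (fun x => (a * dbump k (a * complex.Re x + M%:R) +i* 0)%C).
  have := C11D (C11_step_Re a (M%:R - k%:R))
    (C11Z (-1) (C11_step_Re a (M%:R - k%:R - 1))).
  congr C11; apply/funext => x; rewrite /bump /dbump.
    by rewrite mulN1r !addrA.
  by apply: RcomplexE; rewrite !ReImE/= ?addrA; ring.
have bI : C11 (fun x : C => bump l (a * complex.Im x + M%:R))
    (fun x => (0 +i* (a * dbump l (a * complex.Im x + M%:R)))%C).
  have := C11D (C11_step_Im a (M%:R - l%:R))
    (C11Z (-1) (C11_step_Im a (M%:R - l%:R - 1))).
  congr C11; apply/funext => x; rewrite /bump /dbump.
    by rewrite mulN1r !addrA.
  by apply: RcomplexE; rewrite !ReImE/= ?addrA; ring.
have := C11M bR bI; congr C11; apply/funext => x.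
by apply: RcomplexE; rewrite !ReImE/=; ring.
Qed.

(** The first hypothesis puts the shifted coordinates in [1, 2M], where the tiles sum to 1 and their
    gradients to 0; so [c0] can be subtracted from all coefficients, and only nodes within [2 / a]
    of [x] contribute. The factor 8 is 4 for each coordinate direction, from [dbump_sum_norm]. *)
Lemma interp_approx c c0 b x :
  a * `|x| + 1 <= M%:R ->
  (forall k l, `|x - node k l| <= 2 / a -> `|c k l - c0| <= b) ->
  `|interp c x - c0| <= b /\ `|dinterp c x| <= 8 * a * b.
Proof.
move=> xM cb.
have ax (u : R) : `|u| <= `|x| -> 1 <= a * u + M%:R <= M.*2%:R.
  rewrite ler_norml -addnn natrD => /andP[u1 u2].
  have := ler_wpM2l (ltW a0) u1; have := ler_wpM2l (ltW a0) u2.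
  rewrite mulrN; lra.
set X := a * complex.Re x + M%:R; set Y := a * complex.Im x + M%:R.
have X1 : 1 <= X <= M.*2%:R by rewrite ax// Re_le_norm.
have Y1 : 1 <= Y <= M.*2%:R by rewrite ax// Im_le_norm.
have near k l : (bump k X != 0) || (dbump k X != 0) ->
    (bump l Y != 0) || (dbump l Y != 0) -> `|c k l - c0| <= b.
  have H (f : nat -> R -> R) m (U : R) : (forall k U, 1 <= `|U - k%:R - 1| -> f k U = 0) ->
      f m U != 0 -> `|U - m%:R - 1| < 1.
    by move=> fz; apply: contraNT; rewrite -leNgt => /fz ->.
  move=> kX lY.
  have {}kX : `|X - k%:R - 1| < 1.
    by case/orP: kX; apply: H => *; [exact: bump_eq0|exact: dbump_eq0].
  have {}lY : `|Y - l%:R - 1| < 1.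
    by case/orP: lY; apply: H => *; [exact: bump_eq0|exact: dbump_eq0].
  apply: cb; apply: le_trans (norm_le_ReIm _) _.
  rewrite (_ : complex.Re _ = (X - k%:R - 1) / a); last first.
    by rewrite /X !ReImE/= -natr1; field; rewrite gt_eqF.
  rewrite (_ : complex.Im _ = (Y - l%:R - 1) / a); last first.
    by rewrite /Y !ReImE/= -natr1; field; rewrite gt_eqF.
  rewrite !normrM normfV (gtr0_norm a0) -mulrDl ler_pM2r ?invr_gt0//. lra.
have nb k U : `|bump k U| = bump k U by rewrite ger0_norm; have /andP[] := bump_itv k U.
have sum1 : \sum_(k < M.*2) \sum_(l < M.*2) tile k l x = 1.
  rewrite /tile -/X -/Y -[RHS](bump_sum X1); apply: eq_bigr => k _.
  by rewrite -mulr_sumr bump_sum// mulr1.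
split.
  rewrite -[c0]mulr1 -[X in c0 * X]sum1 /interp mulr_sumr -sumrB.
  rewrite -[b]mulr1 -[X in b * X]sum1 mulr_sumr.
  apply: le_trans (ler_norm_sum _ _ _) _; apply: ler_sum => k _.
  rewrite mulr_sumr -sumrB mulr_sumr.
  apply: le_trans (ler_norm_sum _ _ _) _; apply: ler_sum => l _.
  rewrite -mulrBl normrM /tile -/X -/Y normrM !nb.
  have [->|k0] := eqVneq (bump k X) 0; first by rewrite mul0r !mulr0.
  have [->|l0] := eqVneq (bump l Y) 0; first by rewrite !mulr0.
  have /andP[? _] := bump_itv k X; have /andP[? _] := bump_itv l Y.
  by rewrite ler_wpM2r ?mulr_ge0// near ?k0 ?l0.
have ds0 : \sum_(k < M.*2) \sum_(l < M.*2) dtile k l x = 0.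
  apply: RcomplexE.
    rewrite raddf_sum/= (eq_bigr (fun k : 'I__ => a * dbump k X)) => [|k _].
      by rewrite -mulr_sumr dbump_sum// mulr0.
    rewrite raddf_sum/= (eq_bigr (fun l : 'I__ => a * dbump k X * bump l Y))//.
    by rewrite -mulr_sumr bump_sum// mulr1.
  rewrite raddf_sum/= big1// => k _.
  rewrite raddf_sum/= (eq_bigr (fun l : 'I__ => a * bump k X * dbump l Y))//.
  by rewrite -mulr_sumr dbump_sum// mulr0.
have -> : dinterp c x = \sum_(k < M.*2) \sum_(l < M.*2) (c k l - c0) *: dtile k l x.
  rewrite -[LHS]subr0 -[X in _ - X](scaler0 _ c0) -[X in c0 *: X]ds0 /dinterp scaler_sumr -sumrB.
  apply: eq_bigr => k _; rewrite scaler_sumr -sumrB.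
  by apply: eq_bigr => l _; rewrite scalerBl.
have S1 : \sum_(k < M.*2) \sum_(l < M.*2)
   (`|dbump k X| * bump l Y + bump k X * `|dbump l Y|) <= 8.
  rewrite (eq_bigr (fun k : 'I__ => `|dbump k X| + bump k X * \sum_(l < M.*2) `|dbump l Y|)) => [|k _].
    rewrite big_split/= -mulr_suml bump_sum// mul1r.
    by have := dbump_sum_norm M.*2 X; have := dbump_sum_norm M.*2 Y; lra.
  by rewrite big_split/= -!mulr_sumr bump_sum// mulr1.
(* The sign of [b] is not given. If it were negative, no tile could have positive weight at [x],
   although the weights sum to 1. *)
have b0 : 0 <= b \/ forall k l, bump k X * bump l Y = 0.
  have [b0|b0] := leP 0 b; [by left|right => k l].
  have [//|] := eqVneq (bump k X * bump l Y) 0.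
  rewrite mulf_eq0 negb_or => /andP[k0 l0].
  have : `|c k l - c0| <= b by rewrite near ?k0 ?l0.
  by have := normr_ge0 (c k l - c0); lra.
case: b0 => [b0|b0]; last first.
  have : \sum_(k < M.*2) \sum_(l < M.*2) tile k l x = 0.
    by rewrite big1// => k _; rewrite big1// => l _; exact: b0.
  by rewrite sum1; lra.
apply: (@le_trans _ _ (\sum_(k < M.*2) \sum_(l < M.*2) (a * b) *
   (`|dbump k X| * bump l Y + bump k X * `|dbump l Y|))); last first.
  rewrite (eq_bigr _ (fun k _ => esym (mulr_sumr _ _ _ _))).
  rewrite -mulr_sumr (_ : 8 * a * b = a * b * 8); last ring.
  apply: ler_wpM2l => //.
  by rewrite mulr_ge0// ltW.
apply: le_trans (ler_norm_sum _ _ _) _; apply: ler_sum => k _.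
apply: le_trans (ler_norm_sum _ _ _) _; apply: ler_sum => l _.
rewrite normrZ.
have dle : `|dtile k l x| <= a * (`|dbump k X| * bump l Y + bump k X * `|dbump l Y|).
  apply: le_trans (norm_le_ReIm _) _ => /=; rewrite -/X -/Y !normrM !nb.
  rewrite (gtr0_norm a0); lra.
have ab0 : 0 <= a * b * (`|dbump k X| * bump l Y + bump k X * `|dbump l Y|).
  have /andP[? _] := bump_itv k X; have /andP[? _] := bump_itv l Y.
  by rewrite mulr_ge0 ?addr_ge0 ?mulr_ge0// ltW.
have [kz|kn] := boolP ((bump k X != 0) || (dbump k X != 0)); last first.
  move: kn; rewrite negb_or !negbK => /andP[/eqP k0 /eqP dk0].
  have -> : dtile k l x = 0; last by rewrite normr0 mulr0.
  by apply: RcomplexE; rewrite /dtile/= -/X -/Y ?k0 ?dk0; ring.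
have [lz|ln] := boolP ((bump l Y != 0) || (dbump l Y != 0)); last first.
  move: ln; rewrite negb_or !negbK => /andP[/eqP l0 /eqP dl0].
  have -> : dtile k l x = 0; last by rewrite normr0 mulr0.
  by apply: RcomplexE; rewrite /dtile/= -/X -/Y ?l0 ?dl0; ring.
rewrite [a * b]mulrC -[leRHS]mulrA; apply: ler_pM => //; exact: near.
Qed.

End Lattice.

(** * Gradients in elementary form *)

Section HasGrad.
Variable R : realType.
Local Notation C := (Rcomplex R).

Definition hasgrad (F : C -> R) (x g : C) : Prop :=
  forall e : R, 0 < e -> exists2 d : R, 0 < d &
    forall h : C, `|h| < d -> `|F (x + h) - F x - dotC g h| <= e * `|h|.

Lemma dotC_is_linear (g : C) : linear (dotC g : C -> R^o).
Proof. by move=> k u v; rewrite -[k *: dotC g u]/(k * dotC g u) /dotC !ReImE; ring. Qed.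

HB.instance Definition _ (g : C) :=
  GRing.isLinear.Build R C R^o _ (dotC g) (dotC_is_linear g).

Lemma dotC_continuous (g : C) : continuous (dotC g : C -> R^o).
Proof.
apply: (@linear_bounded_continuous R C R^o (dotC g)).1.
apply/linear_boundedP.
near=> r => h; apply: le_trans (dotC_le g h) _.
rewrite mulrA ler_wpM2r//; near: r; apply: nbhs_pinfty_ge; exact: num_real.
Unshelve. all: by end_near. Qed.

Lemma hasgrad_differentiable F x g : hasgrad F x g ->
  differentiable F x /\ forall v, 'D_v F x = dotC g v.
Proof.
move=> Fg.
have Fo : (F : C -> R^o) \o shift x = cst (F x) + (dotC g : C -> R^o) +o_ (0 : C) id.
  apply/eqaddoP => e /= /Fg[d d0 Fd].
  apply/nbhs_normP; exists d => //= h; rewrite /ball_/= sub0r normrN => /Fd.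
  have -> : F (x + h) - F x - dotC g h = F (h + x) - (F x + dotC g h).
    by rewrite [x + h]addrC; ring.
  exact.
have dF := diff_unique (@dotC_continuous g) Fo.
have dfF : differentiable F x.
  by apply/diff_locallyP; rewrite dF; split; [exact: dotC_continuous|].
by split => // v; rewrite deriveE// dF.
Qed.

Lemma C11_hasgrad F G x : C11 F G -> hasgrad F x (G x).
Proof.
move=> [K K0 [_ _ _ FG _]] e e0; exists (e / (K + 1)).
  by rewrite divr_gt0// ltr_wpDl.
move=> h; rewrite ltr_pdivlMr ?ltr_wpDl// => he.
by apply: le_trans (FG x h) _; have := normr_ge0 h; nra.
Qed.

(** Locality lets a glued function inherit the gradient of the piece that describes it near [x]. *)
Lemma hasgrad_near F1 F2 x g d : 0 < d ->
  (forall y, `|y - x| < d -> F1 y = F2 y) -> hasgrad F1 x g -> hasgrad F2 x g.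
Proof.
move=> d0 F12 F1g e /F1g[d' d'0 Fd].
exists (Num.min d d'); first by rewrite lt_min d0.
move=> h; rewrite lt_min => /andP[hd hd'].
rewrite -!F12 ?subrr ?normr0//; first exact: Fd.
by rewrite addrAC subrr add0r.
Qed.

Lemma C1_of_hasgrad F G : (forall x, hasgrad F x (G x)) ->
  (forall x e, 0 < e -> exists2 d : R, 0 < d & forall y, `|y - x| < d -> `|G y - G x| < e) ->
  C1 F /\ gradient F = G.
Proof.
move=> FG Gc.
have gE : gradient F = G.
  apply/funext => x; apply: RcomplexE; rewrite /gradient/=;
  rewrite (hasgrad_differentiable (FG x)).2 /dotC/=; ring.
split=> //; split => x; first by have [] := hasgrad_differentiable (FG x).
rewrite gE; apply/(@cvgrPdist_lt R C C (nbhs x)) => e e0; have [d d0 Gd] := Gc x e e0.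
apply/nbhs_normP; exists d => //= y; rewrite /ball_/= distrC => /Gd.
by rewrite distrC.
Qed.

Lemma lipschitz_continuous (V : normedModType R) (f : C -> V) (k : R) :
  (forall x y, `|f x - f y| <= k * `|x - y|) -> continuous f.
Proof.
move=> fk x; apply/(@cvgrPdist_lt R V C (nbhs x)) => e e0.
apply/nbhs_normP; exists (e / (`|k| + 1)) => /=; first by rewrite divr_gt0// ltr_wpDl.
move=> y; rewrite /ball_/= ltr_pdivlMr ?ltr_wpDl// => xy.
apply: le_lt_trans (fk x y) (le_lt_trans _ xy); rewrite mulrC ler_wpM2l//.
by rewrite (le_trans (ler_norm k))// lerDl.
Qed.

End HasGrad.

Lemma powR_small (R : realType) (A e u : R) : 0 <= A -> 0 < e -> 0 < u ->
  exists2 d : R, 0 < d & forall t, 0 <= t < d -> A * t `^ u < e.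
Proof.
move=> A0 e0 u0; exists ((e / (A + 1)) `^ u^-1).
  by rewrite powR_gt0// divr_gt0// ltr_wpDl.
move=> t /andP[t0 td].
have A1 : 0 < A + 1 by rewrite ltr_wpDl.
have : t `^ u < e / (A + 1).
  rewrite -[ltRHS](@powRr1 _ (e / (A + 1))) ?divr_ge0 ?ltW//.
  rewrite -[X in _ < _ `^ X](mulVf (lt0r_neq0 u0)) powRrM.
  by apply: gt0_ltr_powR => //; rewrite nnegrE powR_ge0.
rewrite ltr_pdivlMr// mulrC => h.
by have := powR_ge0 t u; nra.
Qed.

Lemma nearest_point (R : realType) (x : Rcomplex R) (E : set (Rcomplex R)) :
  compact E -> E !=set0 -> exists p, E p /\ forall y, E y -> `|x - p| <= `|x - y|.
Proof.
move=> cE E0.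
have [|p] := @compact_EVT_min _ R (fun y => `|x - y|) E E0 cE.
  apply: continuous_subspaceT; apply: (@lipschitz_continuous _ R _ 1) => y z.
  rewrite mul1r; apply: le_trans (ler_dist_dist _ _) _.
  by rewrite opprB addrC addrA subrK distrC.
rewrite inE => Ep pmin; exists p; split => // y Ey.
by apply: pmin; rewrite inE.
Qed.

(** The distance to [B] is 1-Lipschitz and attains its minimum on [A]; a zero minimum would be a
    common point. *)
Lemma compact_disjoint_dist (R : realType) (A B : set (Rcomplex R)) :
  compact A -> A !=set0 -> compact B -> B !=set0 -> (forall x, A x -> B x -> False) ->
  exists2 d : R, 0 < d & forall x y, A x -> B y -> d <= `|x - y|.
Proof.
move=> cA A0 cB B0 AB.
have /choice[p pP] : forall x : Rcomplex R, exists p, B p /\ forall y, B y -> `|x - p| <= `|x - y|.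
  by move=> x; exact: nearest_point.
have lip x y : `|x - p x| <= `|y - p y| + `|x - y|.
  apply: le_trans ((pP x).2 _ (pP y).1) _.
  by rewrite [X in `|X|](_ : _ = (y - p y) + (x - y)) ?ler_normD// [RHS]addrC subrKA.
have [|x] := @compact_EVT_min _ R (fun x => `|x - p x|) A A0 cA.
  apply: continuous_subspaceT; apply: (@lipschitz_continuous _ R _ 1) => x y.
  rewrite mul1r ler_norml; have := lip x y; have := lip y x.
  by rewrite [`|y - x|]distrC => ? ?; apply/andP; split; lra.
rewrite inE => Ax xmin; exists `|x - p x|.
  rewrite normr_gt0 subr_eq0; apply/eqP => xp; apply: (AB x) => //.
  by rewrite xp; exact: (pP x).1.
move=> u v Au Bv; apply: le_trans (xmin u _) _; first by rewrite inE.
exact: (pP u).2.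
Qed.

(** * Gluing interpolants at the scales 8^-n *)

Section Whitney.
Variable R : realType.
Local Notation C := (Rcomplex R).
Variables (E : set C) (f : C -> R) (K s : R).
Hypotheses (cE : compact E) (E0 : E !=set0) (s1 : 1 < s) (K0 : 0 <= K).
Hypothesis fK : forall x y, E x -> E y -> `|f x - f y| <= K * `|x - y| `^ s.

Let nearest x := nearest_point x cE E0.

Let p x : C := projT1 (cid (nearest x)).
Let Ep x : E (p x). Proof. by rewrite /p; case: cid => ? []. Qed.
Let p_le x y : E y -> `|x - p x| <= `|x - y|.
Proof. by rewrite /p; case: cid => ? [_ h] /=; exact: h. Qed.

Let d x := `|x - p x|.

Let d_lip x y : d x <= d y + `|x - y|.
Proof.
apply: le_trans (p_le x (Ep y)) _.
by rewrite [X in `|X|](_ : _ = (y - p y) + (x - y)) ?ler_normD// [RHS]addrC subrKA.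
Qed.

Let d_eq0 x : d x = 0 <-> E x.
Proof.
split=> [/normr0_eq0 /subr0_eq ->//|Ex].
by apply/eqP; rewrite eq_le normr_ge0 andbT; have := p_le x Ex; rewrite subrr normr0.
Qed.

(** The point [p x] is at least as close to [x] as [y] is, hence within twice that distance of
    [y]. *)
Let fp_le x y : E y -> `|f (p x) - f y| <= K * (2 * `|x - y|) `^ s.
Proof.
move=> Ey; apply: le_trans (fK (Ep x) Ey) _; rewrite ler_wpM2l//.
rewrite ge0_ler_powR ?nnegrE//; [exact: ltW (lt_trans _ s1)|].
rewrite -(subrKA x); apply: le_trans (ler_normD _ _) _.
by rewrite distrC mulrDl !mul1r lerD2r p_le.
Qed.

Let bnd : exists2 r : R, 0 <= r & forall x, E x -> `|x| <= r.
Proof.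
have [r [_ rE]] := compact_bounded cE.
exists (`|r| + 1); first by rewrite addr_ge0.
move=> x Ex; apply: rE => //; by rewrite (le_lt_trans (ler_norm _))// ltrDl.
Qed.

Let r : R := projT1 (cid2 bnd).
Let r0 : 0 <= r. Proof. by rewrite /r; case: cid2. Qed.
Let rE x : E x -> `|x| <= r. Proof. by rewrite /r; case: cid2 => ? ? h /=; exact: h. Qed.

Let a (n : nat) : R := 8 ^+ n.
Let a0 n : 0 < a n. Proof. exact: exprn_gt0. Qed.
Let e (n : nat) : R := (a n)^-1.
Let e0 n : 0 < e n. Proof. by rewrite invr_gt0. Qed.
Let eS n : e n = 8 * e n.+1.
Proof. by rewrite /e /a exprS invfM mulrA divff ?mul1r. Qed.
Let e_le m n : (m <= n)%N -> e n <= e m.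
Proof. by move=> mn; rewrite lef_pV2 ?posrE// /a ler_eXn2l// ltr1n. Qed.

(** Large enough for the lattice to cover the ball of radius [r + 1], which contains all points at
    distance at most 1 from [E]. *)
Let M n := Num.bound (a n * (r + 1) + 1).

Let M_ge n x : d x <= 1 -> a n * `|x| + 1 <= (M n)%:R.
Proof.
move=> dx; apply: (@le_trans _ _ (a n * (r + 1) + 1)); last first.
  by apply/ltW/archi_boundP; rewrite addr_ge0// mulr_ge0 ?addr_ge0// ltW.
rewrite lerD2r ler_wpM2l ?(ltW (a0 n))//.
by rewrite -[x](subrK (p x)) (le_trans (ler_normD _ _))// addrC lerD// rE.
Qed.

(* [Phi n] interpolates, on the lattice of mesh [e n = 8^-n], the values of [f] at
   nearest points of [E], and [chi n] is a cutoff, equal to 1 at distance less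
   than [e n] from [E] and to 0 at distance greater than [5 * e n]. *)
Let nd n := node (M n) (a n).
Let Phi n := interp (M n) (a n) (fun k l => f (p (nd n k l))).
Let dPhi n := dinterp (M n) (a n) (fun k l => f (p (nd n k l))).
Let chic n k l : R := if d (nd n k l) < 3 * e n then 1 else 0.
Let chi n := interp (M n) (a n) (chic n).
Let dchi n := dinterp (M n) (a n) (chic n).

Let Phi_approx n x y : d x <= 1 -> E y ->
  `|Phi n x - f y| <= K * (2 * (`|x - y| + 2 * e n)) `^ s /\
  `|dPhi n x| <= 8 * a n * (K * (2 * (`|x - y| + 2 * e n)) `^ s).
Proof.
move=> dx Ey; apply: interp_approx; [exact: a0|exact: M_ge|move=> k l xn].
apply: le_trans (fp_le _ Ey) _; rewrite ler_wpM2l//.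
have s0 : 0 <= s by exact: ltW (lt_trans _ s1).
rewrite ge0_ler_powR ?nnegrE ?mulr_ge0 ?addr_ge0 ?mulr_ge0 ?(ltW (e0 n))//.
rewrite ler_wpM2l// -(subrKA x) (le_trans (ler_normD _ _))// addrC lerD2l.
by rewrite distrC.
Qed.

Let chi_le1 n x : d x <= 1 -> `|chi n x| <= 1 /\ `|dchi n x| <= 8 * a n.
Proof.
move=> dx.
have [] := @interp_approx _ (M n) _ (a0 n) (chic n) 0 1 x (M_ge _ dx).
  by move=> k l _; rewrite subr0 /chic; case: ifP; rewrite ?normr1 ?normr0.
by rewrite subr0 mulr1.
Qed.

(** Tiles reach at most [2 * e n] from their node, so the nodes that matter at a point with
    [d x < e n] lie below the threshold [3 * e n] of [chic]; for [chi0] they lie above it, whence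
    the bound [5 * e n]. *)
Let chi1 n x : d x < e n -> chi n x = 1 /\ dchi n x = 0.
Proof.
move=> dx; have dx1 : d x <= 1.
  by rewrite (le_trans (ltW dx))// -invr1 -(expr0 8) -/(a 0) e_le.
have [] := @interp_approx _ (M n) _ (a0 n) (chic n) 1 0 x (M_ge _ dx1).
  move=> k l xn; rewrite /chic ifT ?subrr ?normr0//.
  by apply: le_lt_trans (d_lip _ x) _; rewrite distrC; move: xn; rewrite -/(e n) -/(nd n); lra.
by rewrite mulr0 !normr_le0 subr_eq0 => /eqP c /eqP dc; split.
Qed.

Let chi0 n x : d x <= 1 -> 5 * e n < d x -> chi n x = 0 /\ dchi n x = 0.
Proof.
move=> dx1 dx.
have [] := @interp_approx _ (M n) _ (a0 n) (chic n) 0 0 x (M_ge _ dx1).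
  move=> k l xn; rewrite /chic ifF ?subrr ?normr0//.
  apply/negbTE; rewrite -leNgt.
  by have := d_lip x (nd n k l); move: xn; rewrite -/(e n) -/(nd n); lra.
by rewrite mulr0 !normr_le0 subr0 => /eqP c /eqP dc; split.
Qed.

(* At distance about [e m] from [E], the extension switches from [Phi m.-1] to
   [Phi m] by means of [chi m]; on the overlap of the domains [O m] and [O m.+1]
   both formulas give [Phi m]. *)
Let P m := if m is n.+1 then Phi n else (fun=> 0).
Let dP m := if m is n.+1 then dPhi n else (fun=> 0).
Let piece m x := P m x + chi m x * (Phi m x - P m x).
Let dpiece m x : C := dP m x + (chi m x *: (dPhi m x - dP m x) + (Phi m x - P m x) *: dchi m x).

Let C11_piece m : C11 (piece m) (dpiece m).
Proof.
have PC : C11 (P m) (dP m) by case: m => [|m]; [exact: C11_cst|exact: C11_interp].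
have FC : C11 (Phi m) (dPhi m) by exact: C11_interp.
have cC : C11 (chi m) (dchi m) by exact: C11_interp.
have := C11D PC (C11M cC (C11D FC (C11Z (-1) PC))).
by congr C11; apply/funext => x; rewrite /piece /dpiece ?mulN1r ?scaleN1r.
Qed.

Let O m x := 6 * e m.+1 < d x /\ (m = 0%N \/ d x < e m.-1).

(** For the least index [m] satisfying the lower bound, that bound fails one scale earlier, so that
    [d x <= 6 * e m < 8 * e m = e m.-1] when [m] is positive. *)
Let O_ex x : 0 < d x -> exists m, O m x.
Proof.
move=> dx; have ex : exists m, 6 * e m.+1 < d x.
  have ex2 := archi_boundP (divr_ge0 (ler0n R 6) (ltW dx)).
  set N := Num.bound _ in ex2; exists N.
  rewrite ltr_pdivrMr ?a0// mulrC -ltr_pdivrMr//.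
  apply: lt_le_trans ex2 _; rewrite /a -natrX ler_nat.
  by apply: ltnW; apply: (@leq_trans (2 ^ N.+1)); [rewrite ltnW// ltn_expl|rewrite leq_exp2r].
have [m md mmin] := ex_minnP ex.
exists m; split => //; case: m => [|m] in md mmin *; [by left|right => /=].
rewrite ltNge; apply/negP => dm; have /mmin : 6 * e m.+1 < d x.
  by apply: lt_le_trans dm; rewrite (eS m); have := e0 m.+1; lra.
by rewrite ltnn.
Qed.

(** Indices that differ by 2 or more have incompatible ranges of [d x]. For [m] and [m.+1],
    [d x < e m] makes [chi m] equal to 1 and [d x > 6 * e m.+1] makes [chi m.+1] vanish. *)
Let O_agree m n x : O m x -> O n x -> piece m x = piece n x /\ dpiece m x = dpiece n x.
Proof.
wlog mn : m n / (m <= n)%N.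
  move=> H; have [/H//|/ltnW /H{}H Om On] := leqP m n.
  by have [-> ->] := H On Om.
move: mn; rewrite leq_eqVlt => /predU1P[->//|mn] [md _] [nd' [n0|nd2]].
  by rewrite n0 in mn.
have nm : n = m.+1.
  apply/eqP; rewrite eqn_leq mn andbT leqNgt; apply/negP => mn2.
  have : e n.-1 <= e m.+1 by rewrite e_le// -ltnS prednK// (leq_trans _ mn).
  by have := e0 m.+1; lra.
rewrite nm/= in nd' nd2 *.
have d1 : d x <= 1.
  by rewrite (le_trans (ltW nd2))// -invr1 -(expr0 8) -/(a 0) e_le.
have [c1 dc1] := chi1 nd2.
have [|c0 dc0] := @chi0 m.+1 x d1; first by have := e0 m.+1; lra.
rewrite /piece /dpiece c1 dc1 c0 dc0 !mul1r !scale1r !scaler0 !mul0r !scale0r !addr0.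
by rewrite ![_ + (_ - _)]addrC !subrK.
Qed.

(** By [O_agree] the choice of the index is immaterial; the default 0 is only taken on [E], where
    [F] and [G] ignore it. *)
Let lvl x : nat := xget 0%N [set m | O m x].
Let F x := if d x == 0 then f x else piece (lvl x) x.
Let G x := if d x == 0 then 0 else dpiece (lvl x) x.

Let FG_piece m x : O m x -> F x = piece m x /\ G x = dpiece m x.
Proof.
move=> Om; have dx : d x != 0.
  by rewrite gt_eqF//; apply: le_lt_trans Om.1; rewrite mulr_ge0// ltW.
rewrite /F /G (negbTE dx); apply: O_agree => //.
by have := @xgetI _ 0%N [set m | O m x] _ Om.
Qed.

Let O_open m x : O m x -> exists2 t : R, 0 < t & forall y, `|y - x| < t -> O m y.
Proof.
move=> [l u]; pose t1 := d x - 6 * e m.+1.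
pose t2 := if m is n.+1 then e n - d x else 1.
exists (Num.min t1 t2).
  rewrite lt_min subr_gt0 l/= /t2; case: (m) u => [//|n] [//|/=].
  by rewrite subr_gt0.
move=> y; rewrite lt_min /t1 /t2 => /andP[y1 y2]; split.
  by have := d_lip x y; rewrite distrC; lra.
case: (m) u y2 => [|n]; [by left|move=> [//|/=] u y2; right].
by have := d_lip y x; lra.
Qed.

(** The piece at [x] mixes interpolants of scale comparable to [d x], itself at most the distance
    from [x] to [y]; differentiating costs a factor of the order of [(d x)^-1]. *)
Let est x y : E y -> 0 < d x -> `|x - y| < 3 / 4 ->
  `|F x - f y| <= 3 * K * 46 `^ s * `|x - y| `^ s /\
  `|G x| <= 320 * K * 46 `^ s * `|x - y| `^ (s - 1).
Proof.
move=> Ey dx xy; have dxy : d x <= `|x - y| by exact: p_le.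
have s0 : 0 < s by exact: lt_trans s1.
have [m Om] := O_ex dx; have [-> ->] := FG_piece Om.
have d1 : d x <= 1 by lra.
(* Index 0 is excluded: it would give [d x > 6 * e 1 = 3 / 4]. *)
case: m Om => [|m] [l u].
  have : 6 / 8 < d x by move: l; rewrite /e /a expr1.
  lra.
case: u => // /= u.
(* Two scales amount to a factor 64, and 64 / 6 < 11. *)
have em : e m < 11 * d x by rewrite (eS m) (eS m.+1); lra.
have em1 : e m.+1 < 11 * d x by rewrite (le_lt_trans _ em)// e_le.
have am0 : a m < (d x)^-1.
  by rewrite -[a m]invrK ltf_pV2 ?posrE ?e0.
have am : a m <= 8 * (d x)^-1 by have := a0 m; lra.
have am1 : a m.+1 <= 8 * (d x)^-1 by rewrite /a exprS ler_pM2l// ltW.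
have B n w : E w -> e n < 11 * d x -> a n <= 8 * (d x)^-1 ->
    `|Phi n x - f w| <= K * 46 `^ s * `|x - w| `^ s /\
    `|dPhi n x| <= 64 * (d x)^-1 * (K * 46 `^ s * `|x - w| `^ s).
  move=> Ew en an; have [h1 h2] := Phi_approx n d1 Ew.
  (* The constant is 46 = 2 * (1 + 2 * 11). *)
  have H : K * (2 * (`|x - w| + 2 * e n)) `^ s <= K * 46 `^ s * `|x - w| `^ s.
    rewrite -mulrA ler_wpM2l// -powRM//.
    rewrite ge0_ler_powR ?nnegrE ?mulr_ge0 ?addr_ge0 ?mulr_ge0 ?(ltW (e0 n))//.
      exact: ltW.
    by have : d x <= `|x - w| by [exact: p_le]; lra.
  split; first exact: le_trans h1 H.
  apply: le_trans h2 _; apply: ler_pM => //.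
  - by rewrite mulr_ge0// ltW.
  - by rewrite mulr_ge0// powR_ge0.
  - by lra.
have [c1 dc1] := chi_le1 m.+1 d1.
split.
  have [b1 _] := B _ _ Ey em am; have [b2 _] := B _ _ Ey em1 am1.
  rewrite /piece/=; set b := K * _ * _ in b1 b2.
  rewrite (_ : _ - f y = (Phi m x - f y) +
    chi m.+1 x * ((Phi m.+1 x - f y) - (Phi m x - f y))); last ring.
  apply: le_trans (ler_normD _ _) _.
  rewrite -!mulrA [K * _]mulrA -/b mulrDl mul1r.
  apply: le_trans (_ : b + 1 * (b + b) <= _); last by rewrite /b; lra.
  apply: lerD => //; rewrite normrM ler_pM//.
  by apply: le_trans (ler_normB _ _) _; exact: lerD.
(* For the gradient, values are compared with the one at [p x] and not at [y]: the factor [(d x)^-1]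
   has to be met by the power [s] of [d x] itself, and only the remaining power [s - 1] is compared
   with the distance to [y]. *)
have [b1 g1] := B _ _ (Ep x) em am; have [b2 g2] := B _ _ (Ep x) em1 am1.
apply: (@le_trans _ _ (320 * K * 46 `^ s * d x `^ (s - 1))); last first.
  rewrite ler_wpM2l ?mulr_ge0 ?powR_ge0//.
  have su : 0 <= s - 1 by rewrite subr_ge0 ltW.
  by apply: ge0_ler_powR; rewrite ?nnegrE ?normr_ge0.
rewrite -/(d x) in b1 b2 g1 g2.
have dE : d x `^ s = d x * d x `^ (s - 1).
  rewrite -{2}(@powRr1 _ (d x)) ?ltW// -powRD ?(gt_eqF dx) ?implybT//.
  by congr (_ `^ _); ring.
set b := K * _ * _ in b1 b2 g1 g2; set v := (d x)^-1 in g1 g2 am am1.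
have v0 : 0 < v by rewrite invr_gt0.
have bE : v * b = K * 46 `^ s * d x `^ (s - 1).
  rewrite /b dE (_ : v * _ = (v * d x) * (K * 46 `^ s * d x `^ (s - 1))); last ring.
  by rewrite mulVf ?mul1r// gt_eqF.
rewrite (_ : 320 * K * 46 `^ s * d x `^ (s - 1) = 320 * (v * b)); last by rewrite bE; ring.
rewrite /dpiece/=; apply: le_trans (ler_normD _ _) _.
have vb : 0 <= v * b by rewrite mulr_ge0 ?(ltW v0)//; exact: le_trans b1.
(* The three terms weigh 64, 2 * 64 and 2 * 64, hence 320. *)
apply: (@le_trans _ _ (64 * v * b + (1 * (64 * v * b + 64 * v * b) + (b + b) * (64 * v)))); last first.
  by lra.
apply: lerD => //; apply: le_trans (ler_normD _ _) _; apply: lerD; rewrite normrZ; apply: ler_pM => //.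
- by apply: le_trans (ler_normB _ _) _; exact: lerD.
- rewrite (_ : _ - _ = (Phi m.+1 x - f (p x)) - (Phi m x - f (p x))); last ring.
  by apply: le_trans (ler_normB _ _) _; exact: lerD.
- by apply: le_trans dc1 _; lra.
Qed.

(** At points of [E], the estimate of order [s > 1] makes increments negligible against distances,
    so the gradient is 0, and the estimate of order [s - 1 > 0] makes [G] continuous. Off [E], [F]
    is locally a single piece. *)
Theorem whitney_extension : exists F : C -> R,
  [/\ C1 F, forall x, E x -> F x = f x & forall x, E x -> gradient F x = 0].
Proof.
have FE x : E x -> F x = f x by move=> /d_eq0 dx; rewrite /F dx eqxx.
have GE x : E x -> G x = 0 by move=> /d_eq0 dx; rewrite /G dx eqxx.
have s0 : 0 < s - 1 by rewrite subr_gt0.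
have [C1F gF] : C1 F /\ gradient F = G.
  have w1 : 1 <= 46 `^ s.
    have s_ge0 : 0 <= s by exact: ltW (lt_trans _ s1).
    have a46 : 1 <= 46 :> R by lra.
    by have := ler_powR a46 s_ge0; rewrite powRr0.
  have FA x y : E y -> `|x - y| < 3 / 4 -> `|F x - F y| <= 3 * K * 46 `^ s * `|x - y| `^ s.
    move=> Ey xy; rewrite (FE y)//; have [/d_eq0 Ex|dx] := eqVneq (d x) 0.
      rewrite (FE x)//; apply: le_trans (fK Ex Ey) _.
      have := mulr_ge0 K0 (powR_ge0 `|x - y| s); nra.
    by apply: (est Ey _ xy).1; rewrite lt_def dx normr_ge0.
  have near x : ~ E x -> exists2 m, O m x & exists2 t : R, 0 < t &
      forall y, `|y - x| < t -> F y = piece m y /\ G y = dpiece m y.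
    move=> nEx; have [|m Om] := @O_ex x.
      by rewrite lt_def normr_ge0 andbT; apply/eqP => /d_eq0.
    exists m => //; have [t t0 tO] := O_open Om.
    by exists t => // y /tO; exact: FG_piece.
  apply: C1_of_hasgrad => [x|x eps eps0].
    have [Ex|nEx] := pselect (E x); last first.
      have [m Om [t t0 tP]] := near x nEx.
      rewrite (FG_piece Om).2; apply: (hasgrad_near t0 _ (C11_hasgrad x (C11_piece m))).
      by move=> y /tP[-> _].
    rewrite GE// => eps eps0.
    have A0 : 0 <= 3 * K * 46 `^ s by rewrite !mulr_ge0 ?powR_ge0.
    have [t t0 tP] := powR_small A0 eps0 s0.
    exists (Num.min t (3 / 4)); first by rewrite lt_min t0/=; lra.
    move=> h; rewrite lt_min => /andP[ht h34].
    rewrite /dotC !mul0r addr0 subr0.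
    have := FA (x + h) x Ex; rewrite [x + h]addrC addrK => /(_ h34) hA.
    apply: le_trans hA _.
    have -> : `|h| `^ s = `|h| `^ (s - 1) * `|h|.
      have [->|h0] := eqVneq h 0.
        by rewrite normr0 mulr0 powR0// gt_eqF// (lt_trans _ s1).
      rewrite -{3}(@powRr1 _ `|h|)// -powRD ?normr_eq0 ?h0 ?implybT//.
      by congr (_ `^ _); ring.
    by rewrite mulrA ler_wpM2r// ltW// tP// normr_ge0.
  have [Ex|nEx] := pselect (E x); last first.
    have [m Om [t t0 tP]] := near x nEx.
    have [L L0 [_ _ _ _ Ld]] := C11_piece m.
    exists (Num.min t (eps / (L + 1))).
      by rewrite lt_min t0 divr_gt0// ltr_wpDl.
    move=> y; rewrite lt_min => /andP[/tP[_ ->]].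
    rewrite (FG_piece Om).2 ltr_pdivlMr ?ltr_wpDl// => ye.
    have := Ld x (y - x); rewrite [x + _]addrC subrK => h; apply: le_lt_trans h _.
    by have := normr_ge0 (y - x); nra.
  have A0 : 0 <= 320 * K * 46 `^ s by rewrite !mulr_ge0 ?powR_ge0.
  have [t t0 tP] := powR_small A0 eps0 s0.
  exists (Num.min t (3 / 4)); first by rewrite lt_min t0/=; lra.
  move=> y; rewrite lt_min => /andP[yt y34]; rewrite (GE x)// subr0.
  have [/d_eq0 Ey|dy] := eqVneq (d y) 0; first by rewrite GE// normr0.
  have [|_ Gy] := est Ex _ y34; first by rewrite lt_def dy normr_ge0.
  by apply: le_lt_trans Gy _; rewrite tP// normr_ge0.
by exists F; split => // x Ex; rewrite gF GE.
Qed.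

End Whitney.

(** * Hausdorff measure *)

Section Hausdorff.
Variable R : realType.
Local Notation C := (Rcomplex R).
Local Open Scope ereal_scope.

Lemma lee_ereal_inf_add (A B : set (\bar R)) x :
  (forall a, A a -> 0 <= a) -> (forall b, B b -> 0 <= b) ->
  (forall a b, A a -> B b -> x <= a + b) -> x <= ereal_inf A + ereal_inf B.
Proof.
move=> A0 B0 xAB.
have iA : 0 <= ereal_inf A by apply: le_ereal_inf_tmp => a /A0.
have iB : 0 <= ereal_inf B by apply: le_ereal_inf_tmp => a /B0.
have [->|Af] := eqVneq (ereal_inf A) +oo.
  by rewrite addye ?leey// gt_eqF// (lt_le_trans _ iB).
have [->|Bf] := eqVneq (ereal_inf B) +oo.
  by rewrite addey ?leey// gt_eqF// (lt_le_trans _ iA).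
have {}Af : ereal_inf A \is a fin_num by rewrite ge0_fin_numE// lt_neqAle Af leey.
have {}Bf : ereal_inf B \is a fin_num by rewrite ge0_fin_numE// lt_neqAle Bf leey.
apply/lee_addgt0Pr => e e0.
have e2 : (0 < e / 2)%R by rewrite divr_gt0.
have [a Aa ae] := lb_ereal_inf_adherent e2 Af.
have [b Bb be] := lb_ereal_inf_adherent e2 Bf.
apply: le_trans (xAB _ _ Aa Bb) _.
rewrite [e]splitr EFinD addeACA.
by apply: leeD; exact: ltW.
Qed.

Implicit Types (U A B : set C) (s : R).

Lemma diam_le U A : U `<=` A -> diam U <= diam A.
Proof.
move=> UA; apply: ereal_sup_le => _ [[x y] [/= Ux Uy] <-].
by exists (x, y) => //; split; exact: UA.
Qed.

Lemma dist_le_diam U x y : U x -> U y -> `|x - y|%:E <= diam U.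
Proof. by move=> Ux Uy; apply: ereal_sup_ubound; exists (x, y). Qed.

Lemma diam_le_bound U (M : \bar R) :
  (forall x y, U x -> U y -> `|x - y|%:E <= M) -> diam U <= M.
Proof. by move=> UM; apply: ge_ereal_sup => _ [[x y] [/= Ux Uy] <-]; exact: UM. Qed.

Lemma diam_ge0 U : U !=set0 -> 0 <= diam U.
Proof. by case=> x Ux; apply: le_trans (dist_le_diam Ux Ux). Qed.

Lemma diam_set0 : diam (set0 : set C) = -oo.
Proof. by apply/eqP; rewrite -leeNy_eq; apply: diam_le_bound. Qed.

Lemma diam_pow_ge0 s U : 0 <= diam_pow s U.
Proof. by rewrite /diam_pow; case: ifP => // _; exact: poweR_ge0. Qed.
Hint Resolve diam_pow_ge0 : core.

Lemma diam_pow_bound s U (M : R) : (0 <= s)%R -> (0 <= M)%R -> diam U <= M%:E ->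
  diam_pow s U <= (M `^ s)%:E.
Proof.
move=> s0 M0 UM; rewrite /diam_pow; case: ifPn => [_|/set0P U0].
  by rewrite lee_fin powR_ge0.
rewrite -poweR_EFin; apply: gt0_ler_poweR => //;
  by rewrite ?in_itv/= ?leey ?andbT ?diam_ge0 ?lee_fin.
Qed.

Lemma premeasure_ge0 s d A : 0 <= hausdorff_premeasure s d A.
Proof.
by apply: le_ereal_inf_tmp => _ [U _ <-]; apply: nneseries_ge0.
Qed.

Lemma premeasure_le s d A B : A `<=` B ->
  hausdorff_premeasure s d A <= hausdorff_premeasure s d B.
Proof.
move=> AB; apply: le_ereal_inf_tmp => _ [U [BU Ud] <-].
by apply: ereal_inf_lbound; exists U => //; split => //; exact: subset_trans BU.
Qed.

Lemma premeasure_delta s d d' A : (d <= d')%R ->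
  hausdorff_premeasure s d' A <= hausdorff_premeasure s d A.
Proof.
move=> dd'; apply: le_ereal_inf_tmp => _ [U [AU Ud] <-].
apply: ereal_inf_lbound; exists U => //; split => // i.
by apply: le_trans (Ud i) _; rewrite lee_fin.
Qed.

Lemma premeasureU s d A B : hausdorff_premeasure s d (A `|` B) <=
  hausdorff_premeasure s d A + hausdorff_premeasure s d B.
Proof.
apply: lee_ereal_inf_add => [_ [U _ <-]|_ [U _ <-]|_ _ [U [AU Ud] <-] [V [BV Vd] <-]];
  do ?exact: nneseries_ge0.
(* The two covers are interleaved, even indices for [A] and odd ones for [B]. *)
pose W n := if odd n then V n./2 else U n./2.
apply: (@le_trans _ _ (\sum_(0 <= i <oo) diam_pow s (W i))).
  apply: ereal_inf_lbound; exists W => //; split.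
    move=> x [/AU[i _ Ux]|/BV[i _ Vx]].
      by exists i.*2 => //; rewrite /W odd_double doubleK.
    by exists i.*2.+1 => //; rewrite /W oddS odd_double/= uphalf_double.
  by move=> i; rewrite /W; case: ifP.
apply: lime_le; first exact: is_cvg_nneseries.
apply: nearW => n.
apply: (@le_trans _ _ (\sum_(0 <= i < n.*2) diam_pow s (W i))).
  by apply: lee_sum_nneg_natr => //; rewrite -addnn leq_addr.
have -> : \sum_(0 <= i < n.*2) diam_pow s (W i) =
  \sum_(0 <= i < n) diam_pow s (U i) + \sum_(0 <= i < n) diam_pow s (V i).
  elim: n => [|n IH]; first by rewrite !big_nil adde0.
  rewrite doubleS !big_nat_recr//= IH /W oddS odd_double/= doubleK uphalf_double.
  by rewrite -addeA addeACA.
by apply: leeD; apply: nneseries_lim_ge.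
Qed.

Lemma premeasure_le_diam s d A : diam A <= d%:E ->
  hausdorff_premeasure s d A <= diam_pow s A.
Proof.
move=> Ad; apply: ge_ereal_inf.
(* Padding by empty sets is free: their diameter -oo meets any bound, and [diam_pow] gives them 0
   even for exponent 0. *)
pose U (i : nat) := if i is 0%N then A else set0.
exists (\sum_(0 <= i <oo) diam_pow s (U i)).
  exists U => //; split=> [x Ax|[|i]//=]; first by exists 0%N.
  by rewrite diam_set0 leNye.
apply: lime_le; first exact: is_cvg_nneseries.
apply: nearW => -[|n]; first by rewrite big_nil.
rewrite big_nat_recl//= big1 ?adde0// => i _.
by rewrite /diam_pow eqxx.
Qed.

Lemma premeasure_scale s d A (S : C -> C) (r : R) : (0 < r)%R ->
  (forall x y, `|S x - S y| <= r * `|x - y|)%R -> (0 <= s)%R ->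
  hausdorff_premeasure s (r * d) (S @` A) <= (r `^ s)%:E * hausdorff_premeasure s d A.
Proof.
move=> r0 Sr s0; have rs0 : (0 < r `^ s)%R by rewrite powR_gt0.
have dS U (M : \bar R) : diam U <= M -> diam (S @` U) <= r%:E * M.
  move=> UM; apply: diam_le_bound => _ _ [x Ux <-] [y Uy <-].
  apply: le_trans (_ : (r * `|x - y|)%:E <= _); first by rewrite lee_fin.
  by rewrite EFinM lee_pmul2l// (le_trans _ UM)// dist_le_diam.
rewrite -lee_pdivrMl//; apply: le_ereal_inf_tmp => _ [U [AU Ud] <-].
rewrite lee_pdivrMl// -nneseriesZl//.
apply: (@le_trans _ _ (\sum_(0 <= i <oo) diam_pow s (S @` U i))).
  apply: ereal_inf_lbound; exists (fun i => S @` U i) => //; split.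
    by move=> _ [x /AU[i _ Ux] <-]; exists i => //; exists x.
  by move=> i; rewrite EFinM; exact: dS.
apply: lee_nneseries => // i _.
rewrite /diam_pow; case: ifPn => [_|/set0P[_ [x Ux _]]].
  by rewrite mule_ge0// ?lee_fin ?powR_ge0//; case: ifP => // _; exact: poweR_ge0.
have U0 : U i !=set0 by exists x.
rewrite ifF; last by apply/negbTE/set0P.
rewrite -poweR_EFin -poweRM ?diam_ge0 ?lee_fin ?(ltW r0)//.
apply: gt0_ler_poweR => //; rewrite ?in_itv/= ?leey ?andbT ?diam_ge0//.
- by exists (S x); exists x.
- by rewrite mule_ge0 ?diam_ge0// lee_fin ltW.
- exact: dS.
Qed.

Lemma hausdorff_measure_ge0 s A : 0 <= hausdorff_measure s A.
Proof.
apply: le_trans (premeasure_ge0 s 1 A) _.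
by apply: ereal_sup_ubound; exists 1%R => //=; exact: ltr01.
Qed.

Lemma hausdorff_measure_le s A B : A `<=` B ->
  hausdorff_measure s A <= hausdorff_measure s B.
Proof.
move=> AB; apply: ge_ereal_sup => _ [d d0 <-].
apply: le_trans (premeasure_le s d AB) _.
by apply: ereal_sup_ubound; exists d.
Qed.

Lemma hausdorff_measureU s A B : hausdorff_measure s (A `|` B) <=
  hausdorff_measure s A + hausdorff_measure s B.
Proof.
apply: ge_ereal_sup => _ [d d0 <-]; apply: le_trans (premeasureU s d A B) _.
by apply: leeD; apply: ereal_sup_ubound; exists d.
Qed.

Lemma hausdorff_measure_scale s A (S : C -> C) (r : R) : (0 < r)%R ->
  (forall x y, `|S x - S y| <= r * `|x - y|)%R -> (0 <= s)%R ->
  hausdorff_measure s (S @` A) <= (r `^ s)%:E * hausdorff_measure s A.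
Proof.
move=> r0 Sr s0; apply: ge_ereal_sup => _ [d d0 <-].
have -> : d = (r * (d / r))%R by rewrite mulrC divfK// gt_eqF.
apply: le_trans (premeasure_scale _ _ r0 Sr s0) _.
rewrite lee_pmul2l ?lte_fin ?powR_gt0//.
by apply: ereal_sup_ubound; exists (d / r)%R => //=; rewrite divr_gt0.
Qed.

Lemma hausdorff_measure1 s (x : C) : (0 < s)%R -> hausdorff_measure s [set x] = 0.
Proof.
move=> s0; apply/eqP; rewrite eq_le hausdorff_measure_ge0 andbT.
have dx : diam [set x] <= 0.
  by apply: diam_le_bound => _ _ -> ->; rewrite subrr normr0.
apply: ge_ereal_sup => _ [d d0 <-].
apply: le_trans (premeasure_le_diam _ _) _.
  by apply: le_trans dx _; rewrite lee_fin ltW.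
apply: le_trans (diam_pow_bound (ltW s0) (lexx 0%R) dx) _.
by rewrite powR0// gt_eqF.
Qed.

End Hausdorff.

Lemma exprn_small (R : realType) (c D e : R) : 0 <= c < 1 -> 0 < e ->
  exists n, c ^+ n * D < e.
Proof.
move=> /andP[c0 c1] e0.
have D1 : 0 < `|D| + 1 by rewrite ltr_wpDl.
have : (fun n => c ^+ n) @ \oo --> (0 : R) by apply: cvg_expr; rewrite ger0_norm.
move=> /cvgrPdist_lt /(_ _ (divr_gt0 e0 D1))[N _ /(_ N (leqnn N))] /=.
rewrite sub0r normrN ger0_norm ?exprn_ge0// ltr_pdivlMr// => h.
exists N; apply: le_lt_trans h; rewrite ler_wpM2l ?exprn_ge0//.
by rewrite (le_trans (ler_norm _))// lerDl.
Qed.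

Lemma ratio_bound (R : realType) (l : nat) (rho : nat -> R) :
  (forall j, (1 <= j <= l)%N -> 0 < rho j < 1) ->
  exists2 c : R, 0 <= c < 1 & forall j, (1 <= j <= l)%N -> rho j <= c.
Proof.
elim: l => [|n IH] r01; first by exists 0 => [|[]//]; rewrite lexx ltr01.
have [j /andP[j1 jn]|c /andP[c0 c1] cP] := IH; first by rewrite r01// j1 ltnW.
have /andP[rn0 rn1] := r01 n.+1 (leqnn _).
exists (Num.max c (rho n.+1)); first by rewrite le_max c0 gt_max c1.
move=> j /andP[j1]; rewrite leq_eqVlt => /predU1P[->|jn].
  by rewrite le_max lexx orbT.
by rewrite le_max cP ?j1.
Qed.

(** * Self-similar charts *)

Section Chart.
Variable R : realType.
Local Notation C := (Rcomplex R).

(* [h j] is the [j]-th similitude read in the parametrization [gam], and [rho j]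
   is its ratio. *)
Record self_similar_chart (l : nat) (gam : R -> C) (h : nat -> R -> R)
    (rho : nat -> R) : Prop := SelfSimilarChart {
  ch_len : (1 < l)%N ;
  ch_rho : forall j, (1 <= j <= l)%N -> 0 < rho j < 1 ;
  ch_itv : forall j t, (1 <= j <= l)%N -> 0 <= t <= 1 -> 0 <= h j t <= 1 ;
  ch_homo : forall j t u, (1 <= j <= l)%N -> 0 <= t -> t <= u -> u <= 1 -> h j t <= h j u ;
  ch_dist : forall j t u, (1 <= j <= l)%N -> 0 <= t <= 1 -> 0 <= u <= 1 ->
    `|gam (h j t) - gam (h j u)| = rho j * `|gam t - gam u| ;
  ch_cover : forall t, 0 <= t <= 1 ->
    exists j, (1 <= j <= l)%N /\ exists2 u, 0 <= u <= 1 & t = h j u ;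
  ch_start : h 1%N 0 = 0 ;
  ch_end : h l 1 = 1 ;
  ch_link : forall j, (1 <= j < l)%N -> h j 1 = h j.+1 0 ;
  ch_order : forall i j t u, (1 <= i)%N -> (i < j <= l)%N -> 0 <= t <= 1 -> 0 <= u <= 1 ->
    h i t <= h j u ;
  ch_inj : forall t u, 0 <= t <= 1 -> 0 <= u <= 1 -> gam t = gam u -> t = u ;
  ch_bound : exists D : R, forall t u, 0 <= t <= 1 -> 0 <= u <= 1 -> `|gam t - gam u| <= D ;
  ch_sep : exists2 del : R, 0 < del & forall i j t u, (1 <= i)%N -> (i.+1 < j <= l)%N ->
    0 <= t <= 1 -> 0 <= u <= 1 -> del <= `|gam (h i t) - gam (h j u)| ;
  ch_corner : exists2 kap : R, 0 < kap & forall p t u, (1 <= p < l)%N ->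
    0 <= t <= 1 -> 0 <= u <= 1 ->
    kap * `|gam (h p t) - gam (h p 1)| <= `|gam (h p t) - gam (h p.+1 u)| /\
    kap * `|gam (h p.+1 u) - gam (h p 1)| <= `|gam (h p t) - gam (h p.+1 u)|
}.

Variables (l : nat) (gam : R -> C) (h : nat -> R -> R) (rho : nat -> R).
Hypothesis ch : self_similar_chart l gam h rho.

Let l0 : (0 < l)%N. Proof. exact: ltnW (ch_len ch). Qed.
Let I0 : 0 <= (0 : R) <= 1. Proof. by rewrite lexx ler01. Qed.
Let I1 : 0 <= (1 : R) <= 1. Proof. by rewrite lexx ler01. Qed.
Let L1 : (1 <= 1 <= l)%N. Proof. by []. Qed.
Let Ll : (1 <= l <= l)%N. Proof. by rewrite l0 leqnn. Qed.
Hint Resolve I0 I1 L1 Ll : core.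

Let dist_gt0 t u : 0 <= t <= 1 -> 0 <= u <= 1 -> t != u -> 0 < `|gam t - gam u|.
Proof.
move=> t1 u1 tu; rewrite normr_gt0 subr_eq0; apply: contra tu => /eqP /(ch_inj ch).
by move=> -> //.
Qed.

Let rho_max := ratio_bound (ch_rho ch).

Let gam_diff t u D : 0 <= t <= 1 -> 0 <= u <= 1 ->
  (forall t u, 0 <= t <= 1 -> 0 <= u <= 1 -> `|gam t - gam u| <= D) ->
  D < `|gam t - gam u| -> False.
Proof. by move=> t1 u1 /(_ t u t1 u1) /le_lt_trans h1 /h1; rewrite ltxx. Qed.

(** Copies from the third on are kept away by [ch_sep]. For the second copy the corner inequality
    applies, the distance from [gam 0] to the common vertex being that of the endpoints scaled by
    [rho 1]. *)
Lemma start_sep : exists2 del : R, 0 < del & forall j u,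
  (1 < j <= l)%N -> 0 <= u <= 1 -> del <= `|gam 0 - gam (h j u)|.
Proof.
have [del del0 sep] := ch_sep ch; have [kap kap0 cor] := ch_corner ch.
have /andP[r0 _] := ch_rho ch L1.
have g01 : 0 < `|gam 0 - gam 1| by rewrite dist_gt0// eq_sym oner_eq0.
exists (Num.min del (kap * (rho 1%N * `|gam 0 - gam 1|))).
  by rewrite lt_min del0 !mulr_gt0.
move=> j u /andP[]; rewrite leq_eqVlt => /predU1P[<- l2|j3 jl] u1 .
  have := (cor 1%N 0 u l2 I0 u1).1.
  by rewrite (ch_dist ch)// (ch_start ch) ge_min => ->; rewrite orbT.
by rewrite ge_min -{1}(ch_start ch) sep// j3.
Qed.

Lemma end_sep : exists2 del : R, 0 < del & forall j u,
  (1 <= j < l)%N -> 0 <= u <= 1 -> del <= `|gam 1 - gam (h j u)|.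
Proof.
have [del del0 sep] := ch_sep ch; have [kap kap0 cor] := ch_corner ch.
have /andP[r0 _] := ch_rho ch Ll.
have g01 : 0 < `|gam 1 - gam 0| by rewrite dist_gt0// oner_eq0.
exists (Num.min del (kap * (rho l * `|gam 1 - gam 0|))).
  by rewrite lt_min del0 !mulr_gt0.
move=> j u /andP[j1]; rewrite leq_eqVlt => /predU1P[jl|jl] u1.
  have jl' : (1 <= j < l)%N by rewrite j1 -jl leqnn.
  have := (cor j u 1 jl' u1 I1).2.
  rewrite (ch_link ch)// jl (ch_dist ch)// (ch_end ch) ge_min [X in _ -> _ || (_ <= X)]distrC => ->.
  by rewrite orbT.
by rewrite ge_min -{1}(ch_end ch) distrC sep// jl leqnn.
Qed.

Section Hoelder.
Local Open Scope ereal_scope.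
Variables (sg M : R).
Hypotheses (sg0 : (0 <= sg)%R) (M0 : (0 <= M)%R).
Let pow1 : (1 `^ sg = 1)%R. Proof. by rewrite powR1. Qed.

(* A quantity that scales like the [sg]-th power of the distance under the map
   fixing the endpoint [p] is controlled by the distance to [p], because the
   points outside the piece containing [p] stay away from it. *)
Lemma endpoint_hoelder (dd : R -> \bar R) (p : R) (k : nat) :
  (0 <= p <= 1)%R -> (1 <= k <= l)%N -> h k p = p ->
  (exists2 del : R, (0 < del)%R & forall j u, (1 <= j <= l)%N -> j != k ->
     (0 <= u <= 1)%R -> (del <= `|gam p - gam (h j u)|)%R) ->
  (forall b, (0 <= b <= 1)%R -> dd b <= M%:E) -> dd p <= 0 ->
  (forall b, (0 <= b <= 1)%R -> dd (h k b) <= (rho k `^ sg)%:E * dd b) ->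
  exists2 c : R, (0 <= c)%R & forall b, (0 <= b <= 1)%R ->
    dd b <= (c * `|gam p - gam b| `^ sg)%:E.
Proof.
move=> p1 kl hp [del del0 sep] ddM ddp dds.
have c0 : (0 <= M * (del^-1) `^ sg)%R by rewrite mulr_ge0// powR_ge0.
exists (M * (del^-1) `^ sg)%R => // b b1.
have [<-|pb] := eqVneq p b.
  by apply: le_trans ddp _; rewrite lee_fin mulr_ge0// powR_ge0.
have [D Dle] := ch_bound ch; have [c c1 rc] := rho_max.
have /andP[rk0 rk1] := ch_rho ch kl.
(* [n] limits the number of zooms: each one multiplies the distance to [p] by at least [c^-1], and
   this distance never exceeds [D]. *)
have [n nb] := exprn_small D c1 (dist_gt0 p1 b1 pb).
elim: n b b1 pb nb => [|n IH] b b1 pb nb.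
  by rewrite expr0 mul1r in nb; case: (gam_diff p1 b1 Dle nb).
have [j [jl [u u1 bE]]] := ch_cover ch b1.
have [jk|jk] := eqVneq j k; last first.
  apply: le_trans (ddM b b1) _; rewrite lee_fin -mulrA -powRM ?invr_ge0 ?(ltW del0)//.
  rewrite -{1}[M]mulr1 ler_wpM2l// -{1}pow1 ge0_ler_powR ?nnegrE ?mulr_ge0 ?invr_ge0 ?(ltW del0)//.
  by rewrite mulrC ler_pdivlMr// mul1r bE sep.
have pu : p != u by apply: contra pb => /eqP pu; rewrite bE jk -pu hp.
have gE : (`|gam p - gam b| = rho k * `|gam p - gam u|)%R.
  by rewrite -{1}hp bE jk (ch_dist ch).
rewrite bE jk; apply: le_trans (dds u u1) _.
rewrite bE jk in gE nb; rewrite gE powRM ?(ltW rk0)// mulrCA EFinM.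
rewrite lee_wpmul2l ?lee_fin ?powR_ge0//.
apply: IH => //; move: nb; rewrite gE exprSr -mulrA => nb.
have [/andP[cp c1'] rkc] := (c1, rc k kl).
have c00 : (0 < c)%R by exact: lt_le_trans rkc.
rewrite -(ltr_pM2l c00) mulrCA; apply: lt_le_trans nb _.
by rewrite ler_wpM2r.
Qed.

(* Zooming in on the smallest copy containing both points leaves them in two
   different copies: either these are not successive, and the points are far
   apart, or one goes through the common vertex. *)
Theorem chart_hoelder (d : R -> R -> \bar R) :
  (forall a b, (0 <= a)%R -> (a <= b)%R -> (b <= 1)%R -> d a b <= M%:E) ->
  (forall a, (0 <= a <= 1)%R -> d a a <= 0) ->
  (forall a b c, (0 <= a)%R -> (a <= b)%R -> (b <= c)%R -> (c <= 1)%R ->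
    d a c <= d a b + d b c) ->
  (forall j a b, (1 <= j <= l)%N -> (0 <= a)%R -> (a <= b)%R -> (b <= 1)%R ->
    d (h j a) (h j b) <= (rho j `^ sg)%:E * d a b) ->
  exists2 c : R, (0 <= c)%R & forall a b, (0 <= a)%R -> (a <= b)%R -> (b <= 1)%R ->
    d a b <= (c * `|gam a - gam b| `^ sg)%:E.
Proof.
move=> dM d0 dT dS.
have [C0 C00 start] : exists2 c : R, (0 <= c)%R & forall b, (0 <= b <= 1)%R ->
    d 0%R b <= (c * `|gam 0 - gam b| `^ sg)%:E.
  apply: (@endpoint_hoelder (d 0%R) 0 1%N) => //.
  - exact: ch_start ch.
  - have [del del0 sep] := start_sep; exists del => // j u /andP[j1 jl] jn u1.
    by apply: sep => //; rewrite jl andbT ltn_neqAle eq_sym jn.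
  - by move=> b /andP[? ?]; apply: dM.
  - exact: d0.
  - by move=> b /andP[? ?]; rewrite -{1}(ch_start ch) dS.
have [C1 C10 endp] : exists2 c : R, (0 <= c)%R & forall b, (0 <= b <= 1)%R ->
    d b 1%R <= (c * `|gam 1 - gam b| `^ sg)%:E.
  apply: (@endpoint_hoelder (d^~ 1%R) 1 l) => //.
  - exact: ch_end ch.
  - have [del del0 sep] := end_sep; exists del => // j u /andP[j1 jl] jn u1.
    by apply: sep => //; rewrite j1 ltn_neqAle jn.
  - by move=> b /andP[? ?]; apply: dM.
  - exact: d0.
  - by move=> b /andP[? ?]; rewrite -{1}(ch_end ch) dS.
have [del del0 sep] := ch_sep ch; have [kap kap0 cor] := ch_corner ch.
(* The first term serves copies that are not successive, the second one pairs of points on either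
   side of a vertex. *)
pose K := (M * del^-1 `^ sg + (C1 + C0) * kap^-1 `^ sg)%R.
have K1 : (0 <= M * del^-1 `^ sg)%R by rewrite mulr_ge0// powR_ge0.
have K2 : (0 <= (C1 + C0) * kap^-1 `^ sg)%R by rewrite mulr_ge0 ?addr_ge0// powR_ge0.
have K0 : (0 <= K)%R by rewrite addr_ge0.
exists K => // a b a0 ab b1.
have [<-|aneb] := eqVneq a b.
  apply: le_trans (d0 a _) _; first by rewrite a0 (le_trans ab).
  by rewrite lee_fin mulr_ge0// powR_ge0.
have [D Dle] := ch_bound ch; have [c c1 rc] := rho_max.
have aI (x y : R) : (0 <= x)%R -> (x <= y)%R -> (y <= 1)%R -> (0 <= x <= 1)%R /\ (0 <= y <= 1)%R.
  by move=> x0 xy y1; rewrite x0 y1 (le_trans xy) ?(le_trans x0 xy).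
have [n nab] : exists n, (c ^+ n * D < `|gam a - gam b|)%R.
  by have [? ?] := aI a b a0 ab b1; apply: exprn_small => //; exact: dist_gt0.
elim: n a b a0 ab b1 aneb nab => [|n IH] a b a0 ab b1 aneb nab.
  have [? ?] := aI a b a0 ab b1.
  by rewrite expr0 mul1r in nab; case: (gam_diff _ _ Dle nab).
have [a1 b1'] := aI a b a0 ab b1.
have [i [il [t t1 aE]]] := ch_cover ch a1.
have [j [jl [u u1 bE]]] := ch_cover ch b1'.
have [/andP[i1 il'] /andP[j1 jl']] := (il, jl).
have [ij|ji|ij] := ltngtP i j; last first.
- have /andP[rj0 rj1] := ch_rho ch jl.
  have tu : (t <= u)%R.
    rewrite leNgt; apply/negP => ut; move: aneb; rewrite eq_le ab/=.
    rewrite aE bE ij (ch_homo ch jl _ (ltW ut))//; last by case/andP: t1.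
    by case/andP: u1.
  have gE : (`|gam a - gam b| = rho j * `|gam t - gam u|)%R.
    by rewrite aE bE ij (ch_dist ch).
  have [[/andP[t0 _] /andP[_ u1']]] := (t1, u1).
  rewrite aE bE ij; apply: le_trans (dS j t u jl t0 tu u1') _.
  rewrite -{2}ij -aE -bE gE powRM ?(ltW rj0)// mulrCA EFinM.
  rewrite lee_wpmul2l ?lee_fin ?powR_ge0//.
  apply: IH => //; first by apply: contra aneb => /eqP tu'; rewrite aE bE ij tu'.
  move: nab; rewrite gE exprSr -mulrA => nab.
  have rjc := rc j jl.
  have c00 : (0 < c)%R by exact: lt_le_trans rjc.
  rewrite -(ltr_pM2l c00) mulrCA; apply: lt_le_trans nab _.
  by rewrite ler_wpM2r.
- have : (b <= a)%R by rewrite aE bE (ch_order ch)// ji.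
  by move=> ba; move: aneb; rewrite eq_le ab ba.
- move: (ij); rewrite leq_eqVlt => /predU1P[ji|ij2]; last first.
    apply: le_trans (dM a b a0 ab b1) _; rewrite lee_fin.
    apply: (@le_trans _ _ (M * del^-1 `^ sg * `|gam a - gam b| `^ sg)%R); last first.
      by rewrite ler_wpM2r ?powR_ge0// lerDl.
    rewrite -mulrA -powRM ?invr_ge0 ?(ltW del0)//.
    rewrite -{1}[M]mulr1 ler_wpM2l// -{1}pow1.
    rewrite ge0_ler_powR ?nnegrE ?mulr_ge0 ?invr_ge0 ?(ltW del0)//.
    by rewrite mulrC ler_pdivlMr// mul1r aE bE sep// ij2.
  have il2 : (1 <= i < l)%N by rewrite i1 ji.
  have [/andP[t0 t1'] /andP[u0 u1']] := (t1, u1).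
  have pI := ch_itv ch il I1.
  have ap : (a <= h i 1)%R by rewrite aE (ch_homo ch).
  have pb : (h i 1 <= b)%R by rewrite (ch_link ch)// ji bE (ch_homo ch).
  apply: le_trans (dT a (h i 1) b a0 ap pb b1) _.
  have gb : (0 <= `|gam a - gam b| / kap)%R by rewrite divr_ge0// ltW.
  (* Reading copy [i] at full size turns the arc from [a] to the vertex into one that ends at
     parameter 1, where [endp] applies; the corner inequality then replaces the distance to the
     vertex by the distance to [b]. *)
  have E1 : d a (h i 1) <= (C1 * (`|gam a - gam b| / kap) `^ sg)%:E.
    have /andP[r0 _] := ch_rho ch il.
    rewrite {1}aE; apply: le_trans (dS _ _ _ il t0 t1' (lexx 1%R)) _.
    apply: (@le_trans _ _ (rho i `^ sg * (C1 * `|gam 1 - gam t| `^ sg))%:E).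
      by rewrite EFinM lee_wpmul2l ?lee_fin ?powR_ge0// endp.
    rewrite lee_fin mulrCA ler_wpM2l// -powRM ?(ltW r0)//.
    rewrite ge0_ler_powR ?nnegrE ?mulr_ge0 ?invr_ge0 ?(ltW r0) ?(ltW kap0)//.
    rewrite ler_pdivlMr// -(ch_dist ch)// mulrC distrC.
    by have := (cor i t u il2 t1 u1).1; rewrite ji -aE -bE.
  have E2 : d (h i 1) b <= (C0 * (`|gam a - gam b| / kap) `^ sg)%:E.
    have /andP[r0 _] := ch_rho ch jl.
    rewrite (ch_link ch)// ji {1}bE; apply: le_trans (dS _ _ _ jl (lexx 0%R) u0 u1') _.
    apply: (@le_trans _ _ (rho j `^ sg * (C0 * `|gam 0 - gam u| `^ sg))%:E).
      by rewrite EFinM lee_wpmul2l ?lee_fin ?powR_ge0// start.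
    rewrite lee_fin mulrCA ler_wpM2l// -powRM ?(ltW r0)//.
    rewrite ge0_ler_powR ?nnegrE ?mulr_ge0 ?invr_ge0 ?(ltW r0) ?(ltW kap0)//.
    rewrite ler_pdivlMr// -(ch_dist ch)// mulrC distrC.
    by have := (cor i t u il2 t1 u1).2; rewrite (ch_link ch)// ji -aE -bE.
  apply: le_trans (leeD E1 E2) _; rewrite -EFinD lee_fin -mulrDl.
  rewrite powRM ?invr_ge0 ?(ltW kap0)// [(_ `^ sg * _)%R]mulrC mulrA.
  by rewrite ler_wpM2r ?powR_ge0// lerDr.
Qed.

End Hoelder.
End Chart.

(** * The distribution function of the natural measure *)

Section NaturalMeasure.
Variable R : realType.
Local Notation C := (Rcomplex R).
Variables (l : nat) (gam : R -> C) (h : nat -> R -> R) (rho p : nat -> R).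
Hypothesis ch : self_similar_chart l gam h rho.
Hypothesis p_gt0 : forall j, 0 < p j.
Hypothesis p1 : \sum_(1 <= j < l.+1) p j = 1.

Let p0 j : 0 <= p j. Proof. exact: ltW. Qed.
Let P j := \sum_(1 <= i < j) p i.

Let P1 : P 1%N = 0. Proof. by rewrite /P big_geq. Qed.
Let PS j : (1 <= j)%N -> P j.+1 = P j + p j.
Proof. by move=> j1; rewrite /P big_nat_recr. Qed.
Let P_ge0 j : 0 <= P j. Proof. by rewrite /P sumr_ge0. Qed.
Let P_le1 j : (1 <= j <= l)%N -> P j + p j <= 1.
Proof.
move=> /andP[j1 jl]; rewrite -PS// -p1 /P (@big_cat_nat _ _ _ j.+1 1 l.+1)//=.
by rewrite lerDl sumr_ge0.
Qed.
Let I0 : 0 <= (0 : R) <= 1. Proof. by rewrite lexx ler01. Qed.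
Let I1 : 0 <= (1 : R) <= 1. Proof. by rewrite lexx ler01. Qed.
Let l0 : (0 < l)%N. Proof. exact: ltnW (ch_len ch). Qed.

(** For successive copies, equal points make the corner inequality send both to the common vertex;
    otherwise they contradict [ch_sep]. *)
Let meet i j t u : (1 <= i)%N -> (i < j <= l)%N -> 0 <= t <= 1 -> 0 <= u <= 1 ->
  h i t = h j u -> [/\ j = i.+1, t = 1 & u = 0].
Proof.
move=> i1 /andP[ij jl] t1 u1 htu.
have [del del0 sep] := ch_sep ch; have [kap kap0 cor] := ch_corner ch.
have ji : j = i.+1.
  apply/eqP; rewrite eqn_leq ij andbT leqNgt; apply/negP => ij2.
  have : del <= `|gam (h i t) - gam (h j u)| by rewrite sep// ij2.
  by rewrite htu subrr normr0 leNgt del0.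
have il : (1 <= i < l)%N by rewrite i1 (leq_trans ij).
have il' : (1 <= i <= l)%N by rewrite i1 ltnW// (leq_trans ij).
have il2 : (1 <= i.+1 <= l)%N by rewrite -ji jl ji.
have [h1 h2] := cor i t u il t1 u1.
rewrite -ji -htu subrr normr0 in h1 h2.
have inj k v w : (1 <= k <= l)%N -> 0 <= v <= 1 -> 0 <= w <= 1 ->
    `|gam (h k v) - gam (h k w)| <= 0 -> v = w.
  move=> kl v1 w1; have /andP[rk _] := ch_rho ch kl.
  rewrite (ch_dist ch)// pmulr_rle0// normr_le0 subr_eq0 => /eqP.
  exact: (ch_inj ch).
split => //; first by apply: (inj i) => //; rewrite -(pmulr_rle0 _ kap0).
apply: (inj j) => //; first by rewrite ji.
by rewrite -(pmulr_rle0 _ kap0) -htu ji -(ch_link ch).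
Qed.

Let sub (psi : R -> R) := (forall t, 0 <= t <= 1 -> 0 <= psi t <= 1) /\
  forall j t, (1 <= j <= l)%N -> 0 <= t <= 1 -> psi (h j t) <= P j + p j * psi t.

(** The indicator of 1 makes the family of subsolutions nonempty and the supremum equal to 1 at 1.
    It is a subsolution because only the last copy reaches 1, and only at its end. *)
Let sub1 : sub (fun t => if t == 1 then 1 else 0).
Proof.
split=> [t _|j t jl t1]; first by case: ifP.
case: ifPn => [/eqP ht1|_]; last first.
  by rewrite addr_ge0// mulr_ge0//; case: ifP.
have /andP[j1] := jl; rewrite leq_eqVlt => /predU1P[jE|jl'].
  have -> : t = 1.
    apply: (ch_inj ch) => //; apply/eqP; rewrite -subr_eq0 -normr_eq0.
    have /andP[rk _] := ch_rho ch jl.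
    have := ch_dist ch jl t1 I1; rewrite ht1 jE (ch_end ch) subrr normr0 => /esym/eqP.
    by rewrite -jE mulf_eq0 (gt_eqF rk).
  by rewrite eqxx mulr1 -PS// jE /P p1.
have [] : [/\ l = j.+1, t = 1 & (1 : R) = 0].
  by apply: meet => //; rewrite ?jl' ?leqnn// ht1 (ch_end ch).
by move=> _ _ /eqP; rewrite oner_eq0.
Qed.

Let phi t := sup [set psi t | psi in sub].

Let has_sup_sub t : 0 <= t <= 1 -> has_sup [set psi t | psi in sub].
Proof.
move=> t1; split; first by exists (if t == 1 then 1 else 0); exists (fun t => if t == 1 then 1 else 0).
by exists 1 => _ [psi [psi1 _] <-]; have /andP[] := psi1 t t1.
Qed.

Let sub_le psi t : 0 <= t <= 1 -> sub psi -> psi t <= phi t.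
Proof. by move=> t1 sp; apply: ub_le_sup; [case: (has_sup_sub t1)|exists psi]. Qed.

Let phi_le t x : 0 <= t <= 1 -> (forall psi, sub psi -> psi t <= x) -> phi t <= x.
Proof.
move=> t1 H; apply: ge_sup; first by case: (has_sup_sub t1).
by move=> _ [psi sp <-]; exact: H.
Qed.

Let sub_phi : sub phi.
Proof.
split=> [t t1|j t jl t1].
  apply/andP; split.
    by apply: le_trans (sub_le t1 sub1); case: ifP.
  by apply: phi_le => // psi [psi1 _]; have /andP[] := psi1 t t1.
apply: phi_le; first exact: ch_itv ch _ _ jl t1.
move=> psi sp; apply: le_trans (sp.2 j t jl t1) _.
by rewrite lerD2l ler_wpM2l// sub_le.
Qed.

(* The largest subsolution of the functional equation
   [phi (h j t) = P j + p j * phi t] solves it. *)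
Lemma natural_measure : exists phi : R -> R, [/\ phi 0 = 0, phi 1 = 1,
  forall t, 0 <= t <= 1 -> 0 <= phi t <= 1 &
  forall j a b, (1 <= j <= l)%N -> 0 <= a <= 1 -> 0 <= b <= 1 ->
    phi (h j a) - phi (h j b) = p j * (phi a - phi b)].
Proof.
have L1 : (1 <= 1 <= l)%N by [].
have phi1 : phi 1 = 1.
  apply/eqP; rewrite eq_le; have /andP[_ ->] := sub_phi.1 1 I1.
  by apply: le_trans (sub_le I1 sub1); rewrite eqxx.
(* At 0 the inequality reads [phi 0 <= p 1 * phi 0], and [p 1 < 1] because there are at least two
   copies. *)
have phi00 : phi 0 <= 0.
  have := sub_phi.2 1%N 0 L1 I0; rewrite (ch_start ch). rewrite P1 add0r.
  have : p 1%N < 1.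
    apply: (@lt_le_trans _ _ (P 3%N)); last by rewrite PS// P_le1// (ch_len ch).
    by rewrite (@PS 2%N)// (@PS 1%N)// P1 add0r ltrDl.
  by nra.
have phi0 : phi 0 = 0.
  by apply/eqP; rewrite eq_le phi00; have /andP[->] := sub_phi.1 0 I0.
(* [F] is the right-hand side of the functional equation. At a vertex shared by two copies it is
   well defined because [phi] is 1 at the end of the first and 0 at the start of the second. *)
have /choice[F FP] : forall s, exists v, 0 <= s <= 1 -> forall j t,
    (1 <= j <= l)%N -> 0 <= t <= 1 -> s = h j t -> v = P j + p j * phi t.
  move=> s; have [s1|ns] := boolP (0 <= s <= 1); last by exists 0.
  have [j [jl [u u1 sE]]] := ch_cover ch s1.
  exists (P j + p j * phi u) => _ k t kl t1 sE'.
  have : h j u = h k t by rewrite -sE.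
  have [/andP[j1 jl'] /andP[k1 kl']] := (jl, kl).
  have [jk|kj|jk] := ltngtP j k.
  - move=> /(meet j1) []//; first by rewrite jk.
    by move=> -> -> ->; rewrite PS// phi1 phi0 mulr0 mulr1 addr0.
  - move=> /esym /(meet k1) []//; first by rewrite kj.
    by move=> -> -> ->; rewrite PS// phi1 phi0 mulr0 mulr1 addr0.
  rewrite -jk => hut; congr (_ + _ * phi _).
  apply: (ch_inj ch) => //; apply/eqP; rewrite -subr_eq0 -normr_eq0.
  have /andP[rk _] := ch_rho ch jl.
  have := ch_dist ch jl u1 t1; rewrite hut subrr normr0 => /esym/eqP.
  by rewrite mulf_eq0 (gt_eqF rk).
have Fh j t : (1 <= j <= l)%N -> 0 <= t <= 1 -> F (h j t) = P j + p j * phi t.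
  by move=> jl t1; apply: FP => //; exact: ch_itv ch _ _ jl t1.
have phiF t : 0 <= t <= 1 -> phi t <= F t.
  move=> t1; have [j [jl [u u1 ->]]] := ch_cover ch t1.
  by rewrite Fh// sub_phi.2.
(* [F] dominates [phi] and is again a subsolution, so maximality gives equality. *)
have subF : sub F.
  split=> [t t1|j t jl t1].
    have [j [jl [u u1 tE]]] := ch_cover ch t1.
    have /andP[f0 f1] := sub_phi.1 u u1.
    rewrite {1 2}tE Fh// addr_ge0 ?mulr_ge0//=.
    apply: le_trans (P_le1 jl); rewrite lerD2l -[leRHS]mulr1.
    exact: ler_wpM2l.
  by rewrite Fh// lerD2l ler_wpM2l// phiF.
have phih j t : (1 <= j <= l)%N -> 0 <= t <= 1 -> phi (h j t) = P j + p j * phi t.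
  move=> jl t1; apply/eqP; rewrite eq_le sub_phi.2//= -Fh// sub_le//.
  exact: ch_itv ch _ _ jl t1.
exists phi; split => //; first exact: sub_phi.1.
by move=> j a b jl a1 b1; rewrite !phih//; ring.
Qed.

End NaturalMeasure.

Section MassDistribution.
Variable R : realType.
Local Notation C := (Rcomplex R).
Local Open Scope ereal_scope.

(** Covering sets have diameter at most 1, so their power [u] dominates their power [sg], and [g]
    sends the trace of each on [A] into an interval of length [2 * K * d i]. These intervals cover
    the unit interval, of Lebesgue measure 1. The extra 1 keeps the constant invertible when [K] is
    0. *)
Lemma mass_distribution (A : set C) (g : C -> R) (K sg u : R) :
  (0 <= K)%R -> (0 <= u <= sg)%R ->
  (forall v, (0 <= v <= 1)%R -> exists2 x, A x & g x = v) ->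
  (forall x y, A x -> A y -> (`|g x - g y| <= K * `|x - y| `^ sg)%R) ->
  ((2 * K + 1)^-1)%:E <= hausdorff_premeasure u 1 A.
Proof.
move=> K0 /andP[u0 usg] gA gK.
have K1 : (0 < 2 * K + 1)%R by rewrite ltr_wpDl// mulr_ge0.
apply: le_ereal_inf_tmp => _ [U [AU Ud] <-].
rewrite -[leLHS]mule1 lee_pdivrMl//.
pose d i := fine (diam_pow u (U i)).
have dE i : diam_pow u (U i) = (d i)%:E.
  rewrite /d fineK// ge0_fin_numE ?diam_pow_ge0//.
  apply: le_lt_trans (diam_pow_bound u0 ler01 (Ud i)) _.
  by rewrite ltry.
have d0 i : (0 <= d i)%R by rewrite -lee_fin -dE diam_pow_ge0.
(* The centre is a value of [g] on the covering set, or 0 if that set misses [A]. *)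
have /choice[c cP] : forall i, exists c : R, forall x, A x -> U i x -> (`|g x - c| <= K * d i)%R.
  move=> i; have [[y [Ay Uy]]|nA] := pselect (exists y, A y /\ U i y); last first.
    by exists 0%R => x Ax Ux; case: nA; exists x.
  exists (g y) => x Ax Ux; apply: le_trans (gK x y Ax Ay) _; rewrite ler_wpM2l//.
  have xy : (`|x - y| <= 1)%R.
    by rewrite -lee_fin; apply: le_trans (Ud i); exact: dist_le_diam.
  apply: (@le_trans _ _ (`|x - y| `^ u)%R).
    have [xyE|xyN] := eqVneq `|x - y|%R 0%R; last first.
      by apply: ger_powR => //; rewrite lt_def xyN normr_ge0.
    rewrite xyE; have [uE|uN] := eqVneq u 0%R; last first.
      by rewrite !powR0// gt_eqF// (lt_le_trans _ usg)// lt_def uN.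
    by rewrite uE powRr0 /powR eqxx; case: (sg == 0%R); rewrite ?ler01.
  rewrite -lee_fin -dE /diam_pow ifF; last by apply/negbTE/set0P; exists x.
  rewrite -poweR_EFin; apply: gt0_ler_poweR => //;
    rewrite ?in_itv/= ?leey ?andbT ?lee_fin// ?dist_le_diam//.
  by rewrite diam_ge0//; exists x.
pose J i : set R := `[(c i - K * d i)%R, (c i + K * d i)%R]%classic.
have muJ i : lebesgue_measure (J i) = (2 * K * d i)%:E.
  rewrite lebesgue_measure_itv/= lte_fin; have := mulr_ge0 K0 (d0 i).
  by case: ltP => ? ?; [rewrite -EFinB|]; congr EFin; lra.
have J01 : `[0%R, 1%R]%classic `<=` \bigcup_i J i.
  move=> v /=; rewrite in_itv/= => /gA[x Ax <-].
  have [i _ Ux] := AU x Ax; exists i => //; rewrite /J/= in_itv/=.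
  have := cP i x Ax Ux; rewrite ler_norml => /andP[? ?].
  by apply/andP; split; lra.
have : lebesgue_measure (`[0%R, 1%R]%classic : set R) <= \sum_(0 <= i <oo) lebesgue_measure (J i).
  by apply: measure_sigma_subadditive => // i; exact: measurable_itv.
have -> : lebesgue_measure (`[0%R, 1%R]%classic : set R) = 1.
  by rewrite (lebesgue_measure_itv `[0%R, 1%R])/= lte_fin ltr01 -EFinB subr0.
move=> /le_trans; apply.
rewrite -nneseriesZl; last by move=> i _; exact: diam_pow_ge0.
apply: lee_nneseries => // i _; rewrite muJ dE -EFinM lee_fin.
by rewrite ler_wpM2r// lerDl.
Qed.

End MassDistribution.

(** * Similarity dimension and covers by copies *)

Section SelfSimilarMeasure.
Variable R : realType.
Local Notation C := (Rcomplex R).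

(** The sum of powers is continuous in the exponent, exceeds 1 at exponent 1, and is at most
    [l * c ^ n < 1] at a large integer [n]. *)
Lemma similarity_dim (l : nat) (rho : nat -> R) :
  (forall j, (1 <= j <= l)%N -> 0 < rho j < 1) ->
  1 < \sum_(1 <= j < l.+1) rho j ->
  exists2 sg, 1 < sg & \sum_(1 <= j < l.+1) rho j `^ sg = 1.
Proof.
move=> r01 r1.
have [c c01 rc] := ratio_bound r01.
pose f (x : R) : R := \sum_(1 <= j < l.+1) rho j `^ x.
have fE x : f x = \sum_(1 <= j < l.+1) expR (x * ln (rho j)).
  rewrite /f !big_nat; apply: eq_bigr => j jl.
  by have /andP[rj0 _] := r01 j jl; rewrite /powR gt_eqF.
have fc : continuous f.
  rewrite (funext fE : f = _); elim: (index_iota 1 l.+1) => [|j r IH].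
    by under eq_fun do rewrite big_nil; exact: cst_continuous.
  under eq_fun do rewrite big_cons.
  move=> x; apply: (@cvgD _ R^o) (IH x).
  apply: continuous_comp; last exact: continuous_expR.
  by apply: cvgMl; exact: cvg_id.
have f1 : f 1 = \sum_(1 <= j < l.+1) rho j.
  rewrite /f !big_nat; apply: eq_bigr => j jl.
  by have /andP[rj0 _] := r01 j jl; rewrite powRr1// ltW.
have lpos : (0 < l)%N.
  by rewrite lt0n; apply: contraTneq r1 => ->; rewrite big_geq// ltr10.
have [n nl] := exprn_small l%:R c01 (ltr01 : 0 < (1 : R)).
have fn : f n%:R < 1.
  apply: le_lt_trans nl; rewrite /f big_nat.
  apply: (@le_trans _ _ (\sum_(1 <= j < l.+1 | (1 <= j < l.+1)%N) c ^+ n)).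
    apply: ler_sum => j jl; have /andP[rj0 _] := r01 j jl.
    rewrite powR_mulrn ?(ltW rj0)// lerXn2r ?nnegrE ?rc// ?(ltW rj0)//.
    by have /andP[] := c01.
  by rewrite -big_nat sumr_const_nat subn1 mulr_natr.
have n1 : (1 : R) <= n%:R.
  rewrite ler1n lt0n; apply/eqP => n0; move: nl; rewrite n0 expr0 mul1r.
  by rewrite ltNge ler1n lpos.
have [|sg] := @IVT R f 1 n%:R 1 n1 (continuous_subspaceT fc).
  by rewrite ge_min le_max (ltW fn) f1 (ltW r1) orbT.
rewrite in_itv/= => /andP[s1 _] fs; exists sg => //.
rewrite lt_neqAle s1 andbT; apply/eqP => s1E; move: r1.
by rewrite -f1 [X in _ < f X]s1E fs ltxx.
Qed.

Variables (l : nat) (L : set C) (S : nat -> C -> C) (rho : nat -> R) (D : R).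
Hypothesis L_sub : L `<=` \bigcup_(j in [set j | (1 <= j <= l)%N]) (S j @` L).
Hypothesis rho01 : forall j, (1 <= j <= l)%N -> 0 < rho j < 1.
Hypothesis S_lip : forall j, (1 <= j <= l)%N ->
  forall x y, `|S j x - S j y| <= rho j * `|x - y|.
Hypothesis D0 : 0 <= D.
Hypothesis L_diam : (diam L <= D%:E)%E.

Local Open Scope ereal_scope.

(** One generation shrinks the scale by [c] and multiplies the premeasure by at most the sum of the
    powers [u] of the ratios; induction on generations avoids enumerating words. *)
Lemma premeasure_self_similar u c n : (0 <= u)%R -> (0 <= c)%R ->
  (forall j, (1 <= j <= l)%N -> (rho j <= c)%R) ->
  hausdorff_premeasure u (c ^+ n * D) L <=
    ((\sum_(1 <= j < l.+1) rho j `^ u) ^+ n * D `^ u)%:E.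
Proof.
move=> u0 c0 rc; elim: n => [|n IH].
  rewrite !expr0 !mul1r; apply: le_trans (premeasure_le_diam _ L_diam) _.
  exact: diam_pow_bound.
have cn0 : (0 <= c ^+ n * D)%R by rewrite mulr_ge0// exprn_ge0.
suff H m : (m <= l)%N -> hausdorff_premeasure u (c ^+ n.+1 * D)
    (\bigcup_(j in [set j | (1 <= j <= m)%N]) (S j @` L)) <=
    (\sum_(1 <= j < m.+1) rho j `^ u)%:E * hausdorff_premeasure u (c ^+ n * D) L.
  apply: le_trans (premeasure_le _ _ L_sub) _; apply: le_trans (H l (leqnn l)) _.
  rewrite exprS -mulrA EFinM lee_wpmul2l// lee_fin sumr_ge0// => j _.
  exact: powR_ge0.
elim: m => [|m IHm] ml.
  rewrite big_geq// mul0e (_ : bigcup _ _ = set0); last first.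
    by rewrite -subset0 => x [[|j]].
  have d0 : diam (set0 : set C) <= (c ^+ n.+1 * D)%:E by rewrite diam_set0 leNye.
  by apply: le_trans (premeasure_le_diam u d0) _; rewrite /diam_pow eqxx.
apply: (@le_trans _ _ (hausdorff_premeasure u (c ^+ n.+1 * D)
    ((\bigcup_(j in [set j | (1 <= j <= m)%N]) (S j @` L)) `|` (S m.+1 @` L)))).
  apply: premeasure_le => x [j /= /andP[j1]]; rewrite leq_eqVlt => /predU1P[->|jm] Lx.
    by right.
  by left; exists j => //=; rewrite j1.
apply: le_trans (premeasureU _ _ _ _) _.
rewrite big_nat_recr//= EFinD ge0_muleDl ?lee_fin ?powR_ge0//; last first.
  by rewrite sumr_ge0// => j _; exact: powR_ge0.
apply: leeD; first exact: IHm (ltnW ml).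
have /andP[r0 _] := rho01 (ml : (1 <= m.+1 <= l)%N).
apply: le_trans (premeasure_scale _ _ r0 (S_lip (ml : (1 <= m.+1 <= l)%N)) u0).
apply: premeasure_delta; rewrite exprS -mulrA ler_wpM2r// rc//.
Qed.

Lemma hausdorff_self_similar_le u n : (0 <= u)%R ->
  (\sum_(1 <= j < l.+1) rho j `^ u <= 1)%R ->
  hausdorff_measure u L <= ((\sum_(1 <= j < l.+1) rho j `^ u) ^+ n * D `^ u)%:E.
Proof.
move=> u0; set s := (\sum_(_ <= j < _) _)%R => s1.
have s0 : (0 <= s)%R by apply: sumr_ge0 => j _; exact: powR_ge0.
have [c c01 rc] := ratio_bound rho01; have /andP[c0 _] := c01.
apply: ge_ereal_sup => _ [d d0 <-].
have [m md] := exprn_small D c01 d0.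
have cd : (c ^+ (m + n) * D <= d)%R.
  have /andP[_ c1] := c01.
  by apply: le_trans (ltW md); rewrite ler_wpM2r// ler_wiXn2l ?leq_addr// ?(ltW c1).
apply: le_trans (premeasure_delta _ _ cd) _.
apply: le_trans (premeasure_self_similar (m + n) u0 c0 rc) _.
by rewrite lee_fin ler_wpM2r ?powR_ge0// ler_wiXn2l ?leq_addl.
Qed.

End SelfSimilarMeasure.

(** * Dimension and measure of the arc of a chart *)

Section ChartMeasure.
Variable R : realType.
Local Notation C := (Rcomplex R).
Variables (l : nat) (gam : R -> C) (h : nat -> R -> R) (rho : nat -> R).
Variables (S : nat -> C -> C) (g : C -> R).
Hypothesis ch : self_similar_chart l gam h rho.
Hypothesis gamK : forall t, 0 <= t <= 1 -> g (gam t) = t.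
Hypothesis gam_cont : {within `[0, 1], continuous gam}.
Hypothesis S_gam : forall j t, (1 <= j <= l)%N -> 0 <= t <= 1 ->
  S j (gam t) = gam (h j t).
Hypothesis S_dist : forall j x y, (1 <= j <= l)%N -> `|S j x - S j y| = rho j * `|x - y|.
Hypothesis rho_sum : 1 < \sum_(1 <= j < l.+1) rho j.

Definition chart_arc (a b : R) : set C := [set gam t | t in `[a, b]].

Let I0 : 0 <= (0 : R) <= 1. Proof. by rewrite lexx ler01. Qed.
Let I1 : 0 <= (1 : R) <= 1. Proof. by rewrite lexx ler01. Qed.

(** Covering and order replace continuity of [h j]: a parameter between [h j a] and [h j b] that
    comes from another copy, or from outside [[a, b]], is pinned by order to one of the two ends. *)
Lemma chart_arc_piece j a b : (1 <= j <= l)%N -> 0 <= a -> a <= b -> b <= 1 ->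
  chart_arc (h j a) (h j b) `<=` S j @` chart_arc a b.
Proof.
move=> jl a0 ab b1 x [t /=]; rewrite in_itv/= => /andP[at_ tb] <-.
have a1 : 0 <= a <= 1 by rewrite a0 (le_trans ab).
have b1' : 0 <= b <= 1 by rewrite b1 (le_trans a0).
suff [u /andP[au ub] ->] : exists2 u, a <= u <= b & t = h j u.
  exists (gam u); first by exists u => //=; rewrite in_itv/= au ub.
  by rewrite S_gam// (le_trans a0) ?(le_trans ub).
have t1 : 0 <= t <= 1.
  have /andP[? _] := ch_itv ch jl a1; have /andP[_ ?] := ch_itv ch jl b1'.
  by apply/andP; split; [exact: le_trans at_|exact: le_trans tb _].
have [i [il [u u1 tE]]] := ch_cover ch t1.
have [/andP[i1 il'] /andP[j1 jl']] := (il, jl).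
have [ij|ji|ij] := ltngtP i j.
- exists a; first by rewrite lexx.
  by apply/eqP; rewrite eq_le at_ tE (ch_order ch)// ij.
- exists b; first by rewrite lexx andbT.
  by apply/eqP; rewrite eq_le tb/= tE (ch_order ch)// ji.
rewrite {}ij in tE il.
have [/andP[u0 u1'] /andP[_ a1']] := (u1, a1).
have [ua|au] := ltP u a.
  exists a; first by rewrite lexx.
  by apply/eqP; rewrite eq_le at_ tE (ch_homo ch jl u0 (ltW ua)).
have [bu|ub] := ltP b u.
  exists b; first by rewrite lexx andbT.
  by apply/eqP; rewrite eq_le tb/= tE (ch_homo ch jl _ (ltW bu))// (le_trans a0).
by exists u => //; rewrite au.
Qed.

Lemma chart_arc_split a b c : a <= b -> b <= c ->
  chart_arc a c `<=` chart_arc a b `|` chart_arc b c.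
Proof.
move=> ab bc x [t /=]; rewrite in_itv/= => /andP[at_ tc] <-.
by have [tb|bt] := leP t b; [left|right]; exists t => //=; rewrite in_itv/= ?at_ ?tb// tc ltW.
Qed.

Lemma chart_arc1 a : chart_arc a a = [set gam a].
Proof.
apply/seteqP; split=> [_ [t /= ta <-]|_ ->].
  by move: ta; rewrite in_itv/= -eq_le => /eqP ->.
by exists a => //=; rewrite in_itv/= lexx.
Qed.

Let L := chart_arc 0 1.

Let arc_sub a b : 0 <= a -> b <= 1 -> chart_arc a b `<=` L.
Proof.
move=> a0 b1 x [t /=]; rewrite in_itv/= => /andP[at_ tb] <-.
by exists t => //=; rewrite in_itv/= (le_trans a0) ?(le_trans tb).
Qed.

Let bound : exists2 D : R, 0 <= D & (diam L <= D%:E)%E.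
Proof.
have [D DP] := ch_bound ch; exists D.
  by apply: le_trans (DP 0 0 I0 I0); rewrite subrr normr0.
apply: diam_le_bound => _ _ [t /= + <-] [u /= + <-].
by rewrite !in_itv/= lee_fin => t1 u1; exact: DP.
Qed.

Let L_sub : L `<=` \bigcup_(j in [set j | (1 <= j <= l)%N]) (S j @` L).
Proof.
move=> _ [t /= + <-]; rewrite in_itv/= => /(ch_cover ch)[j [jl [u u1 ->]]].
exists j => //; exists (gam u); last exact: S_gam.
by exists u => //=; rewrite in_itv.
Qed.

Let S_lip j : (1 <= j <= l)%N -> forall x y, `|S j x - S j y| <= rho j * `|x - y|.
Proof. by move=> jl x y; rewrite S_dist. Qed.

Local Open Scope ereal_scope.

Let arc_ne a b : (a <= b)%R -> chart_arc a b !=set0.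
Proof. by move=> ab; exists (gam a); exists a => //=; rewrite in_itv/= lexx. Qed.

(** The diameter scales with exponent 1, and is subadditive because the two parts of an arc share
    the point [gam b]. *)
Lemma chart_bounded_turning : exists2 c : R, (0 <= c)%R &
  forall a b, (0 <= a)%R -> (a <= b)%R -> (b <= 1)%R ->
    diam (chart_arc a b) <= (c * `|gam a - gam b|)%:E.
Proof.
have [D D0 LD] := bound.
have [|||||c c0 cP] := @chart_hoelder _ _ _ _ _ ch 1 D _ D0 (fun a b => diam (chart_arc a b)).
- exact: ler01.
- by move=> a b a0 _ b1; apply: le_trans LD; exact/diam_le/arc_sub.
- by move=> a _; rewrite chart_arc1; apply: diam_le_bound => _ _ -> ->; rewrite subrr normr0.
- move=> a b c a0 ab bc c1; apply: diam_le_bound => x y xA yA.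
  have gb1 : chart_arc a b (gam b) by exists b => //=; rewrite in_itv/= ab lexx.
  have gb2 : chart_arc b c (gam b) by exists b => //=; rewrite in_itv/= bc lexx.
  have tri : `|x - y|%:E <= `|x - gam b|%:E + `|gam b - y|%:E.
    by rewrite -EFinD lee_fin ler_distD.
  have d1 := diam_ge0 (arc_ne ab); have d2 := diam_ge0 (arc_ne bc).
  have [[xl|xr] [yl|yr]] := (chart_arc_split ab bc xA, chart_arc_split ab bc yA).
  + by apply: le_trans (leeDl _ d2); exact: dist_le_diam.
  + by apply: le_trans tri _; apply: leeD; exact: dist_le_diam.
  + rewrite addeC; apply: le_trans tri _; apply: leeD; exact: dist_le_diam.
  + by apply: le_trans (leeDr _ d1); exact: dist_le_diam.
- move=> j a b jl a0 ab b1; have /andP[r0 _] := ch_rho ch jl.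
  rewrite powRr1 ?(ltW r0)//; apply: le_trans (diam_le (chart_arc_piece jl a0 ab b1)) _.
  apply: diam_le_bound => _ _ [x xA <-] [y yA <-].
  by rewrite S_dist// EFinM lee_pmul2l// dist_le_diam.
exists c => // a b a0 ab b1; have := cP a b a0 ab b1.
by rewrite powRr1.
Qed.

(** [chart_hoelder] is used twice: on increments of [phi], for the lower bound of the measure, and
    on the measure of subarcs, whose boundedness comes from covers by copies. *)
Theorem chart_dimension : exists sg : R, [/\ (1 < sg)%R, hausdorff_dim L = sg%:E,
  hausdorff_measure sg L < +oo, 0 < hausdorff_measure sg L &
  exists2 c : R, (0 <= c)%R & forall a b, (0 <= a)%R -> (a <= b)%R -> (b <= 1)%R ->
    hausdorff_measure sg (chart_arc a b) <= (c * `|gam a - gam b| `^ sg)%:E].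
Proof.
have [D D0 LD] := bound; have [sg s1 sgE] := similarity_dim (ch_rho ch) rho_sum.
have s0 : (0 < sg)%R by rewrite (lt_trans _ s1).
have Hfin : hausdorff_measure sg L <= (D `^ sg)%:E.
  have := hausdorff_self_similar_le L_sub (ch_rho ch) S_lip D0 LD 0 (ltW s0).
  by rewrite sgE expr0 mul1r; apply.
have Hup u : (sg < u)%R -> hausdorff_measure u L = 0.
  move=> su; apply/eqP; rewrite eq_le hausdorff_measure_ge0 andbT.
  have u0 : (0 < u)%R by exact: lt_trans su.
  have [c /andP[c0 c1] rc] := ratio_bound (ch_rho ch).
  have us : (0 < u - sg)%R by rewrite subr_gt0.
  pose s := (\sum_(1 <= j < l.+1) rho j `^ u)%R.
  have s_ge0 : (0 <= s)%R by apply: sumr_ge0 => j _; exact: powR_ge0.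
  (* Raising the exponent from [sg] to [u] multiplies each term by at most [c] to the power
     [u - sg], and the terms for [sg] sum to 1. *)
  have s_lt1 : (s < 1)%R.
    apply: (@le_lt_trans _ _ (c `^ (u - sg))%R); last first.
      have -> : (1 = 1 `^ (u - sg) :> R)%R by rewrite powR1.
      by apply: gt0_ltr_powR => //; rewrite nnegrE.
    rewrite -[leRHS]mul1r -sgE mulr_suml /s !big_nat; apply: ler_sum => j jl.
    have /andP[r0 r1] := ch_rho ch jl.
    rewrite -{1}(subrK sg u) addrC powRD; last by rewrite (gt_eqF r0) implybT.
    rewrite ler_wpM2l ?powR_ge0// ge0_ler_powR ?nnegrE ?(ltW us) ?(ltW r0)//.
    exact: rc.
  apply/lee_addgt0Pr => e e0; rewrite add0e.
  have s01 : (0 <= s < 1)%R by rewrite s_ge0.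
  have [n nP] := exprn_small (D `^ u)%R s01 e0.
  apply: le_trans (hausdorff_self_similar_le L_sub (ch_rho ch) S_lip D0 LD n (ltW u0) (ltW s_lt1)) _.
  by rewrite lee_fin ltW.
(* The weights are completed by 1 out of range since [natural_measure] wants all of them
   positive. *)
have [phi [phi0 phi1 phi01 phih]] : exists phi : R -> R, [/\ phi 0 = 0, phi 1 = 1,
    forall t, 0 <= t <= 1 -> 0 <= phi t <= 1 &
    forall j a b, (1 <= j <= l)%N -> 0 <= a <= 1 -> 0 <= b <= 1 ->
    phi (h j a) - phi (h j b) = (if (1 <= j <= l)%N then rho j `^ sg else 1) * (phi a - phi b)]%R.
  apply: (natural_measure ch) => [j|].
    by case: ifPn => // jl; rewrite powR_gt0//; have /andP[] := ch_rho ch jl.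
  by rewrite -sgE !big_nat; apply: eq_bigr => j /= ->.
have [K K0 phiK] : exists2 c : R, (0 <= c)%R & forall a b, (0 <= a)%R -> (a <= b)%R ->
    (b <= 1)%R -> (`|phi a - phi b|)%:E <= (c * `|gam a - gam b| `^ sg)%:E.
  apply: (@chart_hoelder _ _ _ _ _ ch sg 1 (ltW s0) ler01 (fun a b => `|phi a - phi b|%:E)).
  - move=> a b a0 ab b1.
    have /andP[? ?] : (0 <= phi a <= 1)%R by rewrite phi01// a0 (le_trans ab).
    have /andP[? ?] : (0 <= phi b <= 1)%R by rewrite phi01// b1 (le_trans a0).
    by rewrite lee_fin ler_norml; apply/andP; split; lra.
  - by move=> a _; rewrite subrr normr0.
  - by move=> a b c a0 ab bc c1; rewrite -EFinD lee_fin ler_distD.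
  - move=> j a b jl a0 ab b1; rewrite phih ?jl//.
    + by rewrite normrM ger0_norm ?powR_ge0// EFinM.
    + by rewrite a0 (le_trans ab).
    + by rewrite b1 (le_trans a0).
have phiK2 a b : (0 <= a <= 1)%R -> (0 <= b <= 1)%R ->
    (`|phi a - phi b| <= K * `|gam a - gam b| `^ sg)%R.
  move=> /andP[a0 a1] /andP[b0 b1]; rewrite -lee_fin.
  have [ab|/ltW ba] := leP a b; first exact: phiK.
  by rewrite distrC [(`|gam a - gam b|)%R]distrC; exact: phiK.
(* The Hoelder estimate and the continuity of [gam] make [phi] continuous, hence onto. *)
have phi_surj v : (0 <= v <= 1)%R -> exists2 t, (0 <= t <= 1)%R & phi t = v.
  move=> v01.
  have phic : {within `[0%R, 1%R], continuous phi}.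
    apply/subspace_continuousP => t /=; rewrite in_itv/= => t1.
    have /subspace_continuousP /(_ t) := gam_cont.
    rewrite /= in_itv/= => /(_ t1) /cvgrPdist_lt gc.
    apply/cvgrPdist_lt => e e0; have [d d0 dP] := powR_small K0 e0 s0.
    have := gc d d0; rewrite !near_withinE; apply: filterS => w gw w1.
    apply: le_lt_trans (phiK2 t w t1 _) _; first by move: w1; rewrite /= in_itv.
    by apply: dP; rewrite normr_ge0 gw.
  have [|t] := @IVT R phi 0 1 v ler01 phic.
    by rewrite phi0 phi1 min_l ?ler01// max_r ?ler01.
  by rewrite in_itv/= => t1 <-; exists t.
(* Positivity for all exponents up to [sg] also excludes a smaller dimension. *)
have Hlow u : (0 <= u <= sg)%R -> 0 < hausdorff_measure u L.
  move=> u1; apply: (@lt_le_trans _ _ ((2 * K + 1)^-1)%:E).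
    by rewrite lte_fin invr_gt0 ltr_wpDl// mulr_ge0.
  apply: (@le_trans _ _ (hausdorff_premeasure u 1 L)); last first.
    by apply: ereal_sup_ubound; exists 1%R => //=; exact: ltr01.
  apply: (@mass_distribution _ L (phi \o g) K sg u K0 u1).
    move=> v /phi_surj[t t1 <-]; exists (gam t); last by rewrite /= gamK.
    by exists t => //=; rewrite in_itv.
  move=> _ _ [t /= + <-] [w /= + <-]; rewrite !in_itv/= => t1 w1.
  by rewrite !gamK//; exact: phiK2.
exists sg; split => //.
- apply/eqP; rewrite eq_le; apply/andP; split.
    apply/lee_addgt0Pr => e e0; apply: ereal_inf_lbound; exists (sg + e)%R => //.
    by split; [rewrite addr_ge0// ltW|apply: Hup; rewrite ltrDl].
  apply: le_ereal_inf_tmp => _ [u [u0 Hu] <-]; rewrite lee_fin leNgt; apply/negP => us.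
  by have := Hlow u; rewrite Hu ltxx u0 ltW// => /(_ isT).
- by apply: le_lt_trans Hfin _; rewrite ltry.
- by apply: Hlow; rewrite lexx ltW.
apply: (@chart_hoelder _ _ _ _ _ ch sg (D `^ sg) (ltW s0) (powR_ge0 _ _)
  (fun a b => hausdorff_measure sg (chart_arc a b))).
- move=> a b a0 _ b1; apply: le_trans Hfin; exact/hausdorff_measure_le/arc_sub.
- by move=> a _; rewrite chart_arc1 hausdorff_measure1.
- move=> a b c a0 ab bc c1; apply: le_trans (hausdorff_measureU _ _ _).
  exact/hausdorff_measure_le/chart_arc_split.
- move=> j a b jl a0 ab b1; have /andP[r0 _] := ch_rho ch jl.
  apply: le_trans (hausdorff_measure_scale _ r0 (S_lip jl) (ltW s0)).
  exact/hausdorff_measure_le/chart_arc_piece.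
Qed.

End ChartMeasure.

(** * Plane geometry of basic figures *)

Section Cones.
Variable R : realType.
Local Notation C := (Rcomplex R).
Implicit Types (P A Q D V X Y E F : C).

(** The determinant, positive when [Y] is counterclockwise from [X]. If [0 < cross A P], then
    [0 <= cross A V] and [0 <= cross V P] describe the closed sector from [A] counterclockwise to
    [P]. *)
Definition cross X Y : R :=
  complex.Re X * complex.Im Y - complex.Im X * complex.Re Y.

Lemma crossDl X Y V : cross (X + Y) V = cross X V + cross Y V.
Proof. by rewrite /cross !ReImE; ring. Qed.
Lemma crossDr X Y V : cross V (X + Y) = cross V X + cross V Y.
Proof. by rewrite /cross !ReImE; ring. Qed.
Lemma crossZl k X V : cross (k *: X) V = k * cross X V.
Proof. by rewrite /cross !ReImE; ring. Qed.
Lemma crossZr k X V : cross V (k *: X) = k * cross V X.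
Proof. by rewrite /cross !ReImE; ring. Qed.
Lemma crossxx X : cross X X = 0.
Proof. by rewrite /cross; ring. Qed.
Definition crossE := (crossDl, crossDr, crossZl, crossZr, crossxx).

Lemma cross_le X Y : `|cross X Y| <= 2 * (`|X| * `|Y|).
Proof.
apply: le_trans (ler_normB _ _) _; rewrite !normrM mulrDl !mul1r.
by apply: lerD; apply: ler_pM => //; rewrite ?Re_le_norm ?Im_le_norm.
Qed.

Lemma cross_decomp A P V : cross A P != 0 ->
  V = (cross A V / cross A P) *: P + (cross V P / cross A P) *: A.
Proof.
by move=> AP; apply: RcomplexE; rewrite !ReImE /cross in AP *; field.
Qed.

Lemma small_eps (x1 y1 x2 y2 : R) : 0 < x1 -> 0 < x2 ->
  exists2 e, 0 < e & 0 < x1 + e * y1 /\ 0 < x2 + e * y2.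
Proof.
move=> x10 x20; have a1 := normr_ge0 y1; have a2 := normr_ge0 y2.
pose e := Num.min (x1 / (`|y1| + 1)) (x2 / (`|y2| + 1)).
have e0 : 0 < e by rewrite lt_min !divr_gt0// ltr_wpDl.
have H x y : 0 < x -> e <= x / (`|y| + 1) -> 0 < x + e * y.
  move=> x0; have y1' : 0 < `|y| + 1 by rewrite ltr_wpDl.
  rewrite ler_pdivlMr// => h.
  have : - (e * y) <= e * `|y|.
    by rewrite -mulrN ler_wpM2l ?(ltW e0)// -normrN ler_norm.
  lra.
by exists e => //; split; apply: H => //; rewrite /e ge_min lexx ?orbT.
Qed.

(* Two closed convex sectors whose interiors are disjoint can only meet along
   their sides; a common side is either excluded by assumption or forces the
   interiors to overlap. *)
Lemma sectors_meet0 P A Q D V : 0 < cross A P -> 0 < cross Q D ->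
  (forall W, 0 < cross A W -> 0 < cross W P -> 0 < cross W D -> 0 < cross Q W -> False) ->
  (forall k, 0 < k -> A != k *: D) -> (forall k, 0 < k -> P != k *: Q) ->
  0 <= cross A V -> 0 <= cross V P -> 0 <= cross V D -> 0 <= cross Q V -> V = 0.
Proof.
move=> AP QD dis AD PQ; rewrite !le_eqVlt.
have AP0 : cross A P != 0 by rewrite gt_eqF.
have QD0 : cross Q D != 0 by rewrite gt_eqF.
have dec1 := cross_decomp V AP0; have dec2 := cross_decomp V QD0.
have [//|V0] := eqVneq V 0.
case/predU1P=> [AV|AV]; case/predU1P=> [VP|VP].
- by move: dec1; rewrite -AV -VP !mul0r !scale0r addr0.
- rewrite -AV mul0r scale0r add0r in dec1.
  have b0 : 0 < cross V P / cross A P by rewrite divr_gt0.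
  set b := _ / _ in dec1 b0.
  case/predU1P=> [VD|VD]; case/predU1P=> [QV|QV].
  + by move: dec2; rewrite -QV -VD !mul0r !scale0r addr0.
  (* [V] is along both [A] and [D], which [AD] excludes. *)
  + rewrite -VD mul0r scale0r addr0 in dec2.
    have d0 : 0 < cross Q V / cross Q D by rewrite divr_gt0.
    have := AD (b^-1 * (cross Q V / cross Q D)); rewrite mulr_gt0 ?invr_gt0// => /(_ isT).
    have VA : b^-1 *: V = A by rewrite dec1 scalerA mulVf ?scale1r// gt_eqF.
    by rewrite -scalerA -dec2 VA eqxx.
  (* [V] is along both [A] and [Q]. Both sectors open counterclockwise from this ray, so tilting it
     slightly towards [P] enters both interiors. *)
  + rewrite -QV mul0r scale0r add0r in dec2.
    have c0 : 0 < cross V D / cross Q D by rewrite divr_gt0.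
    have QA : cross Q A = 0.
      apply: (mulfI (lt0r_neq0 b0)); rewrite mulr0 -crossZr -dec1; exact: esym.
    have PAQ : 0 < cross Q P.
      by rewrite -(pmulr_rgt0 _ c0) -crossZl -dec2 dec1 crossZl mulr_gt0.
    have DA : 0 < cross A D.
      by rewrite -(pmulr_rgt0 _ b0) -crossZl -dec1 dec2 crossZl mulr_gt0.
    have [e e0 [e1 _]] := small_eps (cross P D) 0 DA DA.
    by case: (dis (A + e *: P)); rewrite !crossE ?QA ?add0r ?mulr0 ?addr0 ?mulr_gt0.
  + have [e e0 [e1 e2]] := small_eps (cross P D) (cross Q P) VD QV.
    case: (dis (V + e *: P)); rewrite !crossE ?mulr0 ?addr0 -?AV ?add0r ?mulr_gt0//.
- rewrite -VP mul0r scale0r addr0 in dec1.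
  have a0 : 0 < cross A V / cross A P by rewrite divr_gt0.
  set a := _ / _ in dec1 a0.
  case/predU1P=> [VD|VD]; case/predU1P=> [QV|QV].
  + by move: dec2; rewrite -QV -VD !mul0r !scale0r addr0.
  + rewrite -VD mul0r scale0r addr0 in dec2.
    have d0 : 0 < cross Q V / cross Q D by rewrite divr_gt0.
    have PD : cross P D = 0.
      apply: (mulfI (lt0r_neq0 a0)); rewrite mulr0 -crossZl -dec1; exact: esym.
    have QP : 0 < cross Q P.
      by rewrite -(pmulr_rgt0 _ a0) -crossZr -dec1 dec2 crossZr mulr_gt0.
    have DA : 0 < cross A D.
      by rewrite -(pmulr_rgt0 _ d0) -crossZr -dec2 dec1 crossZr mulr_gt0.
    have [e e0 [e1 _]] := small_eps (cross Q A) 0 QP QP.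
    by case: (dis (P + e *: A)); rewrite !crossE ?PD ?add0r ?mulr0 ?addr0 ?mulr_gt0.
  + rewrite -QV mul0r scale0r add0r in dec2.
    have c0 : 0 < cross V D / cross Q D by rewrite divr_gt0.
    have := PQ (a^-1 * (cross V D / cross Q D)); rewrite mulr_gt0 ?invr_gt0// => /(_ isT).
    have VP' : a^-1 *: V = P by rewrite dec1 scalerA mulVf ?scale1r// gt_eqF.
    by rewrite -scalerA -dec2 VP' eqxx.
  + have [e e0 [e1 e2]] := small_eps (cross A D) (cross Q A) VD QV.
    case: (dis (V + e *: A)); rewrite !crossE ?mulr0 ?addr0 -?VP ?add0r ?mulr_gt0//.
- move=> VD QV.
  (* [V] is interior to the first sector and stays there after a small push along [Q + D], which
     brings it inside the second. *)
  have [e e0 [e1 e2]] := small_eps (cross A (Q + D)) (cross (Q + D) P) AV VP.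
  have VD' : 0 <= cross V D by case/predU1P: VD => [<-|/ltW].
  have QV' : 0 <= cross Q V by case/predU1P: QV => [<-|/ltW].
  case: (dis (V + e *: (Q + D))); rewrite ?[cross A (_ + _)]crossDr ?[cross (_ + _) P]crossDl ?crossZr ?crossZl//.
    by rewrite !crossE addr0 ltr_wpDl// mulr_gt0.
  by rewrite !crossE add0r ltr_wpDl// mulr_gt0.
Qed.

(** The larger defect of the two inequalities is continuous and positive on the segment from [X] to
    [Y], hence bounded below; being Lipschitz, it bounds the distance to the sector from below.
    Dividing by [a + b] carries this over to the whole cone. *)
Lemma sector_gap X Y E F :
  (forall t, 0 <= t <= 1 -> let x := (1 - t) *: X + t *: Y in
     0 <= cross x E -> 0 <= cross F x -> False) ->
  exists2 kap : R, 0 < kap & forall a b y, 0 <= a -> 0 <= b ->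
    0 <= cross y E -> 0 <= cross F y -> kap * (a + b) <= `|a *: X + b *: Y - y|.
Proof.
move=> H; pose m (t : R) := Num.max (- cross ((1 - t) *: X + t *: Y) E)
  (- cross F ((1 - t) *: X + t *: Y)).
have mc : continuous m.
  have aff (u v : R) : continuous (fun t : R => - ((1 - t) * u + t * v)).
    move=> t; apply: cvgN; apply: cvgD; apply: cvgM; do ?exact: cvg_cst; do ?exact: cvg_id.
    by apply: cvgB; [exact: cvg_cst|exact: cvg_id].
  have mE : m = (fun t => - ((1 - t) * cross X E + t * cross Y E)) \max
                (fun t => - ((1 - t) * cross F X + t * cross F Y)).
    by apply/funext => t; rewrite /m !crossE.
  by move=> t; rewrite mE; apply: continuous_max; exact: aff.
have [t0 t01 t0P] := EVT_min (ler01 : 0 <= 1 :> R) (continuous_subspaceT mc).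
have m0 : 0 < m t0.
  rewrite in_itv/= in t01; rewrite /m lt_max !oppr_gt0 -[_ || _]negbK negb_or -!leNgt.
  by apply/negP => /andP[h1 h2]; exact: (H t0 t01 h1 h2).
pose K := 2 * (`|E| + `|F| + 1).
have K0 : 0 < K by rewrite mulr_gt0// ltr_wpDl// addr_ge0.
have key t y : 0 <= t <= 1 -> 0 <= cross y E -> 0 <= cross F y ->
    m t0 <= K * `|(1 - t) *: X + t *: Y - y|.
  move=> t1 yE Fy; set x := _ *: X + _.
  have := t0P t; rewrite in_itv/= => /(_ t1) mt; apply: le_trans mt _.
  have xy0 := normr_ge0 (x - y).
  rewrite /m ge_max -/x; apply/andP; split.
    apply: (@le_trans _ _ `|cross (x - y) E|).
      apply: le_trans (_ : - cross (x - y) E <= _); last by rewrite -normrN ler_norm.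
      by rewrite -[- y]scaleN1r !crossE; lra.
    apply: le_trans (cross_le _ _) _; rewrite /K.
    have := normr_ge0 E; have := normr_ge0 F; nra.
  apply: (@le_trans _ _ `|cross F (x - y)|).
    apply: le_trans (_ : - cross F (x - y) <= _); last by rewrite -normrN ler_norm.
    by rewrite -[- y]scaleN1r !crossE; lra.
  apply: le_trans (cross_le _ _) _; rewrite /K.
  have := normr_ge0 E; have := normr_ge0 F; nra.
exists (m t0 / K); first exact: divr_gt0.
move=> a b y a0 b0 yE Fy.
have [ab0|abN] := eqVneq (a + b) 0; first by rewrite ab0 mulr0.
have ab : 0 < a + b by rewrite lt_def abN addr_ge0.
have t1 : 0 <= b / (a + b) <= 1.
  by rewrite divr_ge0 ?addr_ge0//= ler_pdivrMr// mul1r lerDr.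
have := key (b / (a + b)) ((a + b)^-1 *: y) t1.
rewrite !crossE !mulr_ge0 ?invr_ge0 ?(ltW ab)// => /(_ isT isT).
rewrite (_ : _ - _ = (a + b)^-1 *: (a *: X + b *: Y - y)); last first.
  by apply: RcomplexE; rewrite !ReImE; field.
rewrite normrZ ger0_norm ?invr_ge0 ?(ltW ab)// => h.
rewrite mulrAC ler_pdivrMr// -ler_pdivlMr//.
by apply: le_trans h _; rewrite mulrCA mulrC [X in X / _]mulrC.
Qed.

End Cones.

(** * Triangles and affine maps *)

Section Triangle.
Variable R : realType.
Local Notation C := (Rcomplex R).

Lemma triangle_convex (a b c x y w : C) (u v t : R) :
  triangle a b c x -> triangle a b c y -> triangle a b c w ->
  0 <= u -> 0 <= v -> 0 <= t -> u + v + t = 1 ->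
  triangle a b c (u *: x + v *: y + t *: w).
Proof.
move=> [x1 [x2 [x3 [? ? ? sx ->]]]] [y1 [y2 [y3 [? ? ? sy ->]]]].
move=> [w1 [w2 [w3 [? ? ? sw ->]]]] u0 v0 t0 s.
exists (u * x1 + v * y1 + t * w1), (u * x2 + v * y2 + t * w2), (u * x3 + v * y3 + t * w3).
split; rewrite ?addr_ge0 ?mulr_ge0//.
  have -> : u * x1 + v * y1 + t * w1 + (u * x2 + v * y2 + t * w2) + (u * x3 + v * y3 + t * w3) =
    u * (x1 + x2 + x3) + v * (y1 + y2 + y3) + t * (w1 + w2 + w3) by ring.
  by rewrite sx sy sw !mulr1.
by apply: RcomplexE; rewrite !ReImE; ring.
Qed.

Lemma triangle_segment (a b c x : C) : plane_segment a b x -> triangle a b c x.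
Proof.
move=> [t /=]; rewrite in_itv/= => /andP[t0 t1] <-; exists (1 - t), t, 0.
by rewrite subr_ge0 t0 t1 scale0r !addr0 subrK.
Qed.

Lemma triangle_vertices (a b c : C) :
  [/\ triangle a b c a, triangle a b c b & triangle a b c c].
Proof.
split; [exists 1, 0, 0|exists 0, 1, 0|exists 0, 0, 1];
  by rewrite ?ler01 ?lexx !scale0r !scale1r ?addr0 ?add0r.
Qed.

Lemma affine_triangle (a b c al be : C) (u v w : R) : u + v + w = 1 ->
  al * (u *: a + v *: b + w *: c) + be =
  u *: (al * a + be) + v *: (al * b + be) + w *: (al * c + be) :> C.
Proof.
move=> s; apply: RcomplexE; rewrite !ReImE.
  rewrite -[X in _ + X = _](mul1r (complex.Re be)) -s; ring.
rewrite -[X in _ + X = _](mul1r (complex.Im be)) -s; ring.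
Qed.

Lemma nbhs_distP (x : C) (A : set C) :
  nbhs x A <-> exists2 d : R, 0 < d & forall y, `|y - x| < d -> A y.
Proof.
split=> [/nbhs_normP[d /= d0 dA]|[d d0 dA]].
  by exists d => // y yx; apply: dA; rewrite /ball_/= distrC.
by apply/nbhs_normP; exists d => //= y; rewrite /ball_/= distrC => /dA.
Qed.

Lemma interior_affine (A B : set C) (al be x : C) : al != 0 ->
  (forall u, A u -> B (al * u + be)) -> interior A x -> interior B (al * x + be : C).
Proof.
move=> al0 AB /nbhs_distP[d d0 dA]; apply/nbhs_distP.
have nal : 0 < `|al : C| by rewrite normr_gt0.
exists (d * `|al : C|); first by rewrite mulr_gt0.
move=> y yx; have -> : y = al * (al^-1 * (y - be)) + be :> C.
  by rewrite mulrA divff// mul1r subrK.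
apply: AB; apply: dA.
have -> : al^-1 * (y - be) - x = al^-1 * (y - (al * x + be)) :> C.
  by field.
rewrite Rcomplex_normM Rcomplex_normV mulrC ltr_pdivrMr//.
Qed.

Variables z0 z1 z2 : C.
Hypothesis orient : 0 < cross (z1 - z0) (z2 - z0).
Let w1 := z1 - z0.
Let w2 := z2 - z0.
Let cw0 : cross w1 w2 != 0. Proof. by rewrite gt_eqF. Qed.

(** Barycentric coordinates along [z1] and [z2], by Cramer's rule. *)
Let cv (x : C) := cross (x - z0) w2 / cross w1 w2.
Let cw (x : C) := cross w1 (x - z0) / cross w1 w2.

Let bary x : x = (1 - cv x - cw x) *: z0 + cv x *: z1 + cw x *: z2.
Proof.
have := @cross_decomp R w2 w1 (x - z0).
have e : cross w2 w1 = - cross w1 w2 by rewrite /cross; ring.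
rewrite e oppr_eq0 => /(_ cw0) E.
rewrite -[LHS](subrK z0) E /cv /cw.
have e2 : cross w2 (x - z0) = - cross (x - z0) w2 by rewrite /cross; ring.
have e3 : cross (x - z0) w1 = - cross w1 (x - z0) by rewrite /cross; ring.
rewrite e2 e3 !invrN !mulrNN.
by apply: RcomplexE; rewrite !ReImE; ring.
Qed.

Let barE u v w : u + v + w = 1 ->
  cv (u *: z0 + v *: z1 + w *: z2) = v /\ cw (u *: z0 + v *: z1 + w *: z2) = w.
Proof.
move=> s; have -> : u *: z0 + v *: z1 + w *: z2 = z0 + (v *: w1 + w *: w2).
  have -> : u = 1 - v - w by rewrite -s; ring.
  by apply: RcomplexE; rewrite !ReImE; ring.
rewrite /cv /cw [z0 + _]addrC addrK [cross (v *: _ + _) w2]crossDl [cross w1 (v *: _ + _)]crossDr.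
rewrite !crossZl !crossZr !crossxx !mulr0 addr0 add0r.
by rewrite !(mulfK cw0).
Qed.

Let triP x : triangle z0 z1 z2 x <-> [/\ 0 <= cv x, 0 <= cw x & cv x + cw x <= 1].
Proof.
split=> [[u [v [w [u0 v0 w0 s ->]]]]|[v0 w0 vw]].
  by have [-> ->] := barE s; split => //; rewrite -s; lra.
exists (1 - cv x - cw x), (cv x), (cw x); split => //; [lra|ring].
Qed.

Let lip : exists2 K : R, 0 <= K & forall x y,
  `|cv x - cv y| <= K * `|x - y| /\ `|cw x - cw y| <= K * `|x - y|.
Proof.
have c0 : 0 < cross w1 w2 by [].
exists (2 * (`|w1| + `|w2|) / cross w1 w2).
  by rewrite divr_ge0 ?(ltW c0)// mulr_ge0// addr_ge0.
move=> x y; rewrite /cv /cw -!mulrBl !normrM [`|(cross w1 w2)^-1|]ger0_norm ?invr_ge0 ?(ltW c0)//.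
have -> : cross (x - z0) w2 - cross (y - z0) w2 = cross (x - y) w2.
  by rewrite /cross !ReImE; ring.
have -> : cross w1 (x - z0) - cross w1 (y - z0) = cross w1 (x - y).
  by rewrite /cross !ReImE; ring.
rewrite ![_ / cross w1 w2 * _]mulrAC !ler_pM2r ?invr_gt0//.
have := cross_le (x - y) w2; have := cross_le w1 (x - y).
have := mulr_ge0 (normr_ge0 w1) (normr_ge0 (x - y)).
have := mulr_ge0 (normr_ge0 w2) (normr_ge0 (x - y)).
split; nra.
Qed.

Lemma triangle_interior u v w : 0 < u -> 0 < v -> 0 < w -> u + v + w = 1 ->
  interior (triangle z0 z1 z2) (u *: z0 + v *: z1 + w *: z2).
Proof.
move=> u0 v0 w0 s; have [K K0 KP] := lip; have [cvE cwE] := barE s.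
set x := _ + _ in cvE cwE *.
(* Moving each coordinate by less than half of [u] keeps their sum below 1. *)
apply/nbhs_distP; exists (Num.min (Num.min v w) (u / 2) / (K + 1)).
  by rewrite divr_gt0 ?ltr_wpDl// !lt_min v0 w0/= divr_gt0.
move=> y; rewrite ltr_pdivlMr ?ltr_wpDl// !lt_min => /andP[/andP[yv yw] yu].
have [h1 h2] := KP y x; have n0 := normr_ge0 (y - x).
rewrite cvE ler_norml in h1; rewrite cwE ler_norml in h2.
by apply/triP; split; lra.
Qed.

Lemma triangle_approx x : (forall e, 0 < e -> exists2 y, triangle z0 z1 z2 y & `|x - y| < e) ->
  triangle z0 z1 z2 x.
Proof.
move=> H; have [K K0 KP] := lip; apply/triP.
have appr e : 0 < e -> exists y, [/\ triangle z0 z1 z2 y, `|cv x - cv y| <= e & `|cw x - cw y| <= e].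
  move=> e0; have [|y Ty xy] := H (e / (K + 1)); first by rewrite divr_gt0// ltr_wpDl.
  exists y; split => //; have [h1 h2] := KP x y; [move: h1|move: h2] => /le_trans; apply;
  by move: xy; rewrite ltr_pdivlMr ?ltr_wpDl//; have := normr_ge0 (x - y); nra.
split; rewrite leNgt; apply/negP => h.
- have [|y [/triP[? ? ?] + _]] := appr (- cv x / 2); first lra.
  by rewrite ler_norml => /andP[? ?]; lra.
- have [|y [/triP[? ? ?] _]] := appr (- cw x / 2); first lra.
  by rewrite ler_norml => /andP[? ?]; lra.
- have [|y [/triP[? ? ?]]] := appr ((cv x + cw x - 1) / 3); first lra.
  by rewrite !ler_norml => /andP[? ?] /andP[? ?]; lra.
Qed.

End Triangle.

Section BasicFigureFacts.
Variable R : realType.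
Local Notation C := (Rcomplex R).
Variables (l q : nat) (z : nat -> C) (S : nat -> C -> C) (L : set C).
Hypothesis bf : basic_figure l q z S.
Hypothesis pos : positively_oriented l q z.
Hypothesis att : attractor l S L.

Let T := triangle (z 0) (z l) (z q).

Lemma base_neq : z l - z 0 != 0.
Proof.
by apply/eqP => e; move: pos; rewrite /positively_oriented e invr0 mulr0 ltxx.
Qed.

Lemma base_norm_gt0 : 0 < `|z l - z 0|.
Proof. by rewrite normr_gt0 base_neq. Qed.

Lemma cross_base_gt0 : 0 < cross (z l - z 0) (z q - z 0).
Proof.
have a0 := base_neq; set a := z l - z 0 in a0 *; set b := z q - z 0.
have bE : b = (b / a) * a :> C by rewrite divfK.
rewrite bE; set t : C := b / a.
have -> : cross a (t * a) = complex.Im t * `|a| ^+ 2.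
  rewrite Rcomplex_normE sqr_sqrtr ?addr_ge0 ?sqr_ge0// /cross !ReImE; ring.
by rewrite mulr_gt0 ?exprn_gt0 ?normr_gt0//; exact: pos.
Qed.

Definition side_ratio (j : nat) : R := `|z j - z j.-1| / `|z l - z 0|.

Lemma similitude_form j : (1 <= j <= l)%N -> exists al be : C,
  [/\ al != 0, forall x, S j x = al * x + be & `|al| = side_ratio j].
Proof.
move=> jl; have [al [be [al0 SE]]] := bf_similitude bf jl.
exists al, be; split => //.
rewrite /side_ratio -(bf_start bf jl) -(bf_end bf jl) !SE.
have -> : al * z l + be - (al * z 0 + be) = al * (z l - z 0) :> C by ring.
by rewrite Rcomplex_normM mulfK// gt_eqF// base_norm_gt0.
Qed.

Lemma similitude_dist j x y : (1 <= j <= l)%N -> `|S j x - S j y| = side_ratio j * `|x - y|.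
Proof.
move=> jl; have [al [be [_ SE <-]]] := similitude_form jl.
rewrite !SE -Rcomplex_normM; congr (`|_|); ring.
Qed.

Lemma ratio01 j : (1 <= j <= l)%N -> 0 < side_ratio j < 1.
Proof.
move=> jl; have [al [be [al0 _ alE]]] := similitude_form jl.
rewrite -{1}alE normr_gt0 al0/=; have [c c1 cP] := bf_contractive bf jl.
apply: le_lt_trans c1; have := cP (z l) (z 0).
by rewrite similitude_dist// ler_pM2r ?base_norm_gt0.
Qed.

Lemma len_gt0 : (0 < l)%N.
Proof. by rewrite lt0n; apply: contra base_neq => /eqP ->; rewrite subrr. Qed.

Let L1 : (1 <= 1 <= l)%N. Proof. exact: len_gt0. Qed.
Let Ll : (1 <= l <= l)%N. Proof. by rewrite len_gt0 leqnn. Qed.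

Lemma vertex_triangle j : (j <= l)%N -> T (z j).
Proof.
have [T0 Tl Tq] := triangle_vertices (z 0) (z l) (z q).
move=> /(bf_vertices bf)[[->//|/triangle_segment H]|/interior_subset//].
exact: H.
Qed.

Lemma closed_triangle_sub x : closed_triangle l q z x -> T x.
Proof.
move=> Tx; apply: (triangle_approx cross_base_gt0) => e e0.
have [|y [/interior_subset Ty yx]] := Tx [set y | `|y - x| < e].

  by apply/nbhs_distP; exists e.
by exists y => //; rewrite distrC.
Qed.

Lemma similitude_triangle j x : (1 <= j <= l)%N -> T x -> T (S j x).
Proof.
move=> jl [u [v [w [u0 v0 w0 s ->]]]]; have /andP[j1 jl'] := jl.
have [al [be [_ SE _]]] := similitude_form jl.
rewrite SE affine_triangle// -!SE (bf_start bf jl) (bf_end bf jl).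
apply: triangle_convex => //.
- by apply: vertex_triangle; rewrite (leq_trans _ jl')// leq_pred.
- exact: vertex_triangle.
- exact/closed_triangle_sub/(bf_apex_image bf).
Qed.

(* Each point of the attractor lies in arbitrarily small copies of it. *)
Lemma attractor_cylinder c n x : 0 <= c ->
  (forall j, (1 <= j <= l)%N -> side_ratio j <= c) -> L x ->
  exists al be y : C, [/\ al != 0, `|al| <= c ^+ n, L y & x = al * y + be] /\
    ((forall u : C, L u -> L (al * u + be)) /\ (forall u : C, T u -> T (al * u + be))).
Proof.
move=> c0 rc; have [_ _ LE] := att.
elim: n x => [|n IH] x Lx.
  exists 1, 0, x; split; last by split=> u; rewrite mul1r addr0.
  by split; rewrite ?oner_neq0 ?mul1r ?addr0// expr0 Rcomplex_normE/= expr1n expr0n addr0 sqrtr1.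
move: (Lx); rewrite {1}LE => -[j /= jl [x' Lx' <-]].
have [al [be [y [[al0 alc Ly xE] [Lal Tal]]]]] := IH x' Lx'.
have [al' [be' [al'0 SE alE]]] := similitude_form jl.
have E u : S j (al * u + be) = (al' * al) * u + (al' * be + be') :> C by rewrite SE; ring.
exists (al' * al), (al' * be + be'), y; split; last first.
  split=> u hu; rewrite -E; last exact/similitude_triangle/Tal.
  by rewrite LE; exists j => //; exists (al * u + be) => //; exact: Lal.
split; [by rewrite mulf_neq0| |by []|by rewrite -E -xE].
by rewrite Rcomplex_normM exprS ler_pM// alE rc.
Qed.

Let c_ex : exists2 c : R, 0 <= c < 1 & forall j, (1 <= j <= l)%N -> side_ratio j <= c.
Proof. by apply: ratio_bound => j; exact: ratio01. Qed.

Lemma attractor_bounded : exists2 D : R, 0 <= D & forall x y, L x -> L y -> `|x - y| <= D.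
Proof.
have [cL [x0 Lx0] _] := att; have [r [_ rL]] := compact_bounded cL.
have rP x : L x -> `|x| <= `|r| + 1.
  by move=> Lx; apply: rL => //; rewrite (le_lt_trans (ler_norm _))// ltrDl.
exists (`|r| + 1 + (`|r| + 1)); first by rewrite !addr_ge0.
by move=> x y Lx Ly; apply: le_trans (ler_normB _ _) _; apply: lerD; exact: rP.
Qed.

Lemma attractor_closed x : (forall e, 0 < e -> exists2 y, L y & `|y - x| < e) -> L x.
Proof.
have [cL _ _] := att; have := compact_closed (@norm_hausdorff R C) cL.
move=> clL H; apply: clL => B /nbhs_distP[d /H[y Ly yx] dB].
by exists y; split => //; exact: dB.
Qed.

(** Points of [L] are limits of images of [z 0] under long compositions of the maps, which preserve
    the closed set [T]. *)
Lemma attractor_triangle : L `<=` T.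
Proof.
move=> x Lx; have [c c01 rc] := c_ex; have [D D0 DP] := attractor_bounded.
apply: (triangle_approx cross_base_gt0) => e e0; have /andP[c0 _] := c01.
have [n nP] := exprn_small (`|x| + D + `|z 0|) c01 e0.
have [al [be [y [[al0 alc Ly xE] [_ Tal]]]]] := attractor_cylinder n c0 rc Lx.
exists (al * z 0 + be); first exact/Tal/vertex_triangle.
rewrite {1}xE; apply: le_lt_trans nP.
have -> : al * y + be - (al * z 0 + be) = al * (y - z 0) :> C by ring.
rewrite Rcomplex_normM ler_pM// (le_trans (ler_normB _ _))// lerD2r.
by rewrite -[y](subrK x) addrC (le_trans (ler_normD _ _))// lerD2l DP.
Qed.

(** Iterating [S j] from any point of [L] stays in [L] and converges to the fixed point. *)
Lemma fixed_attractor j x : (1 <= j <= l)%N -> S j x = x -> L x.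
Proof.
move=> jl Sx; have [_ [y0 Ly0] LE] := att; apply: attractor_closed => e e0.
have /andP[r0 r1] := ratio01 jl.
have r01 : 0 <= side_ratio j < 1 by rewrite r1 ltW.
have [n nP] := exprn_small (`|y0 - x|) r01 e0.
suff H m : exists2 y, L y & `|y - x| <= side_ratio j ^+ m * `|y0 - x|.
  by have [y Ly yx] := H n; exists y => //; exact: le_lt_trans nP.
elim: m => [|m [y Ly yx]]; first by exists y0; rewrite ?expr0 ?mul1r.
exists (S j y); first by rewrite LE; exists j => //; exists y.
by rewrite -{1}Sx similitude_dist// exprS -mulrA ler_pM2l.
Qed.

Lemma vertex_attractor j : (j <= l)%N -> L (z j).
Proof.
have [_ _ LE] := att.
have Lzl : L (z l) by apply: (fixed_attractor Ll); exact: (bf_end bf).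
case: j => [_|j jl]; first by apply: (fixed_attractor L1); rewrite (bf_start bf).
by rewrite LE; exists j.+1 => //; exists (z l) => //; exact: (bf_end bf).
Qed.

(* The copy [S i @` L] contains small copies of the whole triangle, up to
   convexity; so if it had an open part in common with [S j @` L], then the
   open triangles would overlap. *)
Lemma copies_no_common_part i j x e : (1 <= i <= l)%N -> (1 <= j <= l)%N -> i != j ->
  (S i @` L) x -> 0 < e -> (forall y, L y -> `|y - x| < e -> (S j @` L) y) -> False.
Proof.
move=> il jl ij [x' Lx' <-] e0 H.
have [c c01 rc] := c_ex; have [D D0 DP] := attractor_bounded; have /andP[c0 _] := c01.
have [n nP] := exprn_small D c01 e0.
have [al [be [y [[al0 alc Ly xE] [Lal Tal]]]]] := attractor_cylinder n c0 rc Lx'.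
have [ai [bi [ai0 SiE aiE]]] := similitude_form il.
have [aj [bj [aj0 SjE ajE]]] := similitude_form jl.
have [_ _ LE] := att.
pose f u : C := ai * (al * u + be) + bi.
have fS u : f u = S i (al * u + be) by rewrite SiE.
have fL u : L u -> (S j @` L) (f u).
  move=> Lu; apply: H; first by rewrite fS LE; exists i => //; exists (al * u + be) => //; exact: Lal.
  rewrite fS xE similitude_dist//; apply: le_lt_trans nP.
  have -> : al * u + be - (al * y + be) = al * (u - y) :> C by ring.
  rewrite Rcomplex_normM; apply: (@le_trans _ _ (1 * (c ^+ n * D))); last by rewrite mul1r.
  have /andP[ri0 ri1] := ratio01 il.
  by rewrite ler_pM ?(ltW ri0) ?(ltW ri1) ?mulr_ge0// ler_pM// DP.
(* The similitude [u -> a' * u + b'] is [f] followed by the inverse of [S j]. *)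
pose a' : C := ai * al / aj; pose b' : C := (ai * be + bi - bj) / aj.
have fE u : f u = S j (a' * u + b') by rewrite SjE /f /a' /b'; field.
have Sj_inj u v : S j u = S j v -> u = v.
  by rewrite !SjE => /addIr /(mulfI aj0).
(* The image of a vertex lies in [L], hence in [T]; convexity then handles the whole triangle. *)
have Tv k : (k <= l)%N -> T (a' * z k + b').
  move=> kl; have [w Lw] := fL _ (vertex_attractor kl).
  by rewrite fE => /Sj_inj <-; exact: attractor_triangle.
have Ta u : T u -> T (a' * u + b').
  move=> [t1 [t2 [t3 [? ? ? s ->]]]]; rewrite affine_triangle//.
  by apply: triangle_convex => //; apply: Tv => //; exact: bf_apex bf.
have [c1 Tc] : exists x, interior T x.
  exists (3^-1 *: z 0 + 3^-1 *: z l + 3^-1 *: z q).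
  by apply: (triangle_interior cross_base_gt0); rewrite ?invr_gt0//; field.
have a'0 : a' != 0 by rewrite /a' !mulf_neq0// invr_neq0.
suff ijE : i = j by rewrite ijE eqxx in ij.
apply: (bf_disjoint bf il jl).
exists (f c1); split.
  by exists (al * c1 + be); [exact: (interior_affine al0 Tal)|rewrite fS].
by exists (a' * c1 + b'); [exact: (interior_affine a'0 Ta)|rewrite fE].
Qed.

End BasicFigureFacts.

(** A cosine equal to 1 kills the sine of the half angle, which lies in [0, pi) and so must be 0.
    This is how a positive corner angle excludes two sides in the same direction. *)
Lemma carg_gt0 (R : realType) (k : R) : 0 < k -> carg ((k +i* 0)%C : Rcomplex R) = 0.
Proof.
move=> k0; rewrite /carg.
set A := [set t : R | _].
have A0 : A 0.
  split; first by rewrite lexx mulr_gt0// pi_gt0.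
  rewrite cos0 sin0; apply: RcomplexE; rewrite ?ReZ ?ImZ /= ?mulr0// mulr1.
  by rewrite Rcomplex_normE/= expr0n addr0 sqrtr_sqr gtr0_norm.
have [/andP[t0 t2] tE] := @xgetI _ 0 A 0 A0.
set t := xget 0 A in t0 t2 tE *.
have nk : `|((k +i* 0)%C : Rcomplex R)| = k.
  by rewrite Rcomplex_normE/= expr0n addr0 sqrtr_sqr gtr0_norm.
have cos1 : cos t = 1.
  have := congr1 (@complex.Re R) tE; rewrite nk ReZ/= => /esym.
  by rewrite -[RHS]mulr1 => /(mulfI (lt0r_neq0 k0)).
have s2 : sin (t / 2) = 0.
  have : cos ((t / 2) *+ 2) = 1 by rewrite -mulr_natr divfK.
  rewrite cos_mulr2n => c1; have := cos2Dsin2 (t / 2) => c2.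
  by apply/eqP; rewrite -sqrf_eq0; apply/eqP; move: c1; rewrite mulr2n; lra.
apply/eqP; apply: contra_eqT s2 => tn.
have tgt0 : 0 < t by rewrite lt_def tn.
by rewrite gt_eqF// sin_gt0_pi// divr_gt0//= ltr_pdivrMr// mulrC.
Qed.

(** * Length of the polygon and corner inequality *)

Section Corners.
Variable R : realType.
Local Notation C := (Rcomplex R).
Variables (l q : nat) (z : nat -> C) (S : nat -> C -> C).
Hypothesis bf : basic_figure l q z S.
Hypothesis pos : positively_oriented l q z.

Let T := triangle (z 0) (z l) (z q).

Lemma segment_cross0 x : plane_segment (z 0) (z l) x -> cross (z l - z 0) (x - z 0) = 0.
Proof. by move=> [t _ <-]; rewrite /cross !ReImE; ring. Qed.

(** [z q] is off the base line, whereas [z 0], [z 1], [z l.-1] and [z l] lie on it. *)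
Lemma apex_itv : (1 < q)%N && (q.+1 < l)%N.
Proof.
have off x : plane_segment (z 0) (z l) x -> z q != x.
  move=> /segment_cross0 x0; apply/eqP => qx.
  by have := cross_base_gt0 pos; rewrite qx x0 ltxx.
have q0 : q != 0%N.
  apply: contraTneq (off (z 0) _) => [->|]; first by rewrite eqxx.
  by exists 0; rewrite /= ?in_itv/= ?lexx ?ler01// subr0 scale1r scale0r addr0.
have ql : q != l.
  apply: contraTneq (off (z l) _) => [->|]; first by rewrite eqxx.
  by exists 1; rewrite /= ?in_itv/= ?lexx ?ler01// subrr scale1r scale0r add0r.
have q1 : q != 1%N.
  by apply: contraTneq (off _ (bf_first bf)) => ->; rewrite eqxx.
have ql1 : q != l.-1.
  by apply: contraTneq (off _ (bf_last bf)) => ->; rewrite eqxx.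
have ql' : (q < l)%N by rewrite ltn_neqAle ql (bf_apex bf).
have ql2 : (q < l.-1)%N.
  by rewrite ltn_neqAle ql1 -ltnS prednK// (leq_ltn_trans _ ql').
rewrite ltn_predRL in ql2; rewrite ql2 andbT.
by move: q0 q1; case: (q) => [|[|n]].
Qed.

Lemma polygon_length m k : (k <= m)%N ->
  `|z m - z k| <= \sum_(k.+1 <= j < m.+1) `|z j - z j.-1|.
Proof.
elim: m => [|m IH]; first by rewrite leqn0 => /eqP ->; rewrite subrr normr0 big_geq.
rewrite leq_eqVlt => /predU1P[->|km]; first by rewrite subrr normr0 big_geq.
rewrite big_nat_recr//= addrC -(subrKA (z m)); apply: le_trans (ler_normD _ _) _.
by rewrite lerD2l IH.
Qed.

(** The polygon passes through [z q]. With [t] the position of [z q] relative to the base, the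
    triangle inequality is |t| + |1 - t| > 1, strict because [t] has positive imaginary part. *)
Lemma ratio_sum : 1 < \sum_(1 <= j < l.+1) side_ratio l z j.
Proof.
have /andP[q1 ql] := apex_itv; have n0 := base_norm_gt0 pos.
rewrite -mulr_suml ltr_pdivlMr// mul1r.
rewrite (@big_cat_nat _ _ _ q.+1)//=; last by rewrite ltnS ltnW// ltnW.
apply: lt_le_trans (lerD (polygon_length (leq0n q)) (polygon_length (ltnW (ltnW ql)))).
set a := z l - z 0 in n0 *; set b := z q - z 0.
have -> : z l - z q = a - b by rewrite /a /b opprB addrA subrK.
have c0 : 0 < cross a b by exact: cross_base_gt0.
have a0 : a != 0 by rewrite -normr_gt0.
have [t bE it] : exists2 t : C, b = t * a :> C & 0 < complex.Im t.
  by exists (b / a); [rewrite divfK|exact: pos].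
have -> : a - b = (1 - t) * a :> C by rewrite bE mulrBl mul1r.
have nb : `|b| = `|t| * `|a| by rewrite {1}bE Rcomplex_normM.
rewrite nb Rcomplex_normM -mulrDl -[ltLHS]mul1r ltr_pM2r//.
have h1 : complex.Re t < `|t|.
  rewrite Rcomplex_normE (le_lt_trans (ler_norm _))// -sqrtr_sqr ltr_sqrt.
    by rewrite ltrDl exprn_gt0.
  by rewrite ltr_wpDl ?sqr_ge0// exprn_gt0.
have h2 : 1 - complex.Re t <= `|1 - t : C|.
  by have := Re_le_norm (1 - t : C); rewrite !ReImE/=; apply: le_trans; exact: ler_norm.
lra.
Qed.

Hypothesis theta : 0 < theta_min l q z S.

(** Seen from [z p], the copies lie in two sectors that meet only at the origin by [sectors_meet0];
    [sector_gap], applied from each side, makes this quantitative. *)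
Lemma corner_gap p : (1 <= p < l)%N -> exists2 kap : R, 0 < kap & forall x y, T x -> T y ->
  kap * `|S p x - z p| <= `|S p x - S p.+1 y| /\
  kap * `|S p.+1 y - z p| <= `|S p x - S p.+1 y|.
Proof.
move=> pl; have /andP[p1 pl'] := pl.
have il : (1 <= p <= l)%N by rewrite p1 ltnW.
have jl : (1 <= p.+1 <= l)%N by rewrite pl'.
have [al [be [al0 SpE _]]] := similitude_form bf pos il.
have [ga [de [ga0 SqE _]]] := similitude_form bf pos jl.
have zp1 : al * z l + be = z p by rewrite -SpE (bf_end bf).
have zp2 : ga * z 0 + de = z p by rewrite -SqE (bf_start bf).
(* Sides issued from [z p]: [P] is the base and [A] the apex side of copy [p], [Q] and [D] those of
   copy [p.+1]. The sectors run counterclockwise from [A] to [P] and from [Q] to [D]. *)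
pose P : C := al * (z 0 - z l); pose A : C := al * (z q - z l).
pose Q : C := ga * (z l - z 0); pose D : C := ga * (z q - z 0).
have PE : P = z p.-1 - z p.
  by rewrite -(bf_start bf il) SpE -zp1 /P; ring.
have AE : A = S p (z q) - z p by rewrite SpE -zp1 /A; ring.
have QE : Q = z p.+1 - z p.
  by rewrite -(bf_end bf jl) SqE -zp2 /Q; ring.
have DE : D = S p.+1 (z q) - z p by rewrite SqE -zp2 /D; ring.
have crM (t u v : C) : cross (t * u) (t * v) = (complex.Re t ^+ 2 + complex.Im t ^+ 2) * cross u v.
  by rewrite /cross !ReImE; ring.
have sq0 (t : C) : t != 0 -> 0 < complex.Re t ^+ 2 + complex.Im t ^+ 2.
  by move=> t0; rewrite -sqrtr_gt0 -Rcomplex_normE normr_gt0.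
have c0 := cross_base_gt0 pos.
have AP : 0 < cross A P.
  rewrite crM mulr_gt0 ?sq0//.
  by move: c0; rewrite /cross !ReImE; lra.
have QD : 0 < cross Q D by rewrite crM mulr_gt0 ?sq0.
have D0 : D != 0 by apply: contraTneq QD => ->; rewrite /cross/= !mulr0 subrr ltxx.
have Q0 : Q != 0 by apply: contraTneq QD => ->; rewrite /cross/= !mul0r subrr ltxx.
have AD k : 0 < k -> A != k *: D.
  move=> k0; apply/eqP => AkD.
  have : 0 < corner_angle q z S p.
    apply: lt_le_trans theta _; apply: ge_bigmin_seq => //.
    by rewrite mem_index_iota.
  rewrite /corner_angle -AE -DE AkD.
  have -> : (k *: D) / D = (k +i* 0)%C :> C.
    have -> : k *: D = (k +i* 0)%C * D :> C by apply: RcomplexE; rewrite !ReImE/=; ring.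
    by rewrite mulfK.
  by rewrite carg_gt0// ltxx.
(* The weight [k / (1 + k)] gives the same point on both segments, whichever is longer, and this
   point differs from [z p]. *)
have PQ k : 0 < k -> P != k *: Q.
  move=> k0; apply/eqP => PkQ.
  have k1 : 0 < 1 + k by rewrite addr_gt0.
  have W1 : plane_segment (z p.-1) (z p) (z p + (k / (1 + k)) *: Q).
    exists (k / (1 + k)).
      by rewrite /= in_itv/= divr_ge0 ?(ltW k0) ?(ltW k1)//= ler_pdivrMr// mul1r lerDr.
    have -> : z p.-1 = z p + k *: Q by rewrite -PkQ PE addrC subrK.
    by apply: RcomplexE; rewrite !ReImE; field; rewrite gt_eqF.
  have W2 : plane_segment (z p) (z p.+1) (z p + (k / (1 + k)) *: Q).
    exists (k / (1 + k)).
      by rewrite /= in_itv/= divr_ge0 ?(ltW k0) ?(ltW k1)//= ler_pdivrMr// mul1r lerDr.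
    have -> : z p.+1 = z p + Q by rewrite QE addrC subrK.
    by apply: RcomplexE; rewrite !ReImE; ring.
  have : [set z p] (z p + (k / (1 + k)) *: Q) by rewrite -(bf_polygon bf pl).
  move=> /= /eqP; rewrite -subr_eq0 addrAC subrr add0r scaler_eq0 (negbTE Q0) orbF.
  by rewrite gt_eqF// divr_gt0.
have dis W : 0 < cross A W -> 0 < cross W P -> 0 < cross W D -> 0 < cross Q W -> False.
  move=> AW WP WD QW.
  have W1 := cross_decomp W (lt0r_neq0 AP); have W2 := cross_decomp W (lt0r_neq0 QD).
  have : 0 < cross A W / cross A P by rewrite divr_gt0.
  have : 0 < cross W P / cross A P by rewrite divr_gt0.
  have : 0 < cross W D / cross Q D by rewrite divr_gt0.
  have : 0 < cross Q W / cross Q D by rewrite divr_gt0.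
  move: (cross A W / _) (cross W P / _) (cross W D / _) (cross Q W / _) W1 W2.
  move=> a b c d W1 W2 d0 cc0 b0 a0.
  (* Shrinking [W] by [s] leaves a positive barycentric coordinate at the vertex [z p] in both
     triangles. *)
  pose s := (1 + (a + b + (c + d)))^-1.
  have s0 : 0 < s by rewrite invr_gt0 addr_gt0 ?addr_gt0.
  have sE : s * (1 + (a + b + (c + d))) = 1 by rewrite mulVf// gt_eqF// -invr_gt0.
  suff : p = p.+1 by move/eqP; rewrite (ltn_eqF (ltnSn p)).
  apply: (bf_disjoint bf il jl); exists (z p + s *: W); split.
    exists (s * a *: z 0 + (1 - s * a - s * b) *: z l + s * b *: z q).
      by apply: (triangle_interior c0); rewrite ?mulr_gt0//; [nra|ring].
    rewrite SpE affine_triangle; last ring.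
    rewrite zp1 W1 PE AE -(bf_start bf il) !SpE.
    by rewrite -zp1; apply: RcomplexE; rewrite !ReImE; ring.
  exists ((1 - s * c - s * d) *: z 0 + s * c *: z l + s * d *: z q).
    by apply: (triangle_interior c0); rewrite ?mulr_gt0//; [nra|ring].
  rewrite SqE affine_triangle; last ring.
  rewrite zp2 W2 QE DE -(bf_end bf jl) !SqE.
  by rewrite -zp2; apply: RcomplexE; rewrite !ReImE; ring.
have meet0 V : 0 <= cross A V -> 0 <= cross V P -> 0 <= cross V D -> 0 <= cross Q V -> V = 0.
  exact: sectors_meet0.
have ne0 (X Y : C) t : cross X Y != 0 -> (1 - t) *: X + t *: Y != 0.
  move=> XY; apply/eqP => e0.
  have e1 : cross ((1 - t) *: X + t *: Y) Y = 0 by rewrite e0 /cross/=; ring.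
  have e2 : cross X ((1 - t) *: X + t *: Y) = 0 by rewrite e0 /cross/=; ring.
  rewrite !crossE mulr0 addr0 in e1; rewrite !crossE mulr0 add0r in e2.
  move/eqP: e1; rewrite mulf_eq0 (negbTE XY) orbF subr_eq0 => /eqP t1.
  by move/eqP: e2; rewrite mulf_eq0 (negbTE XY) orbF -t1 oner_eq0.
have PAs : cross P A != 0.
  by have -> : cross P A = - cross A P; [rewrite /cross; ring|rewrite oppr_eq0 gt_eqF].
have posc (P1 A1 : C) a b : 0 < cross A1 P1 -> 0 <= a -> 0 <= b ->
    0 <= cross (a *: P1 + b *: A1) P1 /\ 0 <= cross A1 (a *: P1 + b *: A1).
  move=> /ltW h a0 b0; rewrite !crossDl !crossDr !crossZl !crossZr !crossxx.
  by rewrite !mulr0 add0r addr0 !mulr_ge0.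
have posc' (P1 A1 : C) a b : 0 < cross P1 A1 -> 0 <= a -> 0 <= b ->
    0 <= cross (a *: P1 + b *: A1) A1 /\ 0 <= cross P1 (a *: P1 + b *: A1).
  move=> /ltW h a0 b0; rewrite !crossDl !crossDr !crossZl !crossZr !crossxx.
  by rewrite !mulr0 add0r addr0 !mulr_ge0.
have [k1 k10 gap1] : exists2 kap : R, 0 < kap & forall a b y, 0 <= a -> 0 <= b ->
    0 <= cross y D -> 0 <= cross Q y -> kap * (a + b) <= `|a *: P + b *: A - y|.
  apply: sector_gap => t /andP[t_ge0 t_le1] x xD Qx.
  have [|xP Ax] := posc P A (1 - t) t AP _ t_ge0; first by rewrite subr_ge0.
  have x0 : (1 - t) *: P + t *: A = 0 := meet0 _ Ax xP xD Qx.
  by have := ne0 P A t PAs; rewrite x0 eqxx.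
have [k2 k20 gap2] : exists2 kap : R, 0 < kap & forall a b y, 0 <= a -> 0 <= b ->
    0 <= cross y P -> 0 <= cross A y -> kap * (a + b) <= `|a *: Q + b *: D - y|.
  apply: sector_gap => t /andP[t_ge0 t_le1] x xP Ax.
  have [|xD Qx] := posc' Q D (1 - t) t QD _ t_ge0; first by rewrite subr_ge0.
  have x0 : (1 - t) *: Q + t *: D = 0 := meet0 _ Ax xP xD Qx.
  by have := ne0 Q D t (lt0r_neq0 QD); rewrite x0 eqxx.
pose N := `|P| + `|A| + (`|Q| + `|D|) + 1.
have N0 : 0 < N by rewrite ltr_wpDl// !addr_ge0.
exists (Num.min k1 k2 / N); first by rewrite divr_gt0// lt_min k10.
move=> _ _ [u [v [w [u0 v0 w0 s ->]]]] [u' [v' [w' [u'0 v'0 w'0 s' ->]]]].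
rewrite SpE SqE !affine_triangle// -!SpE -!SqE.
have xE : u *: S p (z 0) + v *: S p (z l) + w *: S p (z q) = z p + (u *: P + w *: A).
  rewrite PE AE (bf_start bf il) (bf_end bf il).
  have -> : v = 1 - u - w by rewrite -s; ring.
  by apply: RcomplexE; rewrite !ReImE; ring.
have yE : u' *: S p.+1 (z 0) + v' *: S p.+1 (z l) + w' *: S p.+1 (z q) = z p + (v' *: Q + w' *: D).
  rewrite QE DE (bf_start bf jl) (bf_end bf jl).
  have -> : u' = 1 - v' - w' by rewrite -s'; ring.
  by apply: RcomplexE; rewrite !ReImE; ring.
rewrite xE yE; set X := u *: P + _; set Y := v' *: Q + _.
have -> : z p + X - z p = X by rewrite addrAC subrr add0r.
have -> : z p + Y - z p = Y by rewrite addrAC subrr add0r.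
have -> : z p + X - (z p + Y) = X - Y by rewrite opprD addrACA subrr add0r.
have nle (P1 A1 : C) a b : 0 <= a -> 0 <= b -> `|P1| + `|A1| <= N ->
    `|a *: P1 + b *: A1| <= (a + b) * N.
  move=> a0 b0 h; apply: le_trans (ler_normD _ _) _; rewrite !normrZ !ger0_norm//.
  by have := normr_ge0 P1; have := normr_ge0 A1; nra.
have fin (k n a d : R) : Num.min k1 k2 <= k -> 0 <= a -> n <= a * N -> k * a <= d ->
    Num.min k1 k2 / N * n <= d.
  move=> kk a0 na ka; apply: le_trans ka.
  rewrite mulrAC ler_pdivrMr// -mulrA.
  have m0 : 0 < Num.min k1 k2 by rewrite lt_min k10.
  apply: (@le_trans _ _ (Num.min k1 k2 * (a * N))); first by rewrite ler_wpM2l// ltW.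
  by rewrite ler_wpM2r// mulr_ge0// ltW.
split.
  have [Y1 Y2] := posc' Q D v' w' QD v'0 w'0.
  apply: (fin k1 _ (u + w)); rewrite ?addr_ge0// ?ge_min ?lexx//; last exact: gap1.
  by apply: nle => //; rewrite /N; have := normr_ge0 Q; have := normr_ge0 D; lra.
have [X1 X2] := posc P A u w AP u0 w0.
apply: (fin k2 _ (v' + w')); rewrite ?addr_ge0// ?ge_min ?lexx ?orbT//; last by rewrite distrC; exact: gap2.
by apply: nle => //; rewrite /N; have := normr_ge0 P; have := normr_ge0 A; lra.
Qed.

End Corners.

(** * The arc and its order *)

Section Arcs.
Variable R : realType.
Local Notation C := (Rcomplex R).
Implicit Types (L : set C) (gam : R -> C) (g : C -> R).

(** The body of [arc_parametrization] with the inverse [g] exposed, so that the two convert by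
    definition. *)
Definition arc_pair L gam g : Prop :=
  [/\ {within `[0, 1], continuous gam} /\ {within L, continuous g},
      {homo gam : t / `[0, 1]%classic t >-> L t} /\
        {homo g : x / L x >-> `[0, 1]%classic x},
      forall t, `[0, 1]%classic t -> g (gam t) = t
    & forall x, L x -> gam (g x) = x].

Section Pair.
Variables (L : set C) (gam : R -> C) (g : C -> R).
Hypothesis ap : arc_pair L gam g.

Lemma arc_homo t : 0 <= t <= 1 -> L (gam t).
Proof. by move=> t1; have [_ [h _] _ _] := ap; apply: h; rewrite /= in_itv. Qed.
Lemma arc_itv x : L x -> 0 <= g x <= 1.
Proof. by have [_ [_ h] _ _] := ap; move=> /h /=; rewrite in_itv. Qed.
Lemma arc_gK t : 0 <= t <= 1 -> g (gam t) = t.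
Proof. by move=> t1; have [_ _ h _] := ap; apply: h; rewrite /= in_itv. Qed.
Lemma arc_gamK x : L x -> gam (g x) = x.
Proof. by have [_ _ _ h] := ap; exact: h. Qed.

Lemma within_comp (A : set R) (f : R -> C) : {within A, continuous f} ->
  (forall t, A t -> L (f t)) -> {within A, continuous (g \o f)}.
Proof.
move=> /subspace_continuousP fc fL; have [[_ /subspace_continuousP gc] _ _ _] := ap.
apply/subspace_continuousP => t At B gB.
have fB : nbhs t (fun u => A u -> L (f u) -> B (g (f u))).
  exact: (fc t At _ (gc _ (fL t At) B gB)).
exact: (@filterS _ (nbhs t) _ _ _ (fun u fu Au => fu Au (fL u Au)) fB).
Qed.
End Pair.

Lemma injective_between (k : R -> R) (a b t : R) :
  {within `[0, 1], continuous k} ->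
  (forall t u, 0 <= t <= 1 -> 0 <= u <= 1 -> k t = k u -> t = u) ->
  0 <= a <= 1 -> 0 <= b <= 1 -> Num.min a b <= t <= Num.max a b ->
  Num.min (k a) (k b) <= k t <= Num.max (k a) (k b).
Proof.
move=> kc kinj a1 b1 tab.
have t1 : 0 <= t <= 1.
  have [/andP[? ?] [/andP[? ?] /andP[h1 h2]]] := (a1, (b1, tab)).
  move: h1 h2; rewrite ge_min le_max => /orP[?|?] /orP[?|?]; apply/andP; split; lra.
have inj : {in `[0, 1] &, injective k}.
  by move=> x y; rewrite !in_itv/= => x1 y1; exact: kinj.
have := itv_continuous_inj_mono kc inj.
wlog ab : a b a1 b1 tab / a <= b.
  move=> H; have [|/ltW ba] := leP a b; first exact: H.
  by move=> /(H b a b1 a1); rewrite [Num.min (k a) _]minC [Num.max (k a) _]maxC; apply => //; rewrite minC maxC.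
move: tab; rewrite min_l// max_r// => /andP[at_ tb] [] km.
  have kat : k a <= k t.
    by move: at_; rewrite le_eqVlt => /predU1P[->//|/km h]; apply/ltW/h; rewrite in_itv.
  have ktb : k t <= k b.
    by move: tb; rewrite le_eqVlt => /predU1P[->//|/km h]; apply/ltW/h; rewrite in_itv.
  by rewrite ge_min kat le_max ktb orbT.
have kat : k t <= k a.
  by move: at_; rewrite le_eqVlt => /predU1P[->//|/km h]; apply/ltW/h; rewrite in_itv.
have ktb : k b <= k t.
  by move: tb; rewrite le_eqVlt => /predU1P[->//|/km h]; apply/ltW/h; rewrite in_itv.
by rewrite ge_min ktb orbT le_max kat.
Qed.

(** Another parametrization differs from [gam] by an injective continuous self-map of the unit
    interval, which is monotone and so preserves betweenness. *)
Lemma subarcE L gam g x y : arc_pair L gam g -> L x -> L y ->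
  subarc L x y = chart_arc gam (Num.min (g x) (g y)) (Num.max (g x) (g y)).
Proof.
move=> ap Lx Ly; apply/seteqP; split=> w.
  move=> [gam' [g' ap'] [a [b [t [a1 b1 [xE yE] tab wE]]]]].
  have ap'' : arc_pair L gam' g' by [].
  have hom' := arc_homo ap''.
  have t1 : 0 <= t <= 1.
    have [/andP[? ?] [/andP[? ?] /andP[h1 h2]]] := (a1, (b1, tab)).
    move: h1 h2; rewrite ge_min le_max => /orP[?|?] /orP[?|?]; apply/andP; split; lra.
  have Lw : L w by rewrite wE; exact: hom'.
  exists (g w); last exact: (arc_gamK ap).
  rewrite /= in_itv/= xE yE wE.
  apply: (@injective_between (g \o gam')) => //.
    have [[gc' _] _ _ _] := ap''; apply: (within_comp ap gc').
    by move=> u; rewrite /= in_itv/=; exact: hom'.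
  move=> u v u1 v1 /= /(congr1 gam); rewrite !(arc_gamK ap); do ?exact: hom'.
  move=> /(congr1 g').
  by rewrite !(arc_gK ap'').
move=> [t /=]; rewrite in_itv/= => tb <-.
exists gam; first by exists g.
by exists (g x), (g y), t; rewrite !(arc_gamK ap)// (arc_itv ap Lx) (arc_itv ap Ly).
Qed.

Lemma arc_pair_rev L gam g : arc_pair L gam g ->
  arc_pair L (fun t => gam (1 - t)) (fun x => 1 - g x).
Proof.
move=> ap; have [[gc hc] _ _ _] := ap.
have I (t : R) : 0 <= t <= 1 -> 0 <= 1 - t <= 1.
  by move=> /andP[? ?]; apply/andP; split; lra.
split.
- split.
    apply/subspace_continuousP => t /=; rewrite in_itv/= => t1.
    apply/cvgrPdist_lt => e e0.
    move/subspace_continuousP: gc => /(_ (1 - t)); rewrite /= in_itv/= => /(_ (I t t1)).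
    move=> /cvgrPdist_lt /(_ e e0); rewrite !near_withinE => /nbhs_normP[d /= d0 dP].
    apply/nbhs_normP; exists d => //= u; rewrite /ball_/= => tu; rewrite in_itv/= => u1.
    apply: dP; last by rewrite in_itv/=; exact: I.
    rewrite /ball_/= (_ : 1 - t - (1 - u) = - (t - u)); last ring.
    by rewrite normrN.
  apply/subspace_continuousP => x Lx.
  move/subspace_continuousP: hc => /(_ x Lx) h.
  by apply: (@cvgB _ R^o) => //; exact: cvg_cst.
- split=> [t|x Lx] /=.
    by rewrite in_itv/= => t1; apply: (arc_homo ap); exact: I.
  by rewrite in_itv/=; apply: I; exact: arc_itv ap _ Lx.
- by move=> t /=; rewrite in_itv/= => t1; rewrite (arc_gK ap) ?I// opprB addrC subrK.
- by move=> x Lx /=; rewrite opprB addrC subrK (arc_gamK ap).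
Qed.

Lemma common_lower n (Q : nat -> R -> Prop) :
  (forall j d d', Q j d -> 0 < d' -> d' <= d -> Q j d') ->
  (forall j, (j < n)%N -> exists2 d, 0 < d & Q j d) ->
  exists2 d, 0 < d & forall j, (j < n)%N -> Q j d.
Proof.
move=> Qle; elim: n => [|n IH] H; first by exists 1.
have [j jn|d d0 dP] := IH; first by apply: H; exact: ltnW.
have [d' d'0 d'P] := H n (ltnSn n).
have m0 : 0 < Num.min d d' by rewrite lt_min d0.
exists (Num.min d d') => // j; rewrite ltnS leq_eqVlt => /predU1P[->|jn].
  by apply: Qle d'P m0 _; rewrite ge_min lexx orbT.
by apply: Qle (dP j jn) m0 _; rewrite ge_min lexx.
Qed.

End Arcs.

(** * The chart of a self-similar arc *)

Section ArcChart.
Variable R : realType.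
Local Notation C := (Rcomplex R).
Variables (l q : nat) (z : nat -> C) (S : nat -> C -> C) (L : set C).
Hypothesis bf : basic_figure l q z S.
Hypothesis pos : positively_oriented l q z.
Hypothesis theta : 0 < theta_min l q z S.
Hypothesis att : attractor l S L.

(** Three copies are needed for the second one to lie between two others. *)
Let L3 : (2 < l)%N.
Proof.
have /andP[q1 ql] := apex_itv bf pos.
by apply: leq_trans ql; rewrite !ltnS ltnW.
Qed.

Section Oriented.
Variables (gam : R -> C) (g : C -> R).
Hypothesis ap : arc_pair L gam g.
Hypothesis g01 : g (z 0) < g (z 1).

Let h j t := g (S j (gam t)).
Let I0 : 0 <= (0 : R) <= 1. Proof. by rewrite lexx ler01. Qed.
Let I1 : 0 <= (1 : R) <= 1. Proof. by rewrite lexx ler01. Qed.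

Let Lz j : (j <= l)%N -> L (z j). Proof. exact: (vertex_attractor bf pos att). Qed.

Let L_S j x : (1 <= j <= l)%N -> L x -> L (S j x).
Proof. by have [_ _ LE] := att; move=> jl Lx; rewrite LE; exists j => //; exists x. Qed.

Let t_itv j : (j <= l)%N -> 0 <= g (z j) <= 1.
Proof. by move=> jl; apply: (arc_itv ap); exact: Lz. Qed.

Let Lgam t : 0 <= t <= 1 -> L (gam t). Proof. exact: (arc_homo ap). Qed.

Let h_itv j t : (1 <= j <= l)%N -> 0 <= t <= 1 -> 0 <= h j t <= 1.
Proof. by move=> jl t1; apply: (arc_itv ap); exact/L_S/Lgam. Qed.

Let gam_h j t : (1 <= j <= l)%N -> 0 <= t <= 1 -> gam (h j t) = S j (gam t).
Proof. by move=> jl t1; rewrite (arc_gamK ap)//; exact/L_S/Lgam. Qed.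

Let gam_inj t u : 0 <= t <= 1 -> 0 <= u <= 1 -> gam t = gam u -> t = u.
Proof. by move=> t1 u1 /(congr1 g); rewrite !(arc_gK ap). Qed.

Let h_dist j t u : (1 <= j <= l)%N -> 0 <= t <= 1 -> 0 <= u <= 1 ->
  `|gam (h j t) - gam (h j u)| = side_ratio l z j * `|gam t - gam u|.
Proof. by move=> jl t1 u1; rewrite !gam_h// (similitude_dist bf pos). Qed.

Let h_inj j t u : (1 <= j <= l)%N -> 0 <= t <= 1 -> 0 <= u <= 1 -> h j t = h j u -> t = u.
Proof.
move=> jl t1 u1 htu; apply: gam_inj => //; apply/eqP; rewrite -subr_eq0 -normr_eq0.
have /andP[r0 _] := ratio01 bf pos jl.
by rewrite -(mulrI_eq0 _ (mulfI (lt0r_neq0 r0))) -h_dist// htu subrr normr0.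
Qed.

Let h_cont j : (1 <= j <= l)%N -> {within `[0, 1], continuous (h j)}.
Proof.
move=> jl; apply: (@within_comp _ _ _ _ ap _ (S j \o gam)).
  have [[gc _] _ _ _] := ap; apply/subspace_continuousP => t At.
  apply: (@cvg_comp _ _ _ gam (S j) _ (nbhs (gam t))).
    by move/subspace_continuousP: gc => /(_ t At).
  apply: (@lipschitz_continuous _ C _ (side_ratio l z j)) => x y.
  by rewrite (similitude_dist bf pos).
by move=> t; rewrite /= in_itv/= => t1; exact/L_S/Lgam.
Qed.

Let h_ivt j a b t : (1 <= j <= l)%N -> 0 <= a <= 1 -> 0 <= b <= 1 ->
  h j a <= t <= h j b -> exists2 u, 0 <= u <= 1 & t = h j u.
Proof.
move=> jl a1 b1 tab.
have sub c d : 0 <= c <= 1 -> 0 <= d <= 1 -> {within `[c, d], continuous (h j)}.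
  move=> /andP[c0 _] /andP[_ d1]; apply: continuous_subspaceW (h_cont jl).
  by move=> x /=; rewrite !in_itv/= => /andP[? ?]; apply/andP; split; lra.
have [ab|/ltW ba] := leP a b.
  have [|u] := IVT (v := t) ab (sub a b a1 b1).
    by have /andP[h1 h2] := tab; rewrite ge_min h1 le_max h2 orbT.
  rewrite in_itv/= => /andP[? ?] <-; exists u => //.
  by have [/andP[? ?] /andP[? ?]] := (a1, b1); apply/andP; split; lra.
have [|u] := IVT (v := t) ba (sub b a b1 a1).
  by have /andP[h1 h2] := tab; rewrite ge_min h1 orbT le_max h2.
rewrite in_itv/= => /andP[? ?] <-; exists u => //.
by have [/andP[? ?] /andP[? ?]] := (a1, b1); apply/andP; split; lra.
Qed.

Let rng j t := exists2 u, 0 <= u <= 1 & t = h j u.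

Let rng_conv j a b t : (1 <= j <= l)%N -> rng j a -> rng j b -> a <= t <= b -> rng j t.
Proof. by move=> jl [u u1 ->] [v v1 ->]; exact: h_ivt. Qed.

(** By continuity of [g], points of [L] near the one at the middle of a shared interval have
    parameters in that interval, hence belong to copy [j], against [copies_no_common_part]. *)
Let no_overlap i j a b : (1 <= i <= l)%N -> (1 <= j <= l)%N -> i != j -> a < b ->
  rng i a -> rng i b -> rng j a -> rng j b -> False.
Proof.
move=> il jl ij ab ia ib ja jb.
have m1 : a <= (a + b) / 2 <= b by apply/andP; split; lra.
have [u u1 mE] := rng_conv il ia ib m1.
have mI : 0 <= (a + b) / 2 <= 1 by rewrite mE; exact: h_itv.
have Sx : (S i @` L) (gam ((a + b) / 2)).
  by rewrite mE gam_h//; exists (gam u) => //; exact: Lgam.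
have [[_ /subspace_continuousP gc] _ _ _] := ap.
have e0 : 0 < (b - a) / 2 by lra.
have := gc _ (Lgam mI) => /cvgrPdist_lt /(_ _ e0); rewrite near_withinE => /nbhs_distP[d d0 dP].
apply: (copies_no_common_part bf pos att il jl ij Sx d0) => y Ly yd.
have gy : `|g (gam ((a + b) / 2)) - g y| < (b - a) / 2 := dP y yd Ly.
move: gy; rewrite (arc_gK ap)// ltr_norml => /andP[? ?].
have [|v v1 gyE] := rng_conv jl ja jb (t := g y); first by apply/andP; split; lra.
by exists (gam v); [exact: Lgam|rewrite -gam_h// -gyE (arc_gamK ap)].
Qed.

Let h_start j : (1 <= j <= l)%N -> h j (g (z 0)) = g (z j.-1).
Proof. by move=> jl; rewrite /h (arc_gamK ap (Lz (leq0n l))) (bf_start bf jl). Qed.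

Let h_end j : (1 <= j <= l)%N -> h j (g (z l)) = g (z j).
Proof. by move=> jl; rewrite /h (arc_gamK ap (Lz (leqnn l))) (bf_end bf jl). Qed.

Let rng_start j : (1 <= j <= l)%N -> rng j (g (z j.-1)).
Proof. by move=> jl; exists (g (z 0)); [exact: t_itv|rewrite h_start]. Qed.

Let rng_end j : (1 <= j <= l)%N -> rng j (g (z j)).
Proof. by move=> jl; exists (g (z l)); [exact: t_itv|rewrite h_end]. Qed.

Let t_neq j : (1 <= j <= l)%N -> g (z j.-1) != g (z j).
Proof.
move=> jl; apply/eqP; rewrite -(h_start jl) -(h_end jl) => /(h_inj jl (t_itv (leq0n l)) (t_itv (leqnn l))).
move=> /(congr1 gam); rewrite (arc_gamK ap (Lz (leq0n l))) (arc_gamK ap (Lz (leqnn l))) => z0l.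
by have := base_neq pos; rewrite z0l subrr eqxx.
Qed.

(** If the parameters of the vertices turned back at some vertex, the copies on its two sides would
    share the parameters just before it. *)
Let t_step j : (1 <= j <= l)%N -> g (z j.-1) < g (z j).
Proof.
elim: j => [//|[|j] IH] jl; first exact: g01.
have jl' : (1 <= j.+1 <= l)%N by case/andP: jl => _ /ltnW.
have tj := IH jl'; rewrite /= in tj *.
have := t_neq jl; rewrite neq_lt => /orP[//|tj2].
have := rng_start jl; have := rng_end jl; have := rng_start jl'; have := rng_end jl'.
rewrite /= => e1 s1 e2 s2; exfalso.
have nj : j.+1 != j.+2 by rewrite ltn_eqF.
have [tt|/ltW tt] := leP (g (z j)) (g (z j.+2)).
  apply: (no_overlap jl' jl nj tj2) => //.
  by apply: (rng_conv jl' s1 e1); rewrite tt ltW.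
apply: (no_overlap jl' jl nj tj) => //.
by apply: (rng_conv jl e2 s2); rewrite tt ltW.
Qed.

Let t_le i j : (i <= j)%N -> (j <= l)%N -> g (z i) <= g (z j).
Proof.
elim: j => [|j IH]; first by rewrite leqn0 => /eqP ->.
rewrite leq_eqVlt => /predU1P[->//|ij] jl.
by apply: le_trans (IH ij (ltnW jl)) _; apply/ltW/(@t_step j.+1).
Qed.

(* The second copy lies between two others, hence exactly between [z 1] and
   [z 2]; as it is an image of the whole arc, the arc ends at [z 0] and [z l]. *)
Let rng2 t : rng 2 t -> g (z 1) <= t <= g (z 2).
Proof.
have l1 : (1 <= 1 <= l)%N by exact: (ltnW (ltnW L3)).
have l2 : (1 <= 2 <= l)%N by exact: (ltnW L3).
have l3 : (1 <= 3 <= l)%N by [].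
move=> rt; apply/andP; split; rewrite leNgt; apply/negP => tz.
  have [tt|/ltW tt] := leP (g (z 0)) t.
    apply: (@no_overlap 1 2 t (g (z 1)) l1 l2) => //.
    - by apply: (rng_conv l1 (rng_start l1) (rng_end l1)); rewrite /= tt ltW.
    - exact: (rng_end l1).
    - exact: (rng_start l2).
  apply: (@no_overlap 1 2 (g (z 0)) (g (z 1)) l1 l2) => //.
  - exact: (rng_start l1).
  - exact: (rng_end l1).
  - by apply: (rng_conv l2 rt (rng_start l2)); rewrite /= tt ltW.
  - exact: (rng_start l2).
have [tt|/ltW tt] := leP t (g (z 3)).
  apply: (@no_overlap 2 3 (g (z 2)) t l2 l3) => //.
  - exact: (rng_end l2).
  - exact: (rng_start l3).
  - by apply: (rng_conv l3 (rng_start l3) (rng_end l3)); rewrite /= tt ltW.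
apply: (@no_overlap 2 3 (g (z 2)) (g (z 3)) l2 l3) => //.
- exact: (t_step l3).
- exact: (rng_end l2).
- by apply: (rng_conv l2 (rng_end l2) rt); rewrite tt ltW// (t_step l3).
- exact: (rng_start l3).
- exact: (rng_end l3).
Qed.

Let h_mono j : (1 <= j <= l)%N -> forall t u, 0 <= t <= 1 -> 0 <= u <= 1 -> t <= u -> h j t <= h j u.
Proof.
move=> jl; have inj : {in `[0, 1] &, injective (h j)}.
  by move=> x y; rewrite !in_itv/= => x1 y1; exact: h_inj.
have t0l : g (z 0) < g (z l).
  apply: lt_le_trans g01 _; apply: t_le => //; exact: (ltnW (ltnW L3)).
have [km|km] := itv_continuous_inj_mono (h_cont jl) inj => t u t1 u1.
  by rewrite le_eqVlt => /predU1P[->//|tu]; apply/ltW/km; rewrite ?in_itv.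
have := km (g (z l)) (g (z 0)); rewrite !in_itv/= !t_itv// => /(_ isT isT t0l).
by rewrite (h_start jl) (h_end jl) ltNge (ltW (t_step jl)).
Qed.

Let l2 : (1 <= 2 <= l)%N. Proof. exact: (ltnW L3). Qed.

(** [h 2] increases and sends the parameter of [z 0] to that of [z 1], the least value allowed by
    [rng2]; so no parameter precedes that of [z 0]. *)
Lemma arc_start : g (z 0) = 0.
Proof.
apply: (h_inj l2) => //; first exact: t_itv.
apply/eqP; rewrite eq_le; apply/andP; split; last first.
  by apply: (h_mono l2) => //; [exact: t_itv|have /andP[] := t_itv (leq0n l)].
rewrite (h_start l2)/=.
by have /andP[] : g (z 1) <= h 2 0 <= g (z 2) by apply: rng2; exists 0.
Qed.

Lemma arc_end : g (z l) = 1.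
Proof.
apply: (h_inj l2) => //; first exact: t_itv.
apply/eqP; rewrite eq_le; apply/andP; split.
  by apply: (h_mono l2) => //; [exact: t_itv|have /andP[] := t_itv (leqnn l)].
rewrite (h_end l2)/=.
by have /andP[] : g (z 1) <= h 2 1 <= g (z 2) by apply: rng2; exists 1.
Qed.

Let h0 j : (1 <= j <= l)%N -> h j 0 = g (z j.-1).
Proof. by move=> jl; rewrite -arc_start h_start. Qed.

Let h1 j : (1 <= j <= l)%N -> h j 1 = g (z j).
Proof. by move=> jl; rewrite -arc_end h_end. Qed.

Let h_bounds j t : (1 <= j <= l)%N -> 0 <= t <= 1 -> g (z j.-1) <= h j t <= g (z j).
Proof.
by move=> jl t1; have /andP[t0 t1'] := t1; rewrite -(h0 jl) -(h1 jl) !(h_mono jl).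
Qed.

(** An intermediate copy separates the parameter ranges of copies that are not successive, which are
    thus disjoint compact sets, and there are finitely many pairs. *)
Let sep : exists2 del : R, 0 < del & forall i j t u, (1 <= i)%N -> (i.+1 < j <= l)%N ->
    0 <= t <= 1 -> 0 <= u <= 1 -> del <= `|gam (h i t) - gam (h j u)|.
Proof.
have Scont j : (1 <= j <= l)%N -> continuous (S j).
  move=> jl; apply: (@lipschitz_continuous _ C _ (side_ratio l z j)) => x y.
  by rewrite (similitude_dist bf pos).
have [cL [x0 Lx0] _] := att.
have cS j : (1 <= j <= l)%N -> compact (S j @` L).
  by move=> jl; apply: continuous_compact => //; exact/continuous_subspaceT/Scont.
have nS j : (S j @` L) !=set0 by exists (S j x0); exists x0.
pose Q i j (d : R) := (1 <= i)%N -> (i.+1 < j <= l)%N -> forall x y,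
  (S i @` L) x -> (S j @` L) y -> d <= `|x - y|.
have Qex i j : exists2 d, 0 < d & Q i j d.
  have [/andP[i1 /andP[ij jl]]|n] := boolP ((1 <= i)%N && (i.+1 < j <= l)%N); last first.
    exists 1 => // i1 ij; by rewrite i1 ij in n.
  have il : (1 <= i <= l)%N by rewrite i1; exact: (ltnW (ltnW (leq_trans ij jl))).
  have jl' : (1 <= j <= l)%N by rewrite jl (leq_trans _ ij).
  have [|d d0 dP] := compact_disjoint_dist (cS i il) (nS i) (cS j jl') (nS j).
    move=> _ [x Lx <-] [y Ly xy].
    have := h_bounds il (arc_itv ap Lx); have := h_bounds jl' (arc_itv ap Ly).
    rewrite /h !(arc_gamK ap)// xy => /andP[a _] /andP[_ b].
    have : g (z i) < g (z j.-1).
      apply: lt_le_trans (t_step (j := i.+1) _) _.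
        by rewrite /= (leq_trans (ltnW ij)).
      by apply: t_le; [rewrite -ltnS prednK// (leq_trans _ ij)|rewrite (leq_trans _ jl)// leq_pred].
    by move=> c; have := le_lt_trans b (lt_le_trans c a); rewrite ltxx.
  by exists d => // _ _ x y; exact: dP.
have [i d d' Qd d'0 dd' j jl i1 ij x y Sx Sy|i _|d d0 dP] :=
    common_lower (n := l.+1) (Q := fun i d => forall j, (j < l.+1)%N -> Q i j d).
- exact: le_trans dd' (Qd j jl i1 ij x y Sx Sy).
- apply: common_lower => [j d d' Qd d'0 dd' i1 ij x y Sx Sy|j _]; last exact: Qex.
  exact: le_trans dd' (Qd i1 ij x y Sx Sy).
exists d => // i j t u i1 ij t1 u1; have /andP[ij' jl] := ij.
have il : (1 <= i <= l)%N by rewrite i1; exact: (ltnW (ltnW (leq_trans ij' jl))).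
have jl' : (1 <= j <= l)%N by rewrite jl (leq_trans _ ij').
apply: (dP i _ j) => //; first by rewrite ltnS; case/andP: il.
  by rewrite gam_h//; exists (gam t) => //; exact: Lgam.
by rewrite gam_h//; exists (gam u) => //; exact: Lgam.
Qed.

Let corner : exists2 kap : R, 0 < kap & forall p t u, (1 <= p < l)%N ->
    0 <= t <= 1 -> 0 <= u <= 1 ->
    kap * `|gam (h p t) - gam (h p 1)| <= `|gam (h p t) - gam (h p.+1 u)| /\
    kap * `|gam (h p.+1 u) - gam (h p 1)| <= `|gam (h p t) - gam (h p.+1 u)|.
Proof.
pose Q p (k : R) := (1 <= p < l)%N -> forall t u, 0 <= t <= 1 -> 0 <= u <= 1 ->
    k * `|gam (h p t) - gam (h p 1)| <= `|gam (h p t) - gam (h p.+1 u)| /\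
    k * `|gam (h p.+1 u) - gam (h p 1)| <= `|gam (h p t) - gam (h p.+1 u)|.
have [p d d' Qd d'0 dd' pl t u t1 u1|p _|k k0 kP] := common_lower (n := l) (Q := Q).
- have [Q1 Q2] := Qd pl t u t1 u1; split.
    by apply: le_trans Q1; rewrite ler_wpM2r.
  by apply: le_trans Q2; rewrite ler_wpM2r.
- have [pl|np] := boolP (1 <= p < l)%N; last by exists 1 => // pl; rewrite pl in np.
  have [k k0 kP] := corner_gap bf pos theta pl; exists k => // _ t u t1 u1.
  have /andP[p1 pl'] := pl.
  have il : (1 <= p <= l)%N by rewrite p1; exact: ltnW.
  have jl : (1 <= p.+1 <= l)%N by rewrite pl'.
  rewrite (h1 il) (arc_gamK ap); last by apply: Lz; exact: ltnW.
  rewrite !gam_h//; apply: kP; apply: (attractor_triangle bf pos att); exact: Lgam.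
exists k => // p t u pl; apply: kP => //; by case/andP: pl.
Qed.

Lemma arc_chart : self_similar_chart l gam h (side_ratio l z).
Proof.
have [_ _ LE] := att.
split=> //.
- by move=> j; exact: (ratio01 bf pos).
- by move=> j t u jl t0 tu u1; apply: (h_mono jl) => //; apply/andP; split; lra.
- move=> t t1; have := Lgam t1; rewrite LE => -[j /= jl [x Lx xE]].
  exists j; split => //; exists (g x); first exact: (arc_itv ap).
  by rewrite /h (arc_gamK ap)// xE (arc_gK ap).
- by rewrite h0 ?arc_start//; exact: (ltnW (ltnW L3)).
- by rewrite h1 ?arc_end// leqnn andbT; exact: (ltnW (ltnW L3)).
- by move=> j /andP[j1 jl]; rewrite h1 ?h0 ?j1//; exact: ltnW.
- move=> i j t u i1 /andP[ij jl] t1 u1.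
  have il : (1 <= i <= l)%N by rewrite i1; exact: (ltnW (leq_trans ij jl)).
  have jl' : (1 <= j <= l)%N by rewrite jl (leq_trans _ ij).
  have /andP[_ b1] := h_bounds il t1; have /andP[b2 _] := h_bounds jl' u1.
  apply: le_trans b1 (le_trans _ b2); apply: t_le.
    by rewrite -ltnS prednK// (leq_trans _ ij).
  by rewrite (leq_trans _ jl)// leq_pred.
- have [D D0 DP] := attractor_bounded att; exists D => t u t1 u1.
  by apply: DP; exact: Lgam.
Qed.

Lemma arc_chart_map j t : (1 <= j <= l)%N -> 0 <= t <= 1 -> S j (gam t) = gam (h j t).
Proof. by move=> jl t1; rewrite gam_h. Qed.

End Oriented.
End ArcChart.

(** * Quasi-arcs and Whitney functions *)

Section RegularArc.
Variable R : realType.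
Local Notation C := (Rcomplex R).

Lemma oriented_arc_pair (l q : nat) (z : nat -> C) (S : nat -> C -> C) (L : set C) :
  basic_figure l q z S -> positively_oriented l q z -> attractor l S L -> is_arc L ->
  exists gam g, arc_pair L gam g /\ g (z 0) < g (z 1).
Proof.
move=> bf pos att [gam [g ap]].
have l0 := len_gt0 pos.
have L0 : L (z 0) by exact: (vertex_attractor bf pos att).
have L1 : L (z 1) by exact: (vertex_attractor bf pos att).
have : g (z 0) != g (z 1).
  apply/eqP => /(congr1 gam); rewrite !(arc_gamK (ap : arc_pair L gam g))// => z01.
  have := ratio01 bf pos (l0 : (1 <= 1 <= l)%N).
  by rewrite /side_ratio/= z01 subrr normr0 mul0r ltxx.
rewrite neq_lt => /orP[g01|g10]; first by exists gam, g.
exists (fun t => gam (1 - t)), (fun x => 1 - g x); split; first exact: arc_pair_rev.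
by rewrite ltrD2l ltrN2.
Qed.

Local Open Scope ereal_scope.

(** The distance to the power [t] is the distance times its power [t - 1], which is bounded in terms
    of [D]. The added 1 makes the constant positive. *)
Lemma quasi_arc_bounded_turning (L : set C) (c D t : R) : (0 <= c)%R -> (1 <= t)%R ->
  (forall x y, L x -> L y -> diam (subarc L x y) <= (c * `|x - y|)%:E) ->
  (forall x y, L x -> L y -> (`|x - y| <= D)%R) -> quasi_arc t L.
Proof.
move=> c0 t1 bt LD; exists (c `^ t * D `^ (t - 1) + 1)%R.
  by rewrite ltr_wpDl// mulr_ge0 ?powR_ge0.
have t0 : (0 < t)%R by rewrite (lt_le_trans _ t1).
move=> x y Lx Ly; have xy0 := normr_ge0 (x - y)%R.
apply: (@le_trans _ _ ((c * `|x - y|) `^ t)%:E).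
  by apply: diam_pow_bound; [exact: ltW|rewrite mulr_ge0|exact: bt].
rewrite lee_fin powRM// -(mulr_powRB1 xy0 t0) mulrDl mul1r.
apply: ler_wpDr => //; rewrite [(`|x - y| * _)%R]mulrC mulrA.
rewrite ler_wpM2r// ler_wpM2l ?powR_ge0//.
apply: ge0_ler_powR; rewrite ?nnegrE ?subr_ge0//; last exact: LD.
by apply: le_trans (LD x x Lx Lx); rewrite normr_ge0.
Qed.

(** Subadditivity suffices: [f y] exceeds [f x] by at most the measure of the subarc between them.
    The values at the two ends, 0 and the measure of [L], show that [f] is not constant. *)
Lemma whitney_function_hausdorff (L : set C) (gam : R -> C) (g : C -> R) (x0 : C) (c s : R) :
  compact L -> arc_pair L gam g -> L x0 -> g x0 = 0%R -> (1 < s)%R -> (0 <= c)%R ->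
  0 < hausdorff_measure s L < +oo ->
  (forall a b, (0 <= a)%R -> (a <= b)%R -> (b <= 1)%R ->
    hausdorff_measure s (chart_arc gam a b) <= (c * `|gam a - gam b| `^ s)%:E) ->
  (forall x, L x -> hausdorff_measure s (subarc L x0 x) \is a fin_num) /\
  whitney_function L (fun x => fine (hausdorff_measure s (subarc L x0 x))).
Proof.
move=> cL ap Lx0 gx0 s1 c0 /andP[HL0 HLoo] Hc.
have gI x (Lx : L x) := arc_itv ap Lx.
have I1 : (0 <= (1 : R) <= 1)%R by rewrite ler01 lexx.
have subE x : L x -> subarc L x0 x = chart_arc gam 0 (g x).
  move=> Lx; have /andP[g0 _] := gI x Lx.
  by rewrite (subarcE ap Lx0 Lx) gx0 min_l// max_r.
have fin x : L x -> hausdorff_measure s (chart_arc gam 0 (g x)) \is a fin_num.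
  move=> Lx; rewrite ge0_fin_numE ?hausdorff_measure_ge0//.
  apply: le_lt_trans HLoo; apply: hausdorff_measure_le => w [t /=].
  rewrite in_itv/= => /andP[t0 tx] <-; apply: (arc_homo ap).
  by have /andP[_ g1] := gI x Lx; rewrite t0 (le_trans tx).
split=> [x Lx|]; first by rewrite subE// fin.
set f := fun x => fine _.
have fE x : L x -> (f x)%:E = hausdorff_measure s (chart_arc gam 0 (g x)).
  by move=> Lx; rewrite /f subE// fineK// fin.
have mono x y : L x -> L y -> (g x <= g y)%R -> (`|f x - f y| <= c * `|x - y| `^ s)%R.
  move=> Lx Ly xy; have [/andP[gx _] /andP[_ gy]] := (gI x Lx, gI y Ly).
  have fxy : (f x <= f y)%R.
    rewrite -lee_fin !fE//; apply: hausdorff_measure_le => _ [t /= + <-].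
    by rewrite in_itv/= => /andP[t0 tx]; exists t => //=; rewrite in_itv/= t0 (le_trans tx).
  rewrite distrC ger0_norm ?subr_ge0// lerBlDl -lee_fin EFinD !fE//.
  apply: (@le_trans _ _ (hausdorff_measure s (chart_arc gam 0 (g x)) +
      hausdorff_measure s (chart_arc gam (g x) (g y)))).
    apply: le_trans (hausdorff_measureU _ _ _).
    exact/hausdorff_measure_le/chart_arc_split.
  by rewrite leeD2l// -{2}(arc_gamK ap Lx) -{2}(arc_gamK ap Ly) Hc.
have fH x y : L x -> L y -> (`|f x - f y| <= c * `|x - y| `^ s)%R.
  move=> Lx Ly; have [|/ltW] := leP (g x) (g y); first exact: mono.
  by rewrite distrC [(`|x - y|)%R]distrC; exact: mono.
split.
  exists x0, (gam 1%R); have L1 := arc_homo ap I1; split => //.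
  apply/negP => /eqP fe; have := congr1 EFin fe; rewrite !fE// gx0 chart_arc1 (arc_gK ap)//.
  rewrite hausdorff_measure1 ?(lt_trans _ s1)// => H0.
  move: HL0; rewrite ltNge => /negP; apply; rewrite H0.
  apply: hausdorff_measure_le => x Lx; exists (g x); last exact: (arc_gamK ap).
  by rewrite /= in_itv/=; exact: gI.
exact: (whitney_extension cL (ex_intro _ _ Lx0) s1 c0 fH).
Qed.

End RegularArc.

Theorem theorem6p3 (R : realType) (l q : nat) (z : nat -> Rcomplex R)
    (S : nat -> Rcomplex R -> Rcomplex R) (Lambda : set (Rcomplex R)) (s : R)
    (regular : regular_self_similar_arc l q z S Lambda)
    (dim_s : hausdorff_dim Lambda = s%:E)
    (theta_pos : 0 < theta_min l q z S) :
  (forall t : R, 1 <= t -> quasi_arc t Lambda) /\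
  (forall x, Lambda x ->
    hausdorff_measure s (subarc Lambda (z 0%N) x) \is a fin_num) /\
  whitney_function Lambda
    (fun x => fine (hausdorff_measure s (subarc Lambda (z 0%N) x))).
Proof.
have [bf pos att arc _] := regular.
have [gam [g [ap g01]]] := oriented_arc_pair bf pos att arc.
have ch := arc_chart bf pos theta_pos att ap g01.
have [[gam_cont _] _ _ _] := ap.
have gamK t : 0 <= t <= 1 -> g (gam t) = t by exact: arc_gK ap _.
have S_gam := arc_chart_map att ap.
have S_dist j x y := @similitude_dist _ _ _ _ _ bf pos j x y.
have LE : chart_arc gam 0 1 = Lambda.
  apply/seteqP; split=> [_ [t /= + <-]|x Lx].
    by rewrite in_itv; exact: arc_homo ap _.
  by exists (g x); [rewrite /= in_itv; exact: arc_itv ap _ Lx|exact: arc_gamK ap _ Lx].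
have [c c0 turning] := chart_bounded_turning ch S_gam S_dist.
have [D D0 LD] := attractor_bounded att.
split=> [t t1|].
  apply: (quasi_arc_bounded_turning c0 t1 _ LD) => x y Lx Ly.
  rewrite (subarcE ap Lx Ly).
  have [/andP[x0 x1] /andP[y0 y1]] := (arc_itv ap Lx, arc_itv ap Ly).
  have [xy|/ltW yx] := leP (g x) (g y).
    by have := turning _ _ x0 xy y1; rewrite !(arc_gamK ap).
  by have := turning _ _ y0 yx x1; rewrite !(arc_gamK ap)// distrC.
have [sg [s1 dimE fin pos_measure [k k0 kP]]] :=
  chart_dimension ch gamK gam_cont S_gam S_dist (ratio_sum bf pos).
rewrite LE in dimE fin pos_measure.
(* The exponent of the chart and [s] are both the Hausdorff dimension of [Lambda]. *)
have sE : sg = s by apply: EFin_inj; rewrite -dimE.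
rewrite {}sE in s1 fin pos_measure kP; have [cL _ _] := att.
apply: (whitney_function_hausdorff cL ap _ _ s1 k0) => //.
- exact: vertex_attractor bf pos att _ _.
- exact: (arc_start bf pos att ap g01).
- by rewrite pos_measure.
Qed.
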